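(* Let $n\geq 3$ and let $\Gamma_n$ be the countable universal homogeneous generalized $n$-gon, i.e. the Fraïssé limit of the class $\mathcal{C}_n$. For finitely generated substructures $A,B,C$ of $\Gamma_n$ define $A\perp_C B$ if and only if the free amalgam $\langle AC\rangle\otimes_C\langle BC\rangle$ is $n$-strong in the substructure $\langle ABC\rangle\subseteq\Gamma_n$. Then $\perp$ is a stationary independence relation on $\Gamma_n$.
   Context: Graphs. A subgraph means an induced subgraph. The graph metric $d^G(x,y)$ is the length of a shortest path from $x$ to $y$ in $G$. The diameter of $G$ is the least $m\in\mathbb{N}$ such that any two vertices are at distance at most $m$; the girth is the length of a shortest cycle. A generalized $n$-gon is a bipartite graph of diameter $n$ and girth $2n$. Language. Generalized $n$-gons (and bipartite graphs) $\Gamma$ are considered in the language $L_n=\{P,f_k\mid k=0,\dots,n\}$, where $P$ is a predicate for the sort of the bipartition of the vertex set and the $f_k$ are binary functions with $f_k(x,y)=x_k$ if $d^\Gamma(x,y)=l\geq k$ and there is a unique shortest path $(x=x_0,\dots,x_k,\dots,x_l=y)$ from $x$ to $y$, and $f_k(x,y)=x$ if there is no such unique path or $d^\Gamma(x,y)<k$. $\langle\cdot\rangle$ denotes the generated $L_n$-substructure. Free $n$-completion. For a connected bipartite graph $G$ without cycles of length less than $2n$, put $\mathcal{F}_0(G)=G$; given $\mathcal{F}_i(G)$, let $\mathcal{F}_{i+1}(G)$ be obtained by adding, for every pair $x,y\in\mathcal{F}_i(G)$ with $d^{\mathcal{F}_i(G)}(x,y)=n+1$, a new path $(x=x_0,x_1,\dots,x_{n-2},x_{n-1}=y)$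 of length $n-1$ with $x_1,\dots,x_{n-2}$ new vertices. The free $n$-completion is $\mathcal{F}(G)=\bigcup_{i}\mathcal{F}_i(G)$. $\mathcal{C}_n$ is the class of all free $n$-completions of finite connected bipartite graphs without cycles of length less than $2n$, together with their $L_n$-substructures. By a theorem of Tent, $\mathcal{C}_n$ is a Fraïssé class; its countable homogeneous Fraïssé limit is denoted $\Gamma_n$. $n$-strong. For a finite graph $H$ with vertex set $V_H$ and edge set $E_H$ let $\chi_n(H)=(n-1)|V_H|-(n-2)|E_H|$. For possibly infinite graphs $X\subseteq Y$, $X$ is $n$-strong in $Y$ ($X\leq_n Y$) if $\chi_n(H)-\chi_n(H\cap X)\geq 0$ for all finite subgraphs $H\subseteq Y$. Free amalgam. For graphs $A,B$ with common subgraph $C$, $A\otimes_C B$ is the disjoint union of $A$ and $B$ over $C$ with no edges other than those of $A$ and of $B$. The condition ''$\langle AC\rangle\otimes_C\langle BC\rangle$ is $n$-strong in $\langle ABC\rangle$'' includes that the subgraph of $\langle ABC\rangle$ on $\langle AC\rangle\cup\langle BC\rangle$ is this free amalgam. Stationary independence relation. The type of a finitely generated substructure is the type of a fixed finite generating tuple. A ternary relation $A\perp_C B$ on the finitely generated substructures of a homogeneous structure $M$ is a stationary independence relation if for all finitely generated substructures: (Invariance) whether $A\perp_C B$ holds depends only on the type of $(A,B,C)$ in $M$; in particular $A\perp_C B$ iff $f(A)\perp_{f(C)}f(B)$ for every $f\in\operatorname{Aut}(M)$. (Symmetry) $A\perp_C B$ implies $B\perp_C A$. (Monotonicity) $A\perp_C\langle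 BD\rangle$ implies $A\perp_C B$ and $A\perp_{\langle BC\rangle}D$. (Existence) For all $A,B,C$ there is $A'$ in $M$ realizing $\operatorname{tp}(A/C)$ with $A'\perp_C B$. (Stationarity) If $A$ and $A'$ have the same type over $C$ and $A\perp_C B$, $A'\perp_C B$, then $A$ and $A'$ have the same type over $\langle BC\rangle$.
   Formalization: C_n is taken to consist of L_n-substructures of those free n-completions that are generalized n-gons; literally, a path of length n is its own completion and has no joint embedding with a 2n-cycle, so C_n would not be a Fraïssé class. *)

(* Defs.v *)
From HB Require Import structures.
From mathcomp Require Import all_boot all_order all_algebra finmap.
From mathcomp Require Import all_classical.

Set Implicit Arguments.
Unset Strict Implicit.
Unset Printing Implicit Defensive.

Import Order.TTheory GRing.Theory Num.Theory.

Local Open Scope classical_set_scope.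

(** * Graphs *)

(* Raw data of a graph with a 2-sorted vertex set; the axioms are in
   [bipartite].  [part] interprets the predicate P. *)
Record graph := Graph {
  vert :> choiceType;
  part : pred vert;
  adj : rel vert }.

Definition bipartite (G : graph) :=
  symmetric (@adj G) /\ forall x y : G, adj x y -> part x != part y.

Definition induced (G : graph) (X : set G) : graph :=
  @Graph (set_type X) (fun x => part (val x)) (fun x y => adj (val x) (val y)).

(* [x :: p] is a walk from [x] to [y]; its length is [size p]. *)
Definition walk (G : graph) (x y : G) (p : seq G) : Prop :=
  path (@adj G) x p /\ last x p = y.

(* Shortest walks are the same thing as shortest paths. *)
Definition geodesic (G : graph) (x y : G) (p : seq G) : Prop :=
  walk x y p /\ forall q, walk x y q -> size p <= size q.

(* d^G(x, y) = m; no [m] works if [x] and [y] are not connected. *)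
Definition dist_eq (G : graph) (x y : G) (m : nat) : Prop :=
  exists2 p, geodesic x y p & size p = m.

Definition connected_graph (G : graph) := forall x y : G, exists p, walk x y p.

Definition is_cycle (G : graph) (c : seq G) : Prop :=
  [/\ 2 < size c, uniq c & cycle (@adj G) c].

Definition diam_le (G : graph) (m : nat) :=
  forall x y : G, exists2 l, dist_eq x y l & l <= m.

Definition has_diameter (G : graph) (m : nat) :=
  diam_le G m /\ forall l, diam_le G l -> m <= l.

Definition girth_ge (G : graph) (m : nat) :=
  forall c : seq G, is_cycle c -> m <= size c.

Definition has_girth (G : graph) (m : nat) :=
  girth_ge G m /\ exists2 c : seq G, is_cycle c & size c = m.

Definition generalized_ngon (n : nat) (G : graph) :=
  [/\ bipartite G, has_diameter G n & has_girth G (2 * n)].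

(** * The language L_n *)

Record Lstruct (n : nat) := LStruct {
  dom :> choiceType;
  sP : pred dom;
  sf : 'I_n.+1 -> dom -> dom -> dom }.

Definition unique_geodesic (G : graph) (x y : G) (p : seq G) : Prop :=
  geodesic x y p /\ forall q, geodesic x y q -> q = p.

(* If there is no unique geodesic then [xget] returns [::]; in this case, and
   when [k] exceeds the distance, the default value [x] of [nth] is returned. *)
Definition fk (G : graph) (k : nat) (x y : G) : G :=
  nth x (x :: xget [::] [set p | unique_geodesic x y p]) k.

Definition Ln (n : nat) (G : graph) : Lstruct n :=
  @LStruct n (vert G) (@part G) (fun k => @fk G k).

Definition substructure n (M : Lstruct n) (S : set M) :=
  forall (k : 'I_n.+1) (x y : M), S x -> S y -> S (sf k x y).

Definition gen n (M : Lstruct n) (A : set M) : set M :=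
  smallest (@substructure n M) A.

Definition gens n (M : Lstruct n) (s : seq M) : set M := gen [set` s].

Definition fg_sub n (M : Lstruct n) (A : set M) := exists s, A = gens s.

Definition fg_struct n (M : Lstruct n) := fg_sub [set: M].

Definition embedding n (M N : Lstruct n) (e : M -> N) :=
  [/\ injective e, forall x, sP (e x) = sP x
    & forall k x y, e (sf k x y) = sf k (e x) (e y)].

Definition embeds n (M N : Lstruct n) := exists e : M -> N, embedding e.

Definition automorphism n (M : Lstruct n) (h : M -> M) :=
  bijective h /\ embedding h.

(* [g] restricts to an isomorphism between the substructures [A] and [B];
   its values outside [A] are irrelevant. *)
Definition partial_iso n (M : Lstruct n) (A B : set M) (g : M -> M) :=
  [/\ set_bij A B g, forall x, A x -> sP (g x) = sP x
    & forall k x y, A x -> A y -> g (sf k x y) = sf k (g x) (g y)].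

Definition homogeneous n (M : Lstruct n) :=
  forall (A B : set M) (g : M -> M), fg_sub A -> fg_sub B ->
    partial_iso A B g ->
    exists2 h : M -> M, automorphism h & forall x, A x -> h x = g x.

(* The age of the limit consists of the finitely generated members of [K]. *)
Definition fraisse_limit n (K : Lstruct n -> Prop) (M : Lstruct n) :=
  [/\ countable [set: M], homogeneous M
    & forall A : Lstruct n, fg_struct A -> (embeds A M <-> K A)].

(** * Free completions *)

(* All stages live in one ambient type: [fnew x y k] is the [k]-th vertex of the
   path added between [x] and [y]. *)
Inductive fvert (V : Type) : Type :=
  | fbase of V
  | fnew of fvert V & fvert V & nat.
Arguments fnew {V}.

HB.instance Definition _ (V : Type) := gen_eqMixin (fvert V).
HB.instance Definition _ (V : Type) := gen_choiceMixin (fvert V).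

Section FreeCompletion.
Variables (n : nat) (G : graph).

(* The vertex x_k of the path (x = x_0, ..., x_{n-1} = y). *)
Definition path_vertex (x y : fvert G) (k : nat) : fvert G :=
  if k == 0 then x else if k == n.-1 then y else fnew x y k.

Inductive fedge : fvert G -> fvert G -> Prop :=
  | fedge_base (u v : G) : adj u v -> fedge (fbase u) (fbase v)
  | fedge_path x y k : k < n.-1 ->
      fedge (path_vertex x y k) (path_vertex x y k.+1)
  | fedge_sym u v : fedge u v -> fedge v u.

Fixpoint fpart (v : fvert G) : bool :=
  match v with
  | fbase u => part u
  | fnew x y k => fpart x (+) odd k
  end.

(* Also contains junk vertices; only induced subgraphs of it are used.  For
   n >= 3 every edge of an added path has an endpoint [fnew x y k] with
   0 < k < n - 1, so a later stage adds no edge inside an earlier one. *)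
Definition ambient : graph := @Graph (fvert G) fpart (fun u v => `[< fedge u v >]).

(* Selects exactly one orientation of each pair of distinct vertices, so that a
   single path is added for each unordered pair. *)
Definition oriented (x y : fvert G) : bool :=
  choose [pred z | (z == x) || (z == y)] x == x.

Fixpoint stage (i : nat) : set ambient :=
  if i is j.+1 then
    stage j `|` [set v | exists (x y : induced (stage j)) (k : nat),
      [/\ dist_eq x y n.+1, oriented (val x) (val y), 0 < k < n.-1
        & v = fnew (val x) (val y) k]]
  else range (@fbase G).

Definition free_completion : graph := induced (\bigcup_i stage i).

End FreeCompletion.

(* A tree of diameter at most n is its own free completion and so is not a
   generalized n-gon.  Those of diameter n do not embed, as L_n-structures, into
   any generalized n-gon (their end vertices are joined by a unique geodesic),
   which would destroy joint embedding; those of smaller diameter still occur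
   below as substructures. *)
Definition free_class (n : nat) (A : Lstruct n) : Prop :=
  exists G : graph,
    [/\ finite_set [set: G], bipartite G, connected_graph G & girth_ge G (2 * n)]
    /\ generalized_ngon n (free_completion n G)
    /\ embeds A (Ln n (free_completion n G)).

(** * Strong subgraphs and the independence relation *)

Section Strong.
Variable G : graph.

Definition edges (H : {fset G}) : {fset {fset G}} :=
  [fset [fset x; y]%fset | x in H, y in H & adj x y]%fset.

Definition chi (n : nat) (H : {fset G}) : int :=
  ((n%:Z - 1) * (#|` H|)%:Z - (n%:Z - 2) * (#|` edges H|)%:Z)%R.

Definition strong (n : nat) (X Y : set G) :=
  X `<=` Y /\
  forall H : {fset G}, [set` H] `<=` Y ->
    (0 <= chi n H - chi n [fset x in H | x \in X]%fset)%R.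

(* The induced subgraph on [X `|` Y] is the free amalgam of [X] and [Y]
   over [Z]. *)
Definition free_amalgam (X Y Z : set G) :=
  X `&` Y = Z /\
  forall x y, (X `|` Y) x -> (X `|` Y) y -> adj x y ->
    (X x /\ X y) \/ (Y x /\ Y y).

End Strong.

(* [ngon_indep A B C] is "A is independent from B over C". *)
Definition ngon_indep (n : nat) (G : graph) (A B C : set (Ln n G)) : Prop :=
  let AC : set G := gen (A `|` C) in
  let BC : set G := gen (B `|` C) in
  let ABC : set G := gen (A `|` B `|` C) in
  free_amalgam AC BC C /\ strong n (AC `|` BC) ABC.

(** * First-order types *)

Inductive term (n m : nat) : Type :=
  | TVar of 'I_m
  | TApp of 'I_n.+1 & term n m & term n m.

(* [formula n m]: first-order L_n-formulas with free variables in 'I_m; the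
   variable bound by [FAll] is [ord0], the others being shifted by one. *)
Inductive formula (n : nat) : nat -> Type :=
  | FEq m of term n m & term n m : formula n m
  | FP m of term n m : formula n m
  | FBot m : formula n m
  | FImp m of formula n m & formula n m : formula n m
  | FAll m of formula n m.+1 : formula n m.

Fixpoint eval n (M : Lstruct n) m (v : 'I_m -> M) (t : term n m) : M :=
  match t with
  | TVar i => v i
  | TApp k t1 t2 => sf k (eval v t1) (eval v t2)
  end.

Fixpoint sat n (M : Lstruct n) m (phi : formula n m) : ('I_m -> M) -> Prop :=
  match phi with
  | FEq _ t1 t2 => fun v => eval v t1 = eval v t2
  | FP _ t => fun v => sP (eval v t)
  | FBot _ => fun _ => False
  | FImp _ f1 f2 => fun v => sat f1 v -> sat f2 v
  | FAll _ f => fun v =>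
      forall a : M, sat f (fun i => oapp v a (unlift ord0 i))
  end.

(* tp(a/C) = tp(a'/C), the parameters from C being listed in the tuple [c]. *)
Definition same_type n (M : Lstruct n) (C : set M) m (a a' : m.-tuple M) : Prop :=
  forall p (c : p.-tuple M) (phi : formula n (m + p)),
    (forall i, C (tnth c i)) ->
    (sat phi (tnth [tuple of a ++ c]) <-> sat phi (tnth [tuple of a' ++ c])).

(* [ind A B C] reads "A is independent from B over C".  Finitely generated
   substructures whose type is considered are given by a generating tuple. *)
Record stationary_independence n (M : Lstruct n)
    (ind : set M -> set M -> set M -> Prop) : Prop := StationaryIndependence {
  ind_invariance : forall p q r (a a' : p.-tuple M) (b b' : q.-tuple M)
      (c c' : r.-tuple M),
    same_type set0 [tuple of a ++ b ++ c] [tuple of a' ++ b' ++ c'] ->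
    (ind (gens a) (gens b) (gens c) <-> ind (gens a') (gens b') (gens c'));
  ind_automorphism : forall (h : M -> M) (A B C : set M),
    automorphism h -> fg_sub A -> fg_sub B -> fg_sub C ->
    (ind A B C <-> ind (h @` A) (h @` B) (h @` C));
  ind_symmetry : forall A B C : set M,
    fg_sub A -> fg_sub B -> fg_sub C -> ind A B C -> ind B A C;
  ind_monotonicity : forall A B C D : set M,
    fg_sub A -> fg_sub B -> fg_sub C -> fg_sub D ->
    ind A (gen (B `|` D)) C ->
    ind A B C /\ ind A D (gen (B `|` C));
  ind_existence : forall m (a : m.-tuple M) (B C : set M),
    fg_sub B -> fg_sub C ->
    exists2 a' : m.-tuple M, same_type C a a' & ind (gens a') B C;
  ind_stationarity : forall m (a a' : m.-tuple M) (B C : set M),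
    fg_sub B -> fg_sub C -> same_type C a a' ->
    ind (gens a) B C -> ind (gens a') B C ->
    same_type (gen (B `|` C)) a a' }.

(* Main.v *)
(* Call a set of vertices convex if it contains every path of length less than n
   between two of its points.  In a generalized n-gon such paths are unique and
   geodesics of length n are not, so that the substructures are the convex sets,
   and two vertices of the right parity are joined by a path of length at most
   n - 1.

   If Y is strong in a convex set Z, counting edges shows that a path of length at
   most n - 1 in Z which leaves Y has length exactly n - 1, lies outside Y except
   for its ends and carries no other edges to Y, and that adding it to Y yields
   again a strong set.  Zorn's lemma then gives two facts.  Firstly, a graph
   isomorphism between sets which are strong in their hulls extends to the hulls,
   because both sides acquire the same paths; this is stationarity.  Secondly, if X
   is convex relative to a strong Y, then X is strong in its hull, which meets Y in
   X and forms with Y a free amalgam which is strong again; this is monotonicity.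

   For existence, let A, B and C lie in the free completion F(G) of a finite graph
   G.  A stage G1 of F(G) which contains generators of C is finite and strong.  As
   C is convex, gluing two copies of G1 along C yields a finite graph of girth at
   least 2n; by the two facts its free completion contains two copies of F(G)
   freely amalgamated over C.  It embeds into the limit, and homogeneity moves A. *)

Require Import Defs.
From mathcomp Require Import all_boot all_order all_algebra finmap.
From mathcomp Require Import all_classical.
From mathcomp Require Import zify.

Set Implicit Arguments.
Unset Strict Implicit.
Unset Printing Implicit Defensive.

Import Order.TTheory GRing.Theory Num.Theory.

Local Open Scope classical_set_scope.

(** * Paths and convex sets *)

(** The coefficients of [chi] are tuned to one event: a path of length l attached by its two ends
    brings l - 1 vertices and l edges and changes [chi] by l - (n - 1). Strength therefore excludes
    short detours, and those of length n - 1 are free.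

    Isomorphisms are extended by one such path at a time. The images of its ends have the right
    parity to be joined by a path of length at most n - 1. By girth this path does not lie in the
    range already, and counting then shows that it runs outside the range except for its ends.

    Two obstacles shape the existence part. The free completion of the glued graph is not known
    beforehand to be a generalized n-gon, so isomorphisms are extended using only bounds on diameter
    and girth; the completion is recognized afterwards by a convex copy of F(G) inside it. Over an
    empty C the glued graph is disconnected; there independence is taken over a single vertex far
    from everything concerned, and the second fact serves to discard that vertex. *)

Lemma split_seq (T : eqType) (x : T) (p : seq T) :
  x \in p -> exists p1 p2, p = p1 ++ x :: p2.
Proof. by move=> xp; case/splitPr: xp => p1 p2; exists p1, p2. Qed.

Lemma split_first (T : Type) (a : pred T) (s : seq T) :
  has a s -> exists s1 x s2, [/\ s = s1 ++ x :: s2, a x & ~~ has a s1].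
Proof.
by case/split_find => x s1 s2 ax ns1; exists s1, x, s2; rewrite cat_rcons.
Qed.

Lemma split_last (T : eqType) (a : pred T) (x : T) (s : seq T) : a x ->
  exists s1 s2, [/\ s = s1 ++ s2, a (last x s1) & ~~ has a s2].
Proof.
move=> ax; elim/last_ind: s => [|s y [s1 [s2 [-> a1 n2]]]].
  by exists [::], [::].
have [ay|nay] := boolP (a y).
  by exists (rcons (s1 ++ s2) y), [::]; rewrite cats0 last_rcons.
by exists s1, (rcons s2 y); rewrite rcons_cat has_rcons (negbTE nay).
Qed.

(* [q] is the part outside [a] of the walk [x :: p] around its vertex [w]. *)
Lemma segment (T : eqType) (a : pred T) (x w : T) (p : seq T) :
    a x -> a (last x p) -> w \in p -> ~~ a w ->
  exists p1 q b p3, [/\ p = p1 ++ rcons q b ++ p3, a (last x p1), a b,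
    w \in q & ~~ has a q].
Proof.
move=> ax al /split_seq[p' [p'' Ep]] naw.
have hp : has a p''.
  apply: contraTT al => np; rewrite Ep last_cat /=.
  have := mem_last w p''; rewrite inE => /predU1P[->//|lp].
  by apply: contra np => al; apply/hasP; exists (last w p'').
have [q2 [b [p3 [Ep'' ab nq2]]]] := split_first hp.
have [p1 [q1 [Ep' al1 nq1]]] := split_last p' ax.
exists p1, (q1 ++ w :: q2), b, p3; split=> //.
- by rewrite Ep Ep' Ep'' cat_rcons -!catA.
- by rewrite mem_cat mem_head orbT.
- by rewrite has_cat /= !negb_or nq1 naw.
Qed.

Section Paths.
Variable G : graph.
Hypothesis adjS : symmetric (@adj G).
Implicit Types (x y z a b : G) (p q : seq G) (X Y Z : set G).

Definition upath x p := path (@adj G) x p && uniq (x :: p).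

Lemma upath_catl x p q : upath x (p ++ q) -> upath x p.
Proof.
rewrite /upath cat_path -cat_cons cat_uniq.
by move=> /andP[/andP[-> _] /and3P[-> _ _]].
Qed.

Lemma upath_catr x p q : upath x (p ++ q) -> upath (last x p) q.
Proof.
rewrite /upath cat_path -cat_cons lastI cat_rcons cat_uniq.
by move=> /andP[/andP[_ ->]] /and3P[].
Qed.

Lemma upath_rev x p : upath x p -> upath (last x p) (rev (belast x p)).
Proof.
rewrite /upath => /andP[xp u]; apply/andP; split.
  by rewrite rev_path (eq_path (e' := @adj G)) // => u' v; rewrite adjS.
by rewrite -rev_rcons rev_uniq -lastI.
Qed.

Lemma last_rev_belast x p : last (last x p) (rev (belast x p)) = x.
Proof. by case: p => //= y p; rewrite rev_cons last_rcons. Qed.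

Lemma walk_upath x p : path (@adj G) x p ->
  exists q, [/\ upath x q, last x q = last x p, size q <= size p
    & {subset q <= p}].
Proof.
move=> /shortenP[q xq uq sub]; exists q; split=> //; first by apply/andP.
by apply: uniq_leq_size sub; move: uq => /= /andP[].
Qed.

(** After the common first edges are stripped, the first vertex of [p] on [q] closes a cycle: along
    [p] to that vertex and back along [q]. Its length is at most [size p + size q]. *)
Lemma upath_unique m x p q : girth_ge G m -> upath x p -> upath x q ->
  last x p = last x q -> size p + size q < m -> p = q.
Proof.
move=> gG; elim: p x q => [|y p IH] x [|z q] //.
- by move=> _ /andP[_ /=]/andP[nx _] Ex; case/negP: nx; rewrite {1}Ex mem_last.
- by move=> /andP[_ /=]/andP[nx _] _ Ex; case/negP: nx; rewrite -{1}Ex mem_last.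
move=> up uq; have [Eyz|nyz] := eqVneq y z.
  rewrite -Eyz in uq *; move=> /= El lt; congr cons.
  apply: (IH y) => //; last by lia.
    by move: up; rewrite -[y :: p]cat1s => /upath_catr.
  by move: uq; rewrite -[y :: q]cat1s => /upath_catr.
move=> El lt; exfalso.
have hq : has (mem (z :: q)) (y :: p).
  apply/hasP; exists (last y p); first exact: mem_last.
  by rewrite (El : last y p = last z q); apply: (mem_last z q).
have [p1 [w [p2 [Ep wq np1]]]] := split_first hq.
have [q1 [q2 Eq]] := split_seq wq.
move: up uq; rewrite Ep Eq -!cat_rcons => /upath_catl up /upath_catl uq.
have cyc : is_cycle (x :: p1 ++ w :: rev q1).
  split.
  - rewrite /= size_cat /= size_rev.
    rewrite addnS !ltnS; case: (posnP (size p1 + size q1)) => [/eqP|//].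
    rewrite addn_eq0 => /andP[/nilP E1 /nilP E2].
    move: Ep Eq nyz; rewrite E1 E2 /= => -[-> _] [-> _].
    by rewrite eqxx.
  - rewrite -cat_rcons -cat_cons cat_uniq.
    move: up uq => /andP[_ up] /andP[_ uq].
    rewrite up /= rev_uniq; apply/andP; split.
      apply/hasPn => v; rewrite mem_rev => vq; rewrite /= inE mem_rcons inE.
      apply/negP => /or3P[/eqP Ev|/eqP Ev|vp].
      + by move: uq => /= /andP[]; rewrite mem_rcons inE -Ev vq orbT.
      + by move: uq => /= /andP[_]; rewrite rcons_uniq -Ev vq.
      + case/negP: np1; apply/hasP; exists v => //.
        by rewrite inE Eq mem_cat vq.
    by move: uq; rewrite /= rcons_uniq => /and3P[].
  - rewrite /= rcons_cat -cat_rcons cat_path.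
    move: up (upath_rev uq) => /andP[-> _] /=.
    rewrite !last_rcons belast_rcons rev_cons => /andP[+ _].
    by [].
have := gG _ cyc; rewrite /= size_cat /= size_rev.
have := congr1 size Ep; have := congr1 size Eq; rewrite !size_cat /=.
move: lt => /=; lia.
Qed.

(** Paths are listed without their first vertex, so the excursion has length [(size q).+1]. [upath]
    makes the ends distinct, and [q != [::]] excludes a mere edge between points of [X]. *)
Definition excursion X a q b :=
  [/\ X a, X b, upath a (rcons q b), q != [::] & forall z, z \in q -> ~ X z].

(** The last clause is for excursions that counting forces to have length [n - 1]: inside a path of
    length below [n] nothing can have been cut off, so the excursion is the path itself. *)
Lemma path_excursion X x p w : upath x p -> X x -> X (last x p) ->
  w \in p -> ~ X w ->
  exists a q b, [/\ excursion X a q b, w \in q, {subset rcons q b <= p},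
    (size q).+1 <= size p & size p <= (size q).+1 -> a = x /\ p = rcons q b].
Proof.
move=> up Xx Xl wp nXw.
have [||//||p1 [q [b [p3 [Ep Xa Xb wq nq]]]]] :=
  @segment _ (mem X) x w p; try exact: mem_set.
  by apply/negP => /set_mem.
exists (last x p1), q, b; split=> //.
- split; try exact: set_mem.
  + by move: up; rewrite Ep => /upath_catr /upath_catl.
  + by move: wq; case: (q).
  + by move=> z zq Xz; case/negP: nq; apply/hasP; exists z => //; apply: mem_set.
- by move=> z zq; rewrite Ep !mem_cat zq orbT.
- by rewrite Ep !size_cat size_rcons; lia.
- have E i j k : i + (j.+1 + k) <= j.+1 -> i = 0 /\ k = 0 by lia.
  rewrite Ep !size_cat size_rcons => /E[/size0nil -> /size0nil ->].
  by rewrite cats0.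
Qed.

(** Only paths inside [Y] are tested, since a set that is closed within a strong [Y] may still have
    a larger hull, growing outside [Y]. *)
Definition rconvex n X Y := forall x p, upath x p -> size p < n ->
  X x -> X (last x p) -> (forall z, z \in p -> Y z) -> forall z, z \in p -> X z.

(* In a generalized [n]-gon the convex sets are the [L_n]-substructures. *)
Definition convex n X := rconvex n X setT.

Lemma rconvexP n X Y :
  (forall a q b, excursion X a q b -> (size q).+1 < n ->
     (forall z, z \in q -> Y z) -> False) ->
  rconvex n X Y.
Proof.
move=> H x p up sp Xx Xl pY z zp; apply: contrapT => nXz.
have [a [q [b [exc zq sub le _]]]] := path_excursion up Xx Xl zp nXz.
apply: (H a q b exc); first exact: leq_ltn_trans le sp.
by move=> u uq; apply: pY; apply: sub; rewrite mem_rcons inE uq orbT.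
Qed.

Lemma convexP n X :
  (forall a q b, excursion X a q b -> (size q).+1 < n -> False) -> convex n X.
Proof. by move=> H; apply: rconvexP => a q b e lt _; apply: (H a q b). Qed.

Lemma not_convex n X : ~ convex n X ->
  exists a q b, excursion X a q b /\ (size q).+1 < n.
Proof.
move=> nX; apply: contrapT => H; apply: nX; apply: convexP => a q b e lt.
by apply: H; exists a, q, b.
Qed.

Lemma excursion_rconvex n X Y a q b : rconvex n X Y -> excursion X a q b ->
  (forall z, z \in q -> Y z) -> Y b -> (size q).+1 < n -> False.
Proof.
move=> cX [Xa Xb u nq nX] qY Yb lt.
case: q nq u nX qY lt => // z q _ u nX qY lt.
apply: (nX z (mem_head _ _)).
apply: (cX a (rcons (z :: q) b)) => //; rewrite ?size_rcons ?last_rcons //.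
  by move=> v; rewrite mem_rcons inE => /predU1P[->//|]; apply: qY.
by rewrite mem_rcons inE mem_head orbT.
Qed.

Lemma excursion_convex n X a q b : convex n X -> excursion X a q b ->
  (size q).+1 < n -> False.
Proof. by move=> cX e; apply: (excursion_rconvex cX e). Qed.

Lemma excursion_sub n X Z a q b : convex n Z -> X `<=` Z ->
  excursion X a q b -> (size q).+1 < n -> forall z, z \in q -> Z z.
Proof.
move=> cZ XZ [Xa Xb u _ _] lt z zq.
apply: (cZ a (rcons q b)) => //; rewrite ?size_rcons ?last_rcons //.
- exact: XZ.
- exact: XZ.
- by rewrite mem_rcons inE zq orbT.
Qed.

Definition hull n X := smallest (convex n) X.

Lemma hull_convex n X : convex n (hull n X).
Proof.
move=> x p up sp hx hl _ z zp S [cS XS].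
by apply: (cS x p) => //; [apply: hx|apply: hl].
Qed.

Lemma sub_hull n X : X `<=` hull n X.
Proof. exact: sub_gen_smallest. Qed.

Lemma hull_min n X S : convex n S -> X `<=` S -> hull n X `<=` S.
Proof. exact: smallest_sub. Qed.

Lemma hullS n X Y : X `<=` Y -> hull n X `<=` hull n Y.
Proof.
move=> XY; apply: hull_min; first exact: hull_convex.
by apply: (subset_trans XY); apply: sub_hull.
Qed.

Lemma hull_id n X : convex n X -> hull n X = X.
Proof. exact: smallest_id. Qed.

End Paths.

(** * Strong subgraphs *)

Section Strong.
Variable G : graph.
Implicit Types (x y z a b : G) (p q : seq G) (X Y Z : set G) (H K : {fset G}).

Lemma edgesP H e :
  reflect (exists x y, [/\ x \in H, y \in H, adj x y & e = [fset x; y]%fset])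
    (e \in edges H).
Proof.
apply: (iffP (imfset2P _ _ _ _ _)) => [[x xH [y /=]]|[x [y [xH yH xy ->]]]].
  by rewrite inE => /andP[/= yH xy] ->; exists x, y.
by exists x => //; exists y => //; rewrite inE /= yH.
Qed.

(** What [H] adds to its trace on [X]. An edge counts as new as soon as one of its ends is outside
    [X]. *)
Definition nv H X := [fset x in H | x \notin X]%fset.
Definition ne H X := (edges H `\` edges [fset x in H | x \in X])%fset.

Lemma edgesS H K : (H `<=` K)%fset -> (edges H `<=` edges K)%fset.
Proof.
move=> /fsubsetP sub; apply/fsubsetP => e /edgesP[x [y [xH yH xy ->]]].
by apply/edgesP; exists x, y; split => //; apply: sub.
Qed.

Lemma fset_in_eq H X x : (x \in [fset x in H | x \in X]%fset) =
  (x \in H) && (x \in X).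
Proof. by rewrite !inE. Qed.

Lemma in_fset_seq (T : choiceType) (s : seq T) (x : T) :
  (x \in [fset y in s]%fset) = (x \in s).
Proof. by rewrite !inE. Qed.

Lemma nvP H X x : reflect (x \in H /\ ~ X x) (x \in nv H X).
Proof.
rewrite /nv !inE /=; apply: (iffP andP) => -[xH nX]; split => //.
  by move=> Xx; case/negP: nX; apply: mem_set.
by apply/negP => /set_mem.
Qed.

Lemma fset2_eqE x y u v : [fset x; y]%fset = [fset u; v]%fset ->
  (x = u \/ x = v) /\ (y = u \/ y = v).
Proof.
move=> E; have : x \in [fset u; v]%fset by rewrite -E !inE eqxx.
have : y \in [fset u; v]%fset by rewrite -E !inE eqxx orbT.
by rewrite !inE => /orP[]/eqP-> /orP[]/eqP->; split; auto.
Qed.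

Lemma neP H X e : reflect (exists x y,
    [/\ x \in H, y \in H, adj x y, e = [fset x; y]%fset & ~ (X x /\ X y)])
  (e \in ne H X).
Proof.
rewrite /ne in_fsetD; apply: (iffP andP).
  case=> [nX /edgesP[x [y [xH yH xy Ee]]]].
  exists x, y; split=> // -[Xx Xy]; case/negP: nX.
  by apply/edgesP; exists x, y; rewrite !fset_in_eq xH yH !mem_set.
case=> x [y [xH yH xy -> nX]]; split; last by apply/edgesP; exists x, y.
apply/negP => /edgesP[u [v [uK vK _ Euv]]]; apply: nX.
move: uK vK; rewrite !fset_in_eq => /andP[_ /set_mem Xu] /andP[_ /set_mem Xv].
by have [[->|->] [->|->]] := fset2_eqE Euv.
Qed.

(** Vertices and edges of the trace are among those of [H], so the integer difference splits into
    two honest counts and strength becomes an inequality in [nat]. *)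
Lemma chi_diff n H X : 1 < n ->
  (0 <= chi n H - chi n [fset x in H | x \in X]%fset)%R <->
  (n - 2) * #|` ne H X| <= (n - 1) * #|` nv H X|.
Proof.
move=> n1; set K := [fset x in H | x \in X]%fset.
have KH : (K `<=` H)%fset.
  by apply/fsubsetP => x; rewrite fset_in_eq => /andP[].
have EV : #|` nv H X| = #|` H| - #|` K|.
  rewrite -cardfsDS //; congr #|` _|; apply/fsetP => x.
  by rewrite in_fsetD fset_in_eq !inE /=; case: (x \in H); case: (x \in X).
rewrite EV /ne cardfsDS ?edgesS // /chi.
have lV := fsubset_leq_card KH; have lE := fsubset_leq_card (edgesS KH).
move: lV lE; move: #|` H| #|` K| #|` edges H| #|` edges K| => h k h' k'.
case: n n1 => [|[|m]] // _ /subnKC <- /subnKC <-; rewrite !addKn.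
move: (h - k) (h' - k') => v e.
have -> : ((m.+2%:Z - 1) * (k + v)%:Z - (m.+2%:Z - 2) * (k' + e)%:Z -
    ((m.+2%:Z - 1) * k%:Z - (m.+2%:Z - 2) * k'%:Z) =
    (m.+1 * v)%N%:Z - (m * e)%N%:Z)%R by lia.
by rewrite subr_ge0 lez_nat -[m.+2 - 2]/(m - 0) subn0 subn1.
Qed.

Lemma strongP n X Z : 1 < n -> strong n X Z <-> X `<=` Z /\
  forall H, [set` H] `<=` Z -> (n - 2) * #|` ne H X| <= (n - 1) * #|` nv H X|.
Proof.
by move=> n1; split=> -[XZ sXZ]; split=> // H HZ; apply/chi_diff/sXZ.
Qed.

Lemma strong_refl n X : strong n X X.
Proof.
split=> // H HX; suff -> : [fset x in H | x \in X]%fset = H by rewrite subrr.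
apply/fsetP => x; rewrite fset_in_eq; case xH: (x \in H) => //=.
by rewrite mem_set //; apply: HX.
Qed.

(** The excess of [H] over its trace on [X] is the excess over its trace on [Y] plus the excess of
    that trace over the trace on [X]. *)
Lemma strong_trans n X Y Z : strong n X Y -> strong n Y Z -> strong n X Z.
Proof.
move=> [XY sXY] [YZ sYZ]; split=> [|H HZ]; first exact: subset_trans YZ.
set K := [fset x in H | x \in Y]%fset.
have KY : [set` K] `<=` Y by move=> x /=; rewrite fset_in_eq => /andP[_ /set_mem].
have := addr_ge0 (sYZ H HZ) (sXY K KY).
rewrite addrA subrK; congr (0 <= _ - chi _ _)%R.
apply/fsetP => x; rewrite !fset_in_eq -andbA; congr andb.
apply: andb_idl => /set_mem Xx; exact/mem_set/XY.
Qed.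

(** A finite [H] inside [Z'] has the same trace on [Y] as on [X]. *)
Lemma strong_inter n X Y Z Z' : strong n Y Z -> Z' `<=` Z -> X `<=` Z' ->
  Y `&` Z' = X -> strong n X Z'.
Proof.
move=> [YZ sYZ] Z'Z XZ' YZ'; split=> // H HZ'.
have := sYZ H (subset_trans HZ' Z'Z); congr (0 <= _ - chi _ _)%R.
apply/fsetP => x; rewrite !fset_in_eq; case xH: (x \in H) => //=.
apply/idP/idP => /set_mem h; apply/mem_set.
  by rewrite -YZ'; split => //; apply: HZ'.
by move: h; rewrite -YZ' => -[].
Qed.

Lemma strong_sub n X Z Z' : strong n X Z -> X `<=` Z' -> Z' `<=` Z ->
  strong n X Z'.
Proof.
by move=> sX XZ' Z'Z; apply: (strong_inter sX) => //; apply/setIidPl.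
Qed.

(** Strength is tested on one finite [H] at a time, and a single member of a chain covers all that
    the chain covers of [H]. This makes strength pass to unions of chains, as Zorn's lemma
    requires. *)
Lemma chain_seq (I : Type) (T : eqType) (D : set I) (f : I -> set T)
    (s : seq T) i0 : D i0 ->
    (forall i j, D i -> D j -> f i `<=` f j \/ f j `<=` f i) ->
  exists2 i, D i & forall y : T, y \in s -> (\bigcup_(j in D) f j) y -> f i y.
Proof.
move=> Di0 tot; elim: s => [|x s [i Di IH]]; first by exists i0.
have [[j Dj fx]|nx] := pselect ((\bigcup_(j in D) f j) x).
  have [ij|ji] := tot i j Di Dj.
    exists j => // y; rewrite inE => /predU1P[->//|ys cy].
    by apply: ij; apply: IH.
  exists i => // y; rewrite inE => /predU1P[-> _|ys cy]; last exact: IH.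
  exact: ji.
exists i => // y; rewrite inE => /predU1P[-> /nx//|]; exact: IH.
Qed.

Lemma strong_bigcup n (I : Type) (D : set I) (f : I -> set G) Z i0 : D i0 ->
    (forall i j, D i -> D j -> f i `<=` f j \/ f j `<=` f i) ->
    (forall i, D i -> strong n (f i) Z) ->
  strong n (\bigcup_(i in D) f i) Z.
Proof.
move=> Di0 tot sf; split=> [x [i Di fx]|H HZ]; first exact: (sf i Di).1 x fx.
have [i Di fi] := chain_seq H Di0 tot.
have := (sf i Di).2 H HZ; congr (0 <= _ - chi _ _)%R.
apply/fsetP => x; rewrite !fset_in_eq; case xH: (x \in H) => //=.
by apply/idP/idP => /set_mem h; apply/mem_set; [exists i|apply: fi].
Qed.

Definition epairs x p : seq {fset G} := pairmap (fun u v => [fset u; v]%fset) x p.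

Lemma epairs_sub x p e : e \in epairs x p -> {subset e <= x :: p}.
Proof.
elim: p x => //= y p IH x; rewrite inE => /predU1P[-> z|/IH sub z ze].
  by rewrite !inE => /orP[]/eqP->; rewrite eqxx ?orbT.
by rewrite inE sub ?orbT.
Qed.

Lemma epairs_uniq x p : uniq (x :: p) -> uniq (epairs x p).
Proof.
elim: p x => //= y p IH x /andP[nx u]; rewrite IH // andbT.
apply/negP => /epairs_sub sub; case/negP: nx; apply: sub.
by rewrite !inE eqxx.
Qed.

Lemma size_epairs x p : size (epairs x p) = size p.
Proof. exact: size_pairmap. Qed.

Lemma epairs_ne x p X H : path (@adj G) x p -> {subset x :: p <= H} ->
    (forall u v, [fset u; v]%fset \in epairs x p -> ~ (X u /\ X v)) ->
  {subset epairs x p <= ne H X}.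
Proof.
elim: p x => //= y p IH x /andP[xy yp] sub nX e; rewrite inE => /predU1P[->|].
  apply/neP; exists x, y; split=> //; try by apply: sub; rewrite !inE eqxx ?orbT.
  by apply: nX; rewrite inE eqxx.
apply: IH => // [z zp|u v uv]; first by apply: sub; rewrite inE zp orbT.
by apply: nX; rewrite inE uv orbT.
Qed.

(** As [q] is nonempty, no edge of the excursion joins [a] to [b] directly; so all of its edges are
    new over [X]. *)
Lemma excursion_epairs X a q b e : excursion X a q b ->
  e \in epairs a (rcons q b) -> exists2 z, z \in e & z \in q.
Proof.
case=> _ _ _; case: q => // z q _ _.
rewrite rcons_cons /= inE => /predU1P[->|].
  by exists z; rewrite !inE eqxx ?orbT.
elim: q z => [|y q IH] z /=.
  by rewrite inE => /eqP->; exists z; rewrite !inE eqxx.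
rewrite inE => /predU1P[->|/IH[v ve vq]].
  by exists z; rewrite !inE eqxx.
by exists v => //; rewrite inE vq orbT.
Qed.

Lemma excursion_ne X a q b H : excursion X a q b ->
  {subset a :: rcons q b <= H} -> {subset epairs a (rcons q b) <= ne H X}.
Proof.
move=> e sub; have [Xa Xb /andP[pq _] _ nX] := e.
apply: epairs_ne => // u v /(excursion_epairs e)[z]; rewrite !inE.
by move=> /orP[]/eqP-> zq [Xu Xv]; apply: (nX _ zq).
Qed.

(** * Short excursions from a strong set *)

Section Arc.
Variables (n : nat) (Y Z : set G) (a : G) (q : seq G) (b : G).
Hypothesis n3 : 2 < n.
Hypothesis sYZ : strong n Y Z.
Hypothesis exc : excursion Y a q b.
Hypothesis qZ : forall z, z \in q -> Z z.
Hypothesis short : (size q).+1 < n.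

Lemma arc_count (H : {fset G}) (s : seq {fset G}) :
    {subset a :: rcons q b <= H} -> {subset H <= Z} ->
    (forall x, x \in H -> ~ Y x -> x \in q) ->
    uniq s -> {subset s <= ne H Y} ->
  (n - 2) * size s <= (n - 1) * size q.
Proof.
move=> sub HZ Hq us ss.
have /(strongP Y Z (ltnW n3))[_ /(_ H (fun x xH => set_mem (HZ x xH))) h] := sYZ.
apply: (leq_trans _ (leq_trans h _)); rewrite leq_mul2l; apply/orP; right.
  rewrite -(undup_id us) -card_fseq fsubset_leq_card //.
  by apply/fsubsetP => e; rewrite inE /=; apply: ss.
rewrite (leq_trans _ (size_undup q)) // -card_fseq fsubset_leq_card //.
by apply/fsubsetP => x /nvP[xH nY]; rewrite inE /=; apply: Hq.
Qed.

Lemma excursion_uniq : uniq (a :: rcons q b).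
Proof. by have [_ _ /andP[]] := exc. Qed.

Lemma excursion_path : path (@adj G) a (rcons q b).
Proof. by have [_ _ /andP[]] := exc. Qed.

Lemma mem_excursion z : z \in a :: rcons q b -> Y z \/ z \in q.
Proof.
have [Ya Yb _ _ _] := exc.
rewrite inE mem_rcons inE => /or3P[/eqP->|/eqP->|]; auto.
Qed.

(* An excursion with [k] inner vertices brings at least [k + 1] new edges, so
   strength forces [n - 2 <= k]. *)
Lemma arc_size : n = (size q).+2.
Proof.
have YZ := sYZ.1.
have : (n - 2) * (size q).+1 <= (n - 1) * size q; last first.
  by move: (size q) short n3 => k; nia.
rewrite -(size_rcons q b) -(size_epairs a).
apply: (@arc_count [fset x in a :: rcons q b]%fset).
- by move=> z; rewrite in_fset_seq.
- by move=> z; rewrite in_fset_seq => /mem_excursion[/YZ|/qZ]/mem_set.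
- by move=> z; rewrite in_fset_seq => /mem_excursion[].
- exact/epairs_uniq/excursion_uniq.
- by apply: (excursion_ne exc) => z; rewrite in_fset_seq.
Qed.

(** One further edge at an inner vertex would make [n] new edges on [n - 2] new vertices, against
    strength, because [(n - 2) * n] exceeds [(n - 1) * (n - 2)]. *)
Lemma arc_clean z w : z \in q -> Y w \/ w \in q -> adj z w ->
  [fset z; w]%fset \in epairs a (rcons q b).
Proof.
move=> zq Hw zw; apply: contraT => new; exfalso.
have YZ := sYZ.1.
have nYz : ~ Y z by have [_ _ _ _] := exc; apply.
have Hmem x : x \in w :: a :: rcons q b -> Y x \/ x \in q.
  by rewrite inE => /predU1P[->//|/mem_excursion].
have : (n - 2) * (size q).+2 <= (n - 1) * size q; last first.
  by have := arc_size; move: (size q) n3 => k; nia.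
have -> : (size q).+2 = size ([fset z; w]%fset :: epairs a (rcons q b)).
  by rewrite /= size_epairs size_rcons.
apply: (@arc_count [fset x in w :: a :: rcons q b]%fset).
- by move=> x xa; rewrite in_fset_seq inE xa orbT.
- by move=> x; rewrite in_fset_seq => /Hmem[/YZ|/qZ]/mem_set.
- by move=> x; rewrite in_fset_seq => /Hmem[].
- by rewrite /= new epairs_uniq // excursion_uniq.
- move=> e; rewrite inE => /predU1P[->|].
    apply/neP; exists z, w; split=> //; last by case.
      by rewrite in_fset_seq !inE mem_rcons inE zq !orbT.
    by rewrite in_fset_seq inE eqxx.
  by apply: (excursion_ne exc) => x xa; rewrite in_fset_seq inE xa orbT.
Qed.

(** The arc has [n - 2] inner vertices and [n - 1] edges, which cancel in [chi]. Hence the excess of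
    [H] over the enlarged set is at least the excess over [Y] of [K], that is, of [H] with the whole
    arc thrown in. *)
Lemma arc_strong : strong n (Y `|` [set` q]) Z.
Proof.
have YZ := sYZ.1; have En := arc_size.
apply/strongP; first lia.
split=> [x [/YZ//|/qZ//]|H HZ].
set W := Y `|` [set` q].
set K := (H `|` [fset x in a :: rcons q b])%fset.
have mK x : x \in K = (x \in H) || (x \in a :: rcons q b).
  by rewrite in_fsetU; congr orb; rewrite in_fset_seq.
have KZ : [set` K] `<=` Z.
  move=> x /=; rewrite mK => /orP[/HZ//|/mem_excursion[/YZ|/qZ]//].
have EV : nv K Y = (nv H W `|` [fset x in q])%fset.
  apply/fsetP => x; rewrite in_fsetU; apply/nvP/orP.
    rewrite mK => -[/orP[xH|/mem_excursion[//|xq]] nYx]; last first.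
      by right; rewrite in_fset_seq.
    have [xq|nxq] := boolP (x \in q); first by right; rewrite in_fset_seq.
    by left; apply/nvP; split=> // -[//|/= xq]; rewrite xq in nxq.
  case=> [/nvP[xH nW]|]; first by split; [rewrite mK xH|move=> Yx; apply: nW; left].
  rewrite in_fset_seq => xq; split; first by rewrite mK inE mem_rcons inE xq !orbT.
  by have [_ _ _ _] := exc; apply.
have CV : #|` nv K Y| = #|` nv H W| + size q.
  rewrite EV cardfsU card_fseq undup_id; last first.
    by have := excursion_uniq; rewrite /= rcons_uniq => /and3P[].
  suff -> : (nv H W `&` [fset x in q])%fset = fset0 by rewrite cardfs0 subn0.
  apply/fsetP => x; rewrite in_fsetI !in_fset0; apply/negP => /andP[/nvP[_ nW]].
  by rewrite in_fset_seq => xq; apply: nW; right.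
have CE : #|` ne H W| + (size q).+1 <= #|` ne K Y|.
  have <- : #|` [fset e in epairs a (rcons q b)]%fset| = (size q).+1.
    rewrite card_fseq undup_id ?size_epairs ?size_rcons //.
    exact/epairs_uniq/excursion_uniq.
  set E := [fset e in _]%fset.
  have -> : #|` ne H W| + #|` E| = #|` (ne H W `|` E)%fset|.
    rewrite cardfsU; suff -> : (ne H W `&` E)%fset = fset0.
      by rewrite cardfs0 subn0.
    apply/fsetP => e; rewrite in_fsetI in_fset0; apply/negP => /andP[/neP[x [y]]].
    case=> _ _ _ -> nW; rewrite in_fset_seq => /epairs_sub sub; apply: nW.
    by split; apply: mem_excursion; apply: sub; rewrite !inE eqxx ?orbT.
  apply/fsubset_leq_card/fsubsetP => e; rewrite in_fsetU => /orP[/neP[x [y]]|].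
    case=> xH yH xy -> nW; apply/neP; exists x, y; split=> //; rewrite ?mK ?xH ?yH //.
    by case=> Yx Yy; apply: nW; split; left.
  rewrite in_fset_seq; apply: (excursion_ne exc) => x xa.
  by rewrite mK xa orbT.
have /strongP[|_ /(_ K KZ)] := sYZ; first lia.
rewrite CV; move: CE; rewrite En.
move: (size q) (#|` ne H W|) #|` ne K Y| #|` nv H W| => k e e' v.
by nia.
Qed.

End Arc.

End Strong.

Lemma lift_seq (T U : eqType) (P : T -> Prop) (f : T -> U) (s : seq U) :
  (forall y, y \in s -> exists2 x, P x & f x = y) ->
  exists2 t, map f t = s & forall x, x \in t -> P x.
Proof.
elim: s => [|y s IH] h; first by exists [::].
have [t Et tP] := IH (fun z zs => h z (mem_behead (s := y :: s) zs)).
have [x Px Ex] := h y (mem_head _ _).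
exists (x :: t); first by rewrite /= Et Ex.
by move=> z; rewrite inE => /predU1P[->//|/tP].
Qed.

Section StrongEmbed.
Variables (G G' : graph) (f : G -> G').
Hypothesis fI : injective f.
Hypothesis fE : forall x y, adj (f x) (f y) = adj x y.

Lemma edges_embed (H : {fset G}) :
  edges [fset f x | x in H]%fset =
  [fset [fset f x | x in (e : {fset G})]%fset | e in edges H]%fset.
Proof.
apply/fsetP => e; apply/edgesP/imfsetP => [|[e' /edgesP]].
  case=> _ [_ [/imfsetP[x /= xH ->] /imfsetP[y /= yH ->] xy ->]].
  exists [fset x; y]%fset; first by apply/edgesP; exists x, y; rewrite -fE.
  by rewrite imfsetU !imfset_fset1.
case=> x [y [xH yH xy ->]] ->; exists (f x), (f y).
by rewrite !in_imfset // fE imfsetU !imfset_fset1.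
Qed.

Lemma chi_embed n (H : {fset G}) : chi n [fset f x | x in H]%fset = chi n H.
Proof.
rewrite /chi edges_embed !card_imfset //= => A B /fsetP E.
apply/fsetP => x; have := E (f x).
by rewrite !mem_imfset.
Qed.

Lemma fset_embed (H : {fset G}) (X : set G) :
  [fset y in [fset f x | x in H] | y \in (f @` X)%classic]%fset =
  [fset f x | x in [fset x in H | x \in X]]%fset.
Proof.
apply/fsetP => y; rewrite fset_in_eq.
apply/andP/imfsetP => [[/imfsetP[x /= xH ->] /set_mem[x' Xx' /fI Ex]]|[x /=]].
  by exists x; rewrite //= fset_in_eq xH -Ex mem_set.
rewrite fset_in_eq => /andP[xH /set_mem Xx] ->; split; last first.
  by apply: mem_set; exists x.
by rewrite in_imfset.
Qed.

Lemma strong_embed n X Z : strong n (f @` X) (f @` Z) <-> strong n X Z.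
Proof.
split=> -[XZ sX]; split.
- by move=> x Xx; have [|z Zz /fI <-] := XZ (f x); first by exists x.
- move=> H HZ; rewrite -!(chi_embed n) -fset_embed; apply: sX.
  by move=> _ /imfsetP[x /= /HZ Zx ->]; exists x.
- by move=> _ [x /XZ Zx <-]; exists x.
- move=> H HZ; have [t Et tZ] := @lift_seq _ _ Z f H (fun y yH => HZ y yH).
  have EH : H = [fset f x | x in [fset x in t]]%fset.
    apply/fsetP => y; rewrite -[y \in H]/(y \in (H : seq _)) -Et.
    apply/mapP/imfsetP => -[x xt ->]; exists x => //=; first by rewrite in_fset_seq.
    by rewrite /= in_fset_seq in xt.
  rewrite EH fset_embed !chi_embed; apply: sX => x /=.
  by rewrite in_fset_seq => /tZ.
Qed.

End StrongEmbed.

(** * Hulls in a strong subgraph *)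

Lemma excursion_ends (G : graph) (X : set G) a q b : excursion X a q b ->
  exists z z', [/\ z \in q, z' \in q, adj a z & adj z' b].
Proof.
case=> _ _ /andP[]; case/lastP: q => // q z' + _ _ _.
rewrite !rcons_path last_rcons => /andP[/andP[pq qz'] z'b].
case: q pq qz' => [|z q] /= pq qz'; first by exists z', z'; rewrite inE eqxx.
by case/andP: pq => az _; exists z, z'; rewrite mem_head inE mem_rcons mem_head orbT.
Qed.

Section HullStrong.
Variables (G : graph) (n : nat).
Hypotheses (adjS : symmetric (@adj G)) (n3 : 2 < n).
Variables X Y Z : set G.
Hypotheses (sYZ : strong n Y Z) (cZ : convex n Z) (XY : X `<=` Y).
Hypothesis cXY : rconvex n X Y.

(** Invariant of a set growing from [X] towards its hull by arcs off [Y]: the second and third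
    clauses keep the amalgam with [Y] free, the last one makes the arc lemmas applicable to the next
    arc. *)
Let good (W : set G) := [/\ W `<=` hull n X, W `&` Y `<=` X,
  forall u v, W u -> Y v -> adj u v -> X u \/ X v & strong n (W `|` Y) Z].

Let good_max : exists W, [/\ X `<=` W, good W &
  forall W', W `<=` W' -> good W' -> W' `<=` W].
Proof.
(* [X] is joined to [W] in the property so that the maximal set contains [X]. *)
have [|W [gW maxW]] := @Zorn_bigcup _ (fun W => good (X `|` W)).
  move=> F FP tot; split.
  - move=> x [/sub_hull//|[W FW Wx]].
    by have [sub _ _ _] := FP W FW; apply: sub; right.
  - move=> x [[//|[W FW Wx]] Yx].
    by have [_ sub _ _] := FP W FW; apply: sub; split=> //; right.
  - move=> u v [Xu|[W FW Wu]] Yv uv; first by left.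
    by have [_ _ sub _] := FP W FW; apply: (sub u v) => //; right.
  (* Zorn's lemma also asks about the empty chain, while [strong_bigcup] needs a member; [set0] is
     adjoined to provide one. *)
  - pose D := [set W | F W \/ W = set0].
    have -> : X `|` \bigcup_(W in F) W `|` Y = \bigcup_(W in D) (X `|` W `|` Y).
      apply/seteqP; split=> [x [[Xx|[W FW Wx]]|Yx]|x [W [FW|->]]].
      + by exists set0; [right|left; left].
      + by exists W; [left|left; right].
      + by exists set0; [right|right].
      + by case=> [[Xx|Wx]|Yx]; [left; left|left; right; exists W|right].
      + by case=> [[Xx|//]|Yx]; [left; left|right].
    apply: (@strong_bigcup _ _ _ _ _ _ set0); first by right.
      move=> A B DA DB; suff [AB|BA] : A `<=` B \/ B `<=` A.
      + by left; apply: setSU; apply: setUS.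
      + by right; apply: setSU; apply: setUS.
      + case: DA => [FA|->]; last by left; apply: sub0set.
        case: DB => [FB|->]; last by right; apply: sub0set.
        exact: tot.
    move=> W [FW|->]; first by have [] := FP W FW.
    by rewrite setU0 (setUidr XY).
exists (X `|` W); split=> // W' WW' gW' x W'x; apply: contrapT => nWx.
have EW' : X `|` W' = W'.
  by apply/setUidr; apply: subset_trans WW'; apply: subsetUl.
apply: (maxW W'); last by rewrite EW'.
split; first by apply: subset_trans WW'; apply: subsetUr.
by move=> W'W; apply: nWx; right; apply: W'W.
Qed.

(** A maximal good [W] is convex. A short excursion from it that runs inside [Y] would have its ends
    in [X] by the edge clause, against relative convexity. Any other contains an excursion from [W]
    and [Y] together, which by its length is the whole path and could be added to [W]. *)
Lemma hull_strong : [/\ hull n X `&` Y = X,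
  forall u v, hull n X u -> Y v -> adj u v -> X u \/ X v,
  strong n (hull n X `|` Y) Z & strong n X (hull n X)].
Proof.
have YZ := sYZ.1.
have hXZ : hull n X `<=` Z by apply: hull_min => //; apply: subset_trans YZ.
have [W [XW [WX WY We Ws] maxW]] := good_max.
suff cW : convex n W.
  have <- : W = hull n X by apply/seteqP; split=> //; apply: hull_min.
  have EW : W `&` Y = X.
    by apply/seteqP; split=> // x Xx; split; [apply: XW|apply: XY].
  split=> //; apply: (strong_inter sYZ) => //; last by rewrite setIC.
  by apply: subset_trans hXZ.
apply: convexP => a q b exc lt.
have qX := excursion_sub (@hull_convex _ n X) WX exc lt.
have [Wa Wb uq q0 nW] := exc.
have [qY|/existsNP[w /not_implyP[wq nYw]]] := pselect (forall z, z \in q -> Y z).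
  have [z [z' [zq zq' az zb]]] := excursion_ends exc.
  have nX v : v \in q -> ~ X v by move=> vq /XW; apply: nW.
  have Xa : X a by case: (We a z Wa (qY z zq) az) => // /(nX z zq).
  have Xb : X b.
    by case: (We b z' Wb (qY z' zq')); rewrite 1?adjS // => /(nX z' zq').
  have exc' : excursion X a q b by split.
  exact: (excursion_rconvex cXY exc' qY (XY Xb) lt).
have sW : strong n (W `|` Y) Z by [].
have qZ z : z \in q -> Z z by move=> /qX/hXZ.
have [a' [q' [b' [exc' wq' sub le sp]]]] : exists a' q' b',
    [/\ excursion (W `|` Y) a' q' b', w \in q', {subset rcons q' b' <= rcons q b},
    (size q').+1 <= (size q).+1 &
    (size q).+1 <= (size q').+1 -> a' = a /\ rcons q b = rcons q' b'].
  rewrite -(size_rcons q b); apply: path_excursion => //; first by left.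
  - by rewrite last_rcons; left.
  - by rewrite mem_rcons inE wq orbT.
  - by case=> // /(nW w wq).
have zq' z : z \in q' -> z \in q.
  move=> zq'; have /sub : z \in rcons q' b' by rewrite mem_rcons inE zq' orbT.
  rewrite mem_rcons inE => /predU1P[Ezb|//].
  by have [_ _ _ _ /(_ z zq')] := exc'; case; left; rewrite Ezb.
have lt' := leq_ltn_trans le lt.
have q'Z z : z \in q' -> Z z by move=> /zq'/qZ.
have En := arc_size n3 sW exc' q'Z lt'.
have [Ea Eq] : a' = a /\ rcons q b = rcons q' b' by apply: sp; rewrite -ltnS -En.
have [Eq' Eb] := rcons_inj Eq.
rewrite Ea -Eq' -Eb in exc'.
have nYq z : z \in q -> ~ Y z.
  by move=> zq Yz; have [_ _ _ _ /(_ z zq)] := exc'; apply; right.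
have /maxW sub' : W `<=` W `|` [set` q] by apply: subsetUl.
apply: (nW w wq); apply: sub'; last by right.
split.
- by move=> x [/WX//|/qX].
- by move=> x [[Wx|/= xq] Yx]; [apply: WY|case: (nYq x xq)].
- move=> u v [Wu|/= uq'] Yv uv; first exact: (We u v).
  (* A neighbour in [Y] of an inner vertex lies on the arc, hence is one of its ends, and an end
     that lies in [Y] belongs to [X]. *)
  have vaq : [fset u; v]%fset \in epairs a (rcons q b).
    by apply: (arc_clean n3 sW exc' qZ lt) => //; left; right.
  right; have : v \in a :: rcons q b.
    by apply: (epairs_sub vaq); rewrite !inE eqxx orbT.
  rewrite inE mem_rcons inE => /or3P[/eqP Ev|/eqP Ev|/nYq//];
    by apply: WY; rewrite Ev in Yv *.
- rewrite setUAC; exact: (arc_strong n3 sW exc' qZ lt).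
Qed.

End HullStrong.

(** * Extension of isomorphisms *)

(* What is shared by all free completions, including those of trees. *)
Definition pregon n (G : graph) :=
  [/\ bipartite G, diam_le G n & girth_ge G (2 * n)].

Lemma generalized_ngon_pregon n G : generalized_ngon n G -> pregon n G.
Proof. by case=> bG [dG _] [gG _]. Qed.

Lemma path_part (G : graph) (x : G) p : bipartite G -> path (@adj G) x p ->
  part (last x p) = part x (+) odd (size p).
Proof.
move=> [_ bG]; elim: p x => [|y p IH] x /=; first by rewrite addbF.
move=> /andP[/bG xy /IH ->]; rewrite /=.
by case: (part x) xy; case: (part y) => //; case: (odd _).
Qed.

(** Translates edges of a path into positions, so that two arcs of equal length can be compared
    index by index. *)
Lemma epairs_nth (G : graph) (x0 x : G) p i w : uniq (x :: p) -> i <= size p ->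
  [fset nth x0 (x :: p) i; w]%fset \in epairs x p ->
  exists j, [/\ j <= size p, w = nth x0 (x :: p) j & j = i.+1 \/ i = j.+1].
Proof.
elim: p x i => [|y p IH] x i //= /andP[nx u] li.
have eqE (u1 : G) : [fset u1; w]%fset = [fset x; y]%fset -> u1 != w ->
    (u1 = x /\ w = y) \/ (u1 = y /\ w = x).
  by move=> /fset2_eqE[[->|->] [->|->]]; rewrite ?eqxx; auto.
rewrite inE => /predU1P[E|]; last first.
  case: i li => [|i] li.
    by move=> /epairs_sub sub; case/negP: nx; apply: sub; rewrite !inE eqxx.
  by move=> /(IH y i u li)[j [lj Ej Hj]]; exists j.+1; split=> //; lia.
have [Ew|nw] := eqVneq (nth x0 (x :: y :: p) i) w.
  move: E; rewrite Ew => /fsetP E.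
  have := E x; have := E y; rewrite !inE !eqxx ?orbT ?orbb => /eqP <- /eqP Exy.
  by case/negP: nx; rewrite Exy mem_head.
have [[Ei ->]|[Ei ->]] := eqE _ E nw.
  case: i li Ei {E nw} => [|i] li Ei; first by exists 1; split=> //; left.
  by case/negP: nx; rewrite /= in Ei; rewrite -Ei mem_nth.
case: i li Ei {E nw} => [|[|i]] li Ei.
- by case/negP: nx; rewrite /= in Ei; rewrite Ei mem_head.
- by exists 0; split=> //; right.
- by move: u; rewrite /= in Ei *; rewrite -{1}Ei mem_nth.
Qed.

Section ArcNth.
Variables (G : graph) (n : nat) (Y Z : set G) (a : G) (q : seq G) (b : G).
Hypotheses (n3 : 2 < n) (sYZ : strong n Y Z) (exc : excursion Y a q b).
Hypotheses (qZ : forall z, z \in q -> Z z) (short : (size q).+1 < n).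

Let S := a :: rcons q b.

Lemma arc_clean_nth i w : 0 < i <= size q -> Y w \/ w \in q ->
  adj (nth a S i) w ->
  exists j, [/\ j < size S, w = nth a S j & j = i.+1 \/ i = j.+1].
Proof.
case: i => // i /= li Hw.
have zq : nth a (rcons q b) i \in q by rewrite nth_rcons li mem_nth.
move=> /(arc_clean n3 sYZ exc qZ short zq Hw) h.
have [||j [lj Ej Hj]] := @epairs_nth _ a a (rcons q b) i.+1 w _ _ h.
- exact: excursion_uniq exc.
- by rewrite size_rcons ltnS ltnW.
- by exists j; rewrite /S /= ltnS.
Qed.

End ArcNth.

Section IsoExt.
Variables (G1 G2 : graph) (n : nat).
Hypotheses (g1 : pregon n G1) (g2 : pregon n G2) (n3 : 2 < n).
Implicit Types (R : set (G1 * G2)).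

Definition dom_rel R : set G1 := [set x | exists y, R (x, y)].
Definition rng_rel R : set G2 := [set y | exists x, R (x, y)].

(** A relation instead of a map: the inverse has the same form, so that an argument about one side
    serves the other, and a chain has its union as upper bound. *)
Definition iso_rel R :=
  [/\ forall x y x' y', R (x, x') -> R (y, y') -> x = y <-> x' = y',
      forall x y x' y', R (x, x') -> R (y, y') -> adj x y = adj x' y'
    & forall x x', R (x, x') -> part x = part x'].

Definition iso_strong R Z1 Z2 :=
  [/\ iso_rel R, strong n (dom_rel R) Z1 & strong n (rng_rel R) Z2].

End IsoExt.

Section IsoRel.
Variables (G1 G2 : graph) (R : set (G1 * G2)).
Hypothesis iR : iso_rel R.

Lemma iso_rel_path (t : seq (G1 * G2)) x x' : R (x, x') ->
  (forall u, u \in t -> R u) ->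
  path (@adj G1) x (unzip1 t) = path (@adj G2) x' (unzip2 t).
Proof.
have [_ Radj _] := iR.
elim: t x x' => // -[y y'] t IH x x' Rx Rt /=.
have Ry := Rt _ (mem_head _ _).
rewrite (Radj _ _ _ _ Rx Ry); congr andb.
by apply: IH => // u ut; apply: Rt; rewrite inE ut orbT.
Qed.

Lemma iso_rel_upath (t : seq (G1 * G2)) x x' : R (x, x') ->
  (forall u, u \in t -> R u) -> upath x (unzip1 t) = upath x' (unzip2 t).
Proof.
move=> Rx Rt; rewrite /upath (iso_rel_path Rx Rt); congr andb.
have [Rinj _ _] := iR.
have Rxt u : u \in (x, x') :: t -> R u by rewrite inE => /predU1P[->|/Rt].
change (uniq (map fst ((x, x') :: t)) = uniq (map snd ((x, x') :: t))).
rewrite !map_inj_in_uniq // => -[u u'] [v v'] /Rxt Ru /Rxt Rv /= E.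
  by rewrite E ((Rinj _ _ _ _ Ru Rv).2 E).
by rewrite E ((Rinj _ _ _ _ Ru Rv).1 E).
Qed.

Lemma iso_rel_last (t : seq (G1 * G2)) x x' : R (x, x') ->
  (forall u, u \in t -> R u) -> R (last x (unzip1 t), last x' (unzip2 t)).
Proof.
elim: t x x' => // -[y y'] t IH x x' Rx Rt /=.
by apply: IH => [|u ut]; apply: Rt; rewrite inE ?ut ?eqxx ?orbT.
Qed.

Lemma lift_dom s : (forall x, x \in s -> dom_rel R x) ->
  exists2 t, unzip1 t = s & forall u, u \in t -> R u.
Proof. by move=> sR; apply: lift_seq => x /sR[y Rxy]; exists (x, y). Qed.

Lemma lift_rng s : (forall y, y \in s -> rng_rel R y) ->
  exists2 t, unzip2 t = s & forall u, u \in t -> R u.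
Proof. by move=> sR; apply: lift_seq => y /sR[x Rxy]; exists (x, y). Qed.

Definition inv_rel : set (G2 * G1) := [set p | R (p.2, p.1)].

Lemma iso_rel_inv : iso_rel inv_rel.
Proof.
have [H1 H2 H3] := iR; split.
- by move=> x y x' y' Rx Ry; split=> /(H1 _ _ _ _ Rx Ry).
- by move=> x y x' y' Rx Ry; rewrite (H2 _ _ _ _ Rx Ry).
- by move=> x y Rx; rewrite (H3 _ _ Rx).
Qed.

End IsoRel.

Lemma iso_strong_inv (G1 G2 : graph) n (R : set (G1 * G2)) Z1 Z2 :
  iso_strong n R Z1 Z2 -> iso_strong n (inv_rel R) Z2 Z1.
Proof. by case=> iR s1 s2; split=> //; apply: iso_rel_inv. Qed.

Section ArcTransfer.
Variables (G1 G2 : graph) (n : nat) (R : set (G1 * G2)) (Z1 : set G1).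
Hypotheses (n3 : 2 < n) (iR : iso_rel R) (s1 : strong n (dom_rel R) Z1).
Variables (a b : G1) (q : seq G1) (a' b' : G2) (q' : seq G2).
Hypotheses (exc1 : excursion (dom_rel R) a q b).
Hypotheses (exc2 : excursion (rng_rel R) a' q' b').
Hypotheses (adj2S : symmetric (@adj G2)).
Hypotheses (qZ : forall z, z \in q -> Z1 z) (short : (size q).+1 < n).
Hypotheses (Rab : R (a, a') /\ R (b, b')) (Eq : size q = size q').

Lemma zip_nth p : p \in zip q q' -> exists2 i, i < size q &
  p = (nth a q i, nth a' q' i).
Proof.
move=> /(nthP (a, a'))[i]; rewrite size_zip -Eq minnn => li <-.
by exists i => //; rewrite nth_zip.
Qed.

Lemma ext_fun x y x' y' : (R `|` [set` zip q q']) (x, x') ->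
  (R `|` [set` zip q q']) (y, y') -> x = y -> x' = y'.
Proof.
have [_ _ _ _ nq] := exc1; have [Rinj _ _] := iR.
have uq : uniq q.
  by have := excursion_uniq exc1; rewrite /= rcons_uniq => /and3P[].
case=> [Rx|/zip_nth[i li [-> ->]]] [Ry|/zip_nth[j lj [-> ->]]].
- by move/(Rinj _ _ _ _ Rx Ry).
- by move=> Ex; case: (nq (nth a q j)); [rewrite mem_nth|rewrite -Ex; exists x'].
- by move=> Ex; case: (nq (nth a q i)); [rewrite mem_nth|rewrite Ex; exists y'].
- by move/eqP; rewrite nth_uniq // => /eqP->.
Qed.

(** By strength on the first side an edge at an inner vertex joins consecutive positions of the arc,
    and the second arc has an edge at the same positions. The converse is this lemma for the inverse
    relation. *)
Lemma ext_adj x y x' y' : (x, x') \in zip q q' ->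
  (R `|` [set` zip q q']) (y, y') -> adj x y -> adj x' y'.
Proof.
move=> xq Ry; have [i li [Ex Ex']] := zip_nth xq => xy.
have Hy : dom_rel R y \/ y \in q.
  case: Ry => [Ry|/zip_nth[j lj [-> _]]]; first by left; exists y'.
  by right; rewrite mem_nth.
have Exi : x = nth a (a :: rcons q b) i.+1 by rewrite /= nth_rcons li.
rewrite Exi in xy.
have [//|j [lj Ej Hj]] := arc_clean_nth n3 s1 exc1 qZ short (i := i.+1) _ Hy xy.
(* Position [0] and position [(size q).+1] are the ends, matched by [R]; all others are matched by
   the zip. *)
have Ey' : y' = nth a' (a' :: rcons q' b') j.
  apply: (ext_fun Ry _ Ej).
  case: j lj {Ej Hj} => [|j] lj /=; first by left; exact: Rab.1.
  rewrite !nth_rcons -Eq; have [lj'|] := ltnP j (size q).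
    right; rewrite /= -nth_zip // mem_nth // size_zip -Eq minnn //.
  move: lj; rewrite /= size_rcons !ltnS => lj1 lj2.
  have -> : j = size q by apply/eqP; rewrite eqn_leq lj1.
  by rewrite eqxx; left; exact: Rab.2.
have Ex1 : x' = nth a' (a' :: rcons q' b') i.+1 by rewrite /= nth_rcons -Eq li.
have /(pathP a') adjp := excursion_path exc2.
rewrite Ex1 Ey'; case: Hj => Hj; rewrite Hj in lj *.
  by apply: (adjp i.+1); move: lj; rewrite /= !size_rcons -Eq ltnS.
rewrite -Hj adj2S; case: Hj => Hj; rewrite Hj; apply: (adjp j).
by rewrite size_rcons -Eq -Hj ltnS ltnW.
Qed.

End ArcTransfer.

Section IsoExtend.
Variables (G1 G2 : graph) (n : nat) (Z1 : set G1) (Z2 : set G2).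
Hypotheses (g1 : pregon n G1) (g2 : pregon n G2) (n3 : 2 < n).
Hypotheses (cZ1 : convex n Z1) (cZ2 : convex n Z2).
Implicit Types (R : set (G1 * G2)).

(** A failure of convexity is an arc from [a] to [b] of length [n - 1]; the work is to find an arc
    of the same length between their images and to match the two. *)
Lemma iso_step R : iso_strong n R Z1 Z2 -> ~ convex n (dom_rel R) ->
  exists R', [/\ iso_strong n R' Z1 Z2, R `<=` R' & ~ (R' `<=` R)].
Proof.
have [b1 d1 gi1] := g1; have [b2 d2 gi2] := g2.
have [adj1S _] := b1; have [adj2S _] := b2.
case=> iR s1 s2 /not_convex[a [q [b [exc1 lt]]]].
have [Rinj Radj Rpart] := iR.
have [[a' Raa'] [b' Rbb'] uq q0 nq] := exc1.
have qZ := excursion_sub cZ1 s1.1 exc1 lt.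
have En := arc_size n3 s1 exc1 qZ lt.
have [l [p0 [[wp0 lp0] _] sp0] ln] := d2 a' b'.
have [p [up lp sp _]] := walk_upath wp0.
rewrite lp0 in lp; rewrite sp0 in sp.
have {l p0 wp0 lp0 sp0 sp} {}ln := leq_trans sp ln.
(* The arc has length [n - 1] and [R] preserves the sorts, so [a'] and [b'] have the wrong parity
   for a path of length [n]. *)
have ltp : size p < n.
  rewrite ltn_neqAle ln andbT; apply/eqP => Ep.
  have [/andP[wp _] /andP[wq _]] := (up, uq).
  have := path_part b1 wq; have := path_part b2 wp.
  rewrite lp last_rcons size_rcons (Rpart _ _ Raa') (Rpart _ _ Rbb') => ->.
  by rewrite Ep {1}En /=; case: (part a'); case: (odd (size q)).
(* If [p] stayed in the range, it would pull back to a path from [a] to [b] of length below [n]. By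
   girth this would be the arc itself, whose interior is outside the domain. *)
have [w wp nRw] : exists2 w, w \in p & ~ rng_rel R w.
  apply: contrapT => H; have [t Et Rt] : exists2 t, unzip2 t = p &
      forall u, u \in t -> R u.
    by apply: lift_rng => y yp; apply: contrapT => ny; apply: H; exists y.
  have ut : upath a (unzip1 t) by rewrite (iso_rel_upath iR Raa') // Et.
  have lt1 : last a (unzip1 t) = b.
    have := iso_rel_last Raa' Rt; rewrite Et lp => Rl.
    exact: (Rinj _ _ _ _ Rl Rbb').2.
  have Eq : unzip1 t = rcons q b.
    apply: (upath_unique adj1S gi1 ut uq); first by rewrite lt1 last_rcons.
    rewrite size_rcons size_map -(size_map snd t) -/(unzip2 t) Et.
    by have := leq_add ltp (ltnW lt); rewrite mul2n -addnn addSn.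
  case: q q0 nq Eq {exc1 uq lt qZ En} => // z q _ nq Eq.
  apply: (nq z (mem_head _ _)).
  have : z \in unzip1 t by rewrite Eq mem_head.
  by case/mapP => -[u v] /Rt Ruv /= ->; exists v.
have [||a2 [q' [b2' [exc2 wq' sub le sz]]]] :=
    @path_excursion _ (rng_rel R) a' p w up _ _ wp nRw.
- by exists a.
- by rewrite lp; exists b.
have lt' := leq_ltn_trans le ltp.
have qZ' := excursion_sub cZ2 s2.1 exc2 lt'.
have En' := arc_size n3 s2 exc2 qZ' lt'.
have [Ea Ep] : a2 = a' /\ p = rcons q' b2' by apply: sz; rewrite -ltnS -En'.
have Eb : b2' = b' by rewrite -lp Ep last_rcons.
rewrite {}Ea {}Eb {a2 b2' w wp nRw wq' sub le sz} in exc2 Ep *.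
have Eq : size q = size q' by apply/eqP; rewrite -2!eqSS -En -En'.
have Rab : R (a, a') /\ R (b, b') by [].
have excI : excursion (rng_rel (inv_rel R)) a q b by [].
have excI' : excursion (dom_rel (inv_rel R)) a' q' b' by [].
have RabI : inv_rel R (a', a) /\ inv_rel R (b', b) by [].
have iRI := iso_rel_inv iR.
have zipI x y : (x, y) \in zip q q' -> (y, x) \in zip q' q.
  move=> /(zip_nth a a' Eq)[i li [-> ->]].
  by rewrite -nth_zip // mem_nth // size_zip -Eq minnn.
have RI x y : (R `|` [set` zip q q']) (x, y) ->
    (inv_rel R `|` [set` zip q' q]) (y, x).
  by case=> [Rxy|/= /zipI]; [left|right].
have adjE x y x' y' : (x, x') \in zip q q' -> (R `|` [set` zip q q']) (y, y') ->
    adj x y = adj x' y'.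
  move=> xq Ry; apply/idP/idP.
    exact: (ext_adj n3 iR s1 exc1 exc2 adj2S qZ lt Rab Eq).
  apply: (ext_adj n3 iRI s2 excI' excI adj1S qZ' lt' RabI (esym Eq)).
    exact: zipI.
  exact: RI.
have R'dom : dom_rel (R `|` [set` zip q q']) = dom_rel R `|` [set` q].
  apply/seteqP; split=> [x [y [Rxy|]]|x [[y Rxy]|]].
  - by left; exists y.
  - by move=> /= /(zip_nth a a' Eq)[i li [-> _]]; right; rewrite /= mem_nth.
  - by exists y; left.
  - move=> /= /(nthP a)[i li <-]; exists (nth a' q' i); right.
    by rewrite /= -nth_zip // mem_nth // size_zip -Eq minnn.
have R'rng : rng_rel (R `|` [set` zip q q']) = rng_rel R `|` [set` q'].
  apply/seteqP; split=> [y [x [Rxy|]]|y [[x Rxy]|]].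
  - by left; exists x.
  - move=> /= /(zip_nth a a' Eq)[i li [_ ->]]; right.
    by rewrite /= mem_nth // -Eq.
  - by exists x; left.
  - move=> /= /(nthP a')[i li <-]; exists (nth a q i); right.
    by rewrite /= -nth_zip // mem_nth // size_zip -Eq minnn Eq.
exists (R `|` [set` zip q q']); split; last 2 first.
- exact: subsetUl.
- move=> sub; have := nq (head a q); apply; first by case: (q) q0 => //= z s; rewrite mem_head.
  have : dom_rel (R `|` [set` zip q q']) (head a q).
    by rewrite R'dom; right; case: (q) q0 => //= z s; rewrite mem_head.
  by case=> y /sub Ry; exists y.
split; last 2 first.
- by rewrite R'dom; apply: (arc_strong n3 s1 exc1 qZ lt).
- by rewrite R'rng; apply: (arc_strong n3 s2 exc2 qZ' lt').
split.
- move=> x y x' y' Rx Ry; split.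
    exact: (ext_fun iR a' exc1 Eq Rx Ry).
  exact: (ext_fun iRI a excI' (esym Eq) (RI _ _ Rx) (RI _ _ Ry)).
- move=> x y x' y' Rx Ry.
  have [Rx0|xq] := Rx; last exact: adjE.
  have [Ry0|yq] := Ry; first exact: Radj.
  by rewrite adj1S adj2S; apply: adjE.
- move=> x x' [/Rpart//|/= /(zip_nth a a' Eq)[i li [-> ->]]].
  have [/andP[wq _] _] := (uq, up); have /andP[wp _] := up.
  have part_nth (G : graph) (u v : G) s : bipartite G -> path (@adj G) u (rcons s v) ->
      i < size s -> part (nth u s i) = part u (+) ~~ odd i.
    move=> bG ps li'; have pt : path (@adj G) u (take i.+1 (rcons s v)).
      by move: ps; rewrite -{1}(cat_take_drop i.+1 (rcons s v)) cat_path => /andP[].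
    have := path_part bG pt.
    rewrite (last_nth u) size_takel ?size_rcons 1?leqW // => <-.
    by rewrite /= nth_take // nth_rcons li'.
  rewrite (part_nth _ _ b _ b1) // (part_nth _ _ b' _ b2) -?Ep // -?Eq //.
  by rewrite (Rpart _ _ Raa').
Qed.

End IsoExtend.

Section IsoExtend.
Variables (G1 G2 : graph) (n : nat) (Z1 : set G1) (Z2 : set G2).
Hypotheses (g1 : pregon n G1) (g2 : pregon n G2) (n3 : 2 < n).
Hypotheses (cZ1 : convex n Z1) (cZ2 : convex n Z2).

(** A maximal extension has convex domain by [iso_step] and convex range by [iso_step] for the
    inverse. When [Z1] and [Z2] are the hulls of the domain and range of [R0], it is therefore an
    isomorphism between these hulls. *)
Lemma iso_extend R0 : iso_strong n R0 Z1 Z2 ->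
  exists R, [/\ iso_rel R, R0 `<=` R, dom_rel R `<=` Z1, rng_rel R `<=` Z2 &
    convex n (dom_rel R) /\ convex n (rng_rel R)].
Proof.
move=> iR0.
have [|R [iR maxR]] := @Zorn_bigcup _ (fun R => iso_strong n (R0 `|` R) Z1 Z2).
  move=> F FP tot; pose D := [set R | F R \/ R = set0].
  have D0 : D set0 by right.
  have DP R : D R -> iso_strong n (R0 `|` R) Z1 Z2.
    by case=> [/FP//|->]; rewrite setU0.
  have ED : R0 `|` \bigcup_(R in F) R = \bigcup_(R in D) (R0 `|` R).
    apply/seteqP; split=> [p [Rp|[R FR Rp]]|p [R [FR|->] [Rp|Rp]]] //.
    - by exists set0 => //; left.
    - by exists R; [left|right].
    - by left.
    - by right; exists R.
    - by left.
  have totD A B : D A -> D B -> R0 `|` A `<=` R0 `|` B \/ R0 `|` B `<=` R0 `|` A.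
    move=> DA DB; suff [AB|BA] : A `<=` B \/ B `<=` A.
    - by left; apply: setUS.
    - by right; apply: setUS.
    - case: DA => [FA|->]; last by left; apply: sub0set.
      case: DB => [FB|->]; last by right; apply: sub0set.
      exact: tot.
  have pair p r : (\bigcup_(R in D) (R0 `|` R)) p -> (\bigcup_(R in D) (R0 `|` R)) r ->
      exists R, [/\ D R, (R0 `|` R) p & (R0 `|` R) r].
    move=> [A DA Ap] [B DB Br]; have [AB|BA] := totD A B DA DB.
      by exists B; split=> //; apply: AB.
    by exists A; split=> //; apply: BA.
  rewrite ED; split; [split|..].
  - move=> x y x' y' Rx Ry; have [R [DR Rx' Ry']] := pair _ _ Rx Ry.
    by have [[H _ _] _ _] := DP R DR; apply: H Ry'.
  - move=> x y x' y' Rx Ry; have [R [DR Rx' Ry']] := pair _ _ Rx Ry.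
    by have [[_ H _] _ _] := DP R DR; apply: H Ry'.
  - move=> x x' [R DR Rx].
    by have [[_ _ H] _ _] := DP R DR; apply: H Rx.
  - have -> : dom_rel (\bigcup_(R in D) (R0 `|` R)) =
        \bigcup_(R in D) dom_rel (R0 `|` R).
      apply/seteqP; split=> [x [y [R DR Rx]]|x [R DR [y Rx]]].
        by exists R => //; exists y.
      by exists y, R.
    apply: (strong_bigcup D0) => [A B DA DB|R DR]; last by have [] := DP R DR.
    have [AB|BA] := totD A B DA DB; [left|right] => x [y Rx]; exists y; auto.
  - have -> : rng_rel (\bigcup_(R in D) (R0 `|` R)) =
        \bigcup_(R in D) rng_rel (R0 `|` R).
      apply/seteqP; split=> [y [x [R DR Rx]]|y [R DR [x Rx]]].
        by exists R => //; exists x.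
      by exists x, R.
    apply: (strong_bigcup D0) => [A B DA DB|R DR]; last by have [] := DP R DR.
    have [AB|BA] := totD A B DA DB; [left|right] => x [y Rx]; exists y; auto.
have {}maxR R' : iso_strong n R' Z1 Z2 -> R0 `|` R `<=` R' -> R' `<=` R0 `|` R.
  move=> iR' sub; apply: contrapT => nsub; apply: (maxR R').
    split; first by apply: subset_trans sub; apply: subsetUr.
    by move=> R'R; apply: nsub => p /R'R; right.
  have -> // : R0 `|` R' = R'.
  by apply/setUidr; apply: subset_trans sub; apply: subsetUl.
exists (R0 `|` R); have [iso s1 s2] := iR; split=> //.
- exact: s1.1.
- exact: s2.1.
split; apply: contrapT => nc.
  have [R' [iR' sub nsub]] := iso_step g1 g2 n3 cZ1 cZ2 iR nc.
  by apply: nsub; apply: maxR.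
have [R' [iR' sub nsub]] := iso_step g2 g1 n3 cZ2 cZ1 (iso_strong_inv iR) nc.
apply: nsub => -[y x] R'yx; apply: (maxR (inv_rel R') (iso_strong_inv iR') _ (x, y)) => //.
by case=> u v Ruv; apply: sub.
Qed.

End IsoExtend.

(** * Convex sets as substructures *)

Lemma walk_uniq_or_shorter (T : eqType) (e : rel T) (x : T) q : path e x q ->
  uniq (x :: q) \/
  exists q', [/\ path e x q', last x q' = last x q & size q' < size q].
Proof.
elim: q x => [|y q IH] x /=; first by left.
move=> /andP[xy yq]; case: (IH y yq) => [u|[q' [yq' lq' sq']]]; last first.
  by right; exists (y :: q'); rewrite /= xy.
have [xq|nx] := boolP (x \in y :: q); last by left; apply/andP; split.
right; case/splitPl: xq u yq => p1 p2 El _; rewrite cat_path El => /andP[_ xp2].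
by exists p2; split=> //; rewrite ?last_cat ?El // size_cat ltnS leq_addl.
Qed.

Lemma cycle_nbrs (G : graph) (c : seq G) u : symmetric (@adj G) -> is_cycle c ->
  u \in c -> exists u1 u2, [/\ u1 \in c, u2 \in c, u1 != u2, adj u u1 & adj u u2].
Proof.
move=> adjS [sc uc cc] /rot_to[i s Es].
have mc z : z \in c = (z \in u :: s) by rewrite -Es mem_rot.
move: uc cc sc; rewrite -(rot_uniq i) -(rot_cycle i) -(size_rot i) Es.
case: s Es mc => [|u1 s] // Es mc; case/lastP: s Es mc => [|s u2] // Es mc.
move=> /= /and3P[_ nu1 _]; rewrite !rcons_path !last_rcons.
move=> /and3P[uu1 _ u2u] _; exists u1, u2; split=> //.
- by rewrite mc !inE eqxx orbT.
- by rewrite mc !inE mem_rcons inE eqxx !orbT.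
- by apply: contraNneq nu1 => ->; rewrite mem_rcons inE eqxx.
- by rewrite adjS.
Qed.

Section Ngon.
Variables (G : graph) (n : nat).
Hypothesis gG : generalized_ngon n G.
Let bG : bipartite G. Proof. by case: gG. Qed.
Let adjS : symmetric (@adj G). Proof. by case: bG. Qed.
Let girthG : girth_ge G (2 * n). Proof. by case: gG => _ _ []. Qed.
Let diamG : diam_le G n. Proof. by case: gG => _ []. Qed.

Lemma geodesic_upath (x y : G) p : geodesic x y p -> upath x p.
Proof.
case=> [[xp Ey] minp]; apply/andP; split=> //.
case: (walk_uniq_or_shorter xp) => // -[q [xq El lt]].
by have := minp q; rewrite /walk El Ey => /(_ (conj xq erefl)); rewrite leqNgt lt.
Qed.

Lemma short_upath_eq (x : G) p q : upath x p -> upath x q ->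
  last x p = last x q -> size p < n -> size q <= n -> p = q.
Proof.
move=> up uq El lp lq; apply: (upath_unique adjS girthG up uq El).
by rewrite mul2n -addnn -addSn leq_add.
Qed.

Lemma upath_le_diam (x y : G) : exists p, [/\ upath x p, last x p = y & size p <= n].
Proof.
have [l [p gp <-] ln] := diamG x y; exists p; split=> //.
  exact: geodesic_upath gp.
by case: gp => -[].
Qed.

(* Otherwise [w] is at distance less than [n] from all vertices of a cycle of
   length [2 * n], and the two cycle neighbours of a farthest one yield distinct
   short paths to it. *)
Lemma two_nbrs (y w : G) : adj y w -> exists2 w', adj y w' & w' != w.
Proof.
move=> yw; apply: contrapT => H.
have only v : adj y v -> v = w.
  by move=> yv; apply/eqP; apply: contrapT => /negP nv; apply: H; exists v.
have [_ _ [_ [c cc sc]]] := gG.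
have yc : y \notin c.
  apply/negP => /(cycle_nbrs adjS cc)[u1 [u2 [_ _ + /only E1 /only E2]]].
  by rewrite E1 E2 eqxx.
(* A path of length at most [n] from [y] to the cycle begins with its only neighbour [w]; dropping
   that step leaves length below [n]. *)
have P u : u \in c -> exists p, [/\ upath w p, last w p = u & size p < n].
  move=> uc; have [[|v p] [up El sp]] := upath_le_diam y u.
    by case/negP: yc; rewrite [y]El.
  have /only Ev : adj y v by case/andP: up => /= /andP[].
  exists p; split=> //; last by rewrite -Ev.
  by move: up; rewrite -cat1s => /upath_catr /=; rewrite Ev.
pose E m := `[< exists p, [/\ last w p \in c, upath w p, size p = m & m < n] >].
have exE : exists m, E m.
  have [u uc] : exists u, u \in c.
    by case: (c) cc => [[]//|u s _]; exists u; rewrite mem_head.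
  have [p [up El sp]] := P u uc.
  by exists (size p); apply/asboolP; exists p; rewrite El.
have bE m : E m -> m <= n by move=> /asboolP[p [_ _ _ /ltnW]].
have [m /asboolP[p [pc up sp ltm]] maxm] := ex_maxnP exE bE.
(* By maximality and parity the path to [v] is shorter than [p]. Prolonged to [last w p] it has to
   be [p], so [v] is the last vertex of [p] but one, for both choices of [v]. *)
have step v : v \in c -> adj (last w p) v ->
    exists2 q, last w q = v & rcons q (last w p) = p.
  move=> vc uv; have [q [uq lq sq]] := P v vc; exists q => //.
  have /maxm sq' : E (size q) by apply/asboolP; exists q; rewrite lq.
  have [/andP[wp _] /andP[wq _]] := (up, uq).
  have {}sq' : size q < m.
    rewrite ltn_neqAle sq' andbT; apply/eqP => Em.
    have := path_part bG wp; have := path_part bG wq.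
    rewrite sp -Em lq => <- Ep; have [_ /(_ _ _ uv)] := bG.
    by rewrite Ep eqxx.
  apply: (@short_upath_eq w) => //; rewrite ?last_rcons ?size_rcons //; last 2 first.
  - by apply: leq_ltn_trans ltm.
  - by rewrite sp ltnW.
  apply/andP; split; first by rewrite rcons_path wq lq adjS.
  rewrite -rcons_cons rcons_uniq; case/andP: (uq) => _ ->; rewrite andbT.
  apply/negP => lq'; case/splitPl: lq' uq sq' => q1 q2 El /upath_catl uq1.
  rewrite size_cat => sq'; have sq1 := leq_ltn_trans (leq_addr _ _) sq'.
  have Ep : q1 = p by apply: (short_upath_eq uq1 up El); rewrite ?sp ?(ltnW ltm) ?(ltn_trans sq1 ltm).
  by rewrite Ep sp ltnn in sq1.
have [u1 [u2 [u1c u2c nu u1E u2E]]] := cycle_nbrs adjS cc pc.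
have [q1 E1 Ep1] := step u1 u1c u1E; have [q2 E2 Ep2] := step u2 u2c u2E.
by move: nu; rewrite -E1 -E2; move: Ep1; rewrite -Ep2 => /rcons_inj[->]; rewrite eqxx.
Qed.

Lemma fk_upath k (x : G) p : upath x p -> size p < n ->
  fk k x (last x p) = nth x (x :: p) k.
Proof.
move=> up sp.
have up1 q : walk x (last x p) q -> size p <= size q.
  case=> xq El; have [q' [uq' El' sq' _]] := walk_upath xq.
  rewrite leqNgt; apply/negP => lt; have := leq_ltn_trans sq' lt.
  rewrite (short_upath_eq up uq') ?ltnn ?El' ?El //.
  exact: ltnW (leq_ltn_trans sq' (ltn_trans lt sp)).
have ug : unique_geodesic x (last x p) p.
  split=> [|q gq]; first by split=> //; split=> //; case/andP: up.
  have uq := geodesic_upath gq; case: (gq) => -[_ El] minq.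
  symmetry; apply: (short_upath_eq up uq) => //.
  apply: leq_trans (ltnW sp); apply: minq; split=> //; by case/andP: up.
rewrite /fk; suff -> : xget [::] [set q | unique_geodesic x (last x p) q] = p by [].
by apply: xget_unique => // q [gq _]; case: ug => _; apply.
Qed.

Hypothesis n3 : 2 < n.

(* As every vertex has two neighbours, geodesics of length [n] are not unique. *)
Lemma fk_default k (x y : G) : (forall p, upath x p -> last x p = y -> n <= size p) ->
  fk k x y = x.
Proof.
move=> far; rewrite /fk xgetPN; first by case: k => [|[]].
move=> p [gp uniqp]; have up := geodesic_upath gp; case: (gp) => -[wp El] minp.
have sp : size p = n.
  apply/eqP; rewrite eqn_leq far // andbT.
  by have [q [/andP[wq _] Eq sq]] := upath_le_diam x y; apply: leq_trans sq; apply: minp.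
case/lastP: p gp uniqp up wp El minp sp => [|p y'] gp uniqp up wp.
  by move=> _ _ E; move: n3; rewrite -E.
rewrite last_rcons => Ey; rewrite {y'}Ey in gp uniqp up wp * => minp sp.
move: (wp); rewrite rcons_path => /andP[_]; rewrite adjS => /two_nbrs[w' yw' nw].
have [r [/andP[wr _] El sr]] := upath_le_diam x w'.
have sr' : size r < n.
  rewrite ltn_neqAle sr andbT; apply/eqP => Er.
  have := path_part bG wr; have := path_part bG wp.
  rewrite El last_rcons sp Er => <- Ep; have [_ /(_ _ _ yw')] := bG.
  by rewrite Ep eqxx.
have wr' : walk x y (rcons r y).
  by split; rewrite ?last_rcons // rcons_path wr El adjS.
have /uniqp/rcons_inj[Er] : geodesic x y (rcons r y).
  by split=> // q wq; rewrite size_rcons; apply: leq_trans sr' _; rewrite -sp; apply: minp.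
by move: nw; rewrite -El Er eqxx.
Qed.

Lemma fk_cases k (x y : G) :
  (exists p, [/\ upath x p, last x p = y, size p < n & fk k x y = nth x (x :: p) k]) \/
  (forall p, upath x p -> last x p = y -> n <= size p) /\ fk k x y = x.
Proof.
have [[p [up El sp]]|H] := pselect (exists p, [/\ upath x p, last x p = y & size p < n]).
  by left; exists p; split=> //; rewrite -El fk_upath.
right; have far p : upath x p -> last x p = y -> n <= size p.
  by move=> up El; rewrite leqNgt; apply/negP => sp; apply: H; exists p.
by split=> //; apply: fk_default.
Qed.

Lemma substructure_convex (S : set G) :
  @substructure n (Ln n G) S <-> convex n S.
Proof.
split=> [sS x p up sp Sx Sl _ z zp|cS k x y Sx Sy].
  have /(nthP x)[i li <-] := zp.
  have ki : i.+1 < n.+1 by apply: leq_ltn_trans li _; apply: ltnW.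
  have := sS (Ordinal ki) x (last x p) Sx Sl.
  by rewrite /= fk_upath.
rewrite /=; have [[p [up El sp ->]]|[_ ->//]] := fk_cases k x y.
have [lk|gk] := ltnP k (size p).+1; last by rewrite nth_default.
have := mem_nth x (s := x :: p) lk; rewrite inE => /predU1P[->//|zp].
by apply: (cS x p) => //; rewrite El.
Qed.

Lemma gen_hull (S : set G) : @gen n (Ln n G) S = hull n S.
Proof.
rewrite /gen /hull; congr smallest; apply/funext => T; apply/propext.
exact: substructure_convex.
Qed.

(** Adjacency is not a symbol of the language. It is recovered from [f_1], whose default value is
    its first argument, so that embeddings of structures are embeddings of graphs. *)
Lemma adj_fk (i1 : 'I_n.+1) (x y : G) : i1 = 1%N :> nat ->
  adj x y <-> x != y /\ fk i1 x y = y.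
Proof.
move=> E1; split=> [xy|[nxy]].
  have nxy : x != y by apply: contraTneq xy => <-; apply/negP => /bG.2; rewrite eqxx.
  split=> //; have := @fk_upath i1 x [:: y]; rewrite E1 /=; apply=> //.
  - by rewrite /upath /= xy inE nxy.
  - exact: ltn_trans n3.
have [[[|z p] [up El sp ->]]|[_ ->]] := fk_cases i1 x y; rewrite ?E1 /=.
- by move=> Exy; rewrite Exy eqxx in nxy.
- by move=> <-; case/andP: up => /= /andP[].
- by move=> Exy; rewrite Exy eqxx in nxy.
Qed.

End Ngon.

Section IsoLn.
Variables (G1 G2 : graph) (n : nat).
Hypotheses (g1 : generalized_ngon n G1) (g2 : generalized_ngon n G2) (n3 : 2 < n).

(** Convexity of the domain carries short paths forward and convexity of the range pulls them back;
    so the pairs on which [f_k] takes its default value correspond too. *)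
Lemma iso_rel_fk (R : set (G1 * G2)) k x y x' y' : iso_rel R ->
  convex n (dom_rel R) -> convex n (rng_rel R) ->
  R (x, x') -> R (y, y') -> R (fk k x y, fk k x' y').
Proof.
move=> iR cd cr Rx Ry.
have [[p [up El sp ->]]|[far ->]] := fk_cases g1 n3 k x y.
  have [|t Et Rt] := @lift_dom _ _ R p.
    by apply: (cd x p); rewrite ?El //; [exists x'|exists y'].
  rewrite -Et in up El sp *.
  have := iso_rel_last Rx Rt; rewrite El => Rl.
  have [Rinj _ _] := iR; have Ey' := (Rinj _ _ _ _ Rl Ry).1 erefl.
  rewrite -Ey' (fk_upath g2) -?(iso_rel_upath iR Rx Rt) //; last by rewrite !size_map in sp *.
  have [lk|gk] := ltnP k (size t).+1; last by rewrite !nth_default //= !size_map.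
  rewrite -[x :: _]/(map fst ((x, x') :: t)) -[x' :: _]/(map snd ((x, x') :: t)).
  rewrite !(nth_map (x, x')) // -surjective_pairing.
  by have := mem_nth (x, x') (s := (x, x') :: t) lk; rewrite inE => /predU1P[->|/Rt].
rewrite (fk_default g2 n3) // => p up El; rewrite leqNgt; apply/negP => sp.
have [|t Et Rt] := @lift_rng _ _ R p.
  by apply: (cr x' p); rewrite ?El //; [exists x|exists y].
rewrite -Et in up El sp.
have := iso_rel_last Rx Rt; rewrite El => Rl.
have [Rinj _ _] := iR; have Ey := (Rinj _ _ _ _ Rl Ry).2 erefl.
have := far (unzip1 t); rewrite (iso_rel_upath iR Rx Rt) => /(_ up Ey).
by rewrite !size_map in sp *; rewrite leqNgt sp.
Qed.

Lemma embedding_adj (e : Ln n G1 -> Ln n G2) (x y : G1) :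
  embedding e -> adj (e x : G2) (e y : G2) = adj x y.
Proof.
case=> einj _ ef; have i1 : 1 < n.+1 by rewrite ltnS; apply: ltn_trans n3.
have E1 : Ordinal i1 = 1%N :> nat by [].
apply/idP/idP.
  move=> /(adj_fk g2 n3 _ _ E1)[ne]; have /= <- := ef (Ordinal i1) x y => /einj E.
  by apply/(adj_fk g1 n3 _ _ E1); split=> //; apply: contraNneq ne => ->.
move=> /(adj_fk g1 n3 _ _ E1)[ne E].
apply/(adj_fk g2 n3 _ _ E1); split; first by apply: contraNneq ne => /einj ->.
by have /= <- := ef (Ordinal i1) x y; rewrite E.
Qed.

End IsoLn.

(** * Types and automorphisms *)

Section Gen.
Variables (n : nat) (M : Lstruct n).
Implicit Types (A B S : set M).

Lemma gen_sub A : substructure (gen A).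
Proof.
move=> k x y Ax Ay S [sS AS]; have P : _ /\ _ := conj sS AS.
by apply: sS; [apply: (Ax S P)|apply: (Ay S P)].
Qed.

Lemma sub_gen A : A `<=` gen A.
Proof. exact: sub_gen_smallest. Qed.

Lemma gen_min A S : substructure S -> A `<=` S -> gen A `<=` S.
Proof. exact: smallest_sub. Qed.

Lemma gen_id S : substructure S -> gen S = S.
Proof. exact: smallest_id. Qed.

Lemma genS A B : A `<=` B -> gen A `<=` gen B.
Proof.
move=> AB; apply: gen_min; first exact: gen_sub.
by apply: subset_trans AB _; apply: sub_gen.
Qed.

Lemma gen_eq A B : A `<=` gen B -> B `<=` gen A -> gen A = gen B.
Proof.
by move=> AB BA; apply/seteqP; split; apply: gen_min => //; apply: gen_sub.
Qed.

Lemma genUl A B : gen (gen A `|` B) = gen (A `|` B).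
Proof.
apply: gen_eq => x [Ax|Bx].
- by apply: (genS _ Ax) => y; left.
- by apply: sub_gen; right.
- by apply: sub_gen; left; apply: sub_gen.
- by apply: sub_gen; right.
Qed.

Lemma genUr A B : gen (A `|` gen B) = gen (A `|` B).
Proof. by rewrite setUC genUl setUC. Qed.

Lemma fg_sub_substructure A : fg_sub A -> substructure A.
Proof. by case=> s ->; apply: gen_sub. Qed.

Lemma fg_sub_gen A : fg_sub A -> gen A = A.
Proof. by move/fg_sub_substructure/gen_id. Qed.

Lemma fg_sub_genU A B : fg_sub A -> fg_sub B -> fg_sub (gen (A `|` B)).
Proof.
move=> [s ->] [t ->]; exists (s ++ t); rewrite /gens genUl genUr; congr gen.
by apply/seteqP; split=> x /=; rewrite mem_cat => /orP.
Qed.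

Lemma gensP m (s : m.-tuple M) x :
  gens s x <-> exists t : term n m, eval (tnth s) t = x.
Proof.
split.
  apply: (gen_min (S := [set x | exists t : term n m, eval (tnth s) t = x])).
    by move=> k _ _ [t <-] [u <-]; exists (TApp k t u).
  by move=> y /= /tnthP[i ->]; exists (TVar n i).
case=> t <-; elim: t => [i|k t Ht u Hu] /=.
  by apply: sub_gen; apply: mem_tnth.
exact: gen_sub.
Qed.

End Gen.

Section Embed.
Variables (n : nat) (M N : Lstruct n) (e : M -> N).
Hypothesis eE : embedding e.

Lemma gen_image (A : set M) : gen (e @` A) = e @` gen A.
Proof.
have [_ _ ef] := eE; apply/seteqP; split.
  apply: gen_min => [k _ _ [x Ax <-] [y Ay <-]|_ [x Ax <-]].
    by exists (sf k x y) => //; apply: gen_sub.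
  by exists x => //; apply: sub_gen.
move=> _ [x Ax <-]; apply: (gen_min (S := e @^-1` gen (e @` A)) _ _ Ax).
  by move=> k y z /= hy hz; rewrite ef; apply: gen_sub.
by move=> y Ay; apply: sub_gen; exists y.
Qed.

Lemma gens_image (s : seq M) : gens (map e s) = e @` gens s.
Proof.
rewrite -gen_image; congr gen; apply/seteqP; split=> [y /mapP[x xs ->]|].
  by exists x.
by move=> _ [x xs <-]; apply: map_f.
Qed.

Lemma fg_sub_image (A : set M) : fg_sub A -> fg_sub (e @` A).
Proof. by case=> s ->; exists (map e s); rewrite gens_image. Qed.

End Embed.

Lemma embedding_comp n (M N K : Lstruct n) (e : M -> N) (f : N -> K) :
  embedding e -> embedding f -> embedding (f \o e).
Proof.
case=> ei ep ef [fi fp ff]; split=> [x y /= /fi /ei//|x|k x y] /=.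
  by rewrite fp ep.
by rewrite ef ff.
Qed.

Section Auto.
Variables (n : nat) (M : Lstruct n).

Lemma automorphism_inv (h : M -> M) : automorphism h ->
  exists2 h', automorphism h' & cancel h h' /\ cancel h' h.
Proof.
case=> -[h' hK h'K] [hi hp hf]; exists h'; last by [].
split; first by exists h.
split=> [|x|k x y]; first exact: can_inj h'K.
  by rewrite -hp h'K.
by apply: hi; rewrite hf !h'K.
Qed.

Lemma automorphism_comp (h k : M -> M) :
  automorphism h -> automorphism k -> automorphism (k \o h).
Proof.
move=> [hb he] [kb ke]; split; last exact: embedding_comp.
exact: bij_comp.
Qed.

Lemma eval_auto (h : M -> M) m (v : 'I_m -> M) (t : term n m) : embedding h ->
  eval (h \o v) t = h (eval v t).
Proof. by case=> _ _ hf; elim: t => //= k t -> u ->; rewrite hf. Qed.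

Lemma sat_auto (h : M -> M) m (phi : formula n m) (v : 'I_m -> M) :
  automorphism h -> sat phi (h \o v) <-> sat phi v.
Proof.
move=> ha; have [hb he] := ha; have [hi hp hf] := he.
elim: phi v => {m} [m t u|m t|m|m f1 IH1 f2 IH2|m f IH] v /=.
- by rewrite !eval_auto //; split=> [/hi|->].
- by rewrite eval_auto // hp.
- by [].
- by rewrite IH1 IH2.
- have E a : (fun i => oapp (h \o v) (h a) (unlift ord0 i)) =
      h \o (fun i => oapp v a (unlift ord0 i)).
    by apply/funext => i /=; case: unlift.
  have [h' _ [hK h'K]] := automorphism_inv ha.
  split=> H a; first by apply/IH; rewrite -E.
  by rewrite -[a]h'K E; apply/IH.
Qed.

Hypothesis homM : homogeneous M.

(** Atomic formulas suffice: equations between terms make [g] well defined and injective on the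
    generated substructure, [FP] makes it preserve the sorts, and homogeneity extends it. *)
Lemma same_formulas_auto m (s s' : m.-tuple M) :
    (forall phi : formula n m, sat phi (tnth s) <-> sat phi (tnth s')) ->
  exists2 h, automorphism h & map h s = s'.
Proof.
move=> same.
have sameE t u : eval (tnth s) t = eval (tnth s) u <->
    eval (tnth s') t = eval (tnth s') u by have := same (FEq t u).
pose g x := if pselect (exists t : term n m, eval (tnth s) t = x) is left H
  then eval (tnth s') (projT1 (cid H)) else x.
have gE t : g (eval (tnth s) t) = eval (tnth s') t.
  rewrite /g; case: pselect => [H|[]]; last by exists t.
  by apply/sameE; case: cid.
have [|h ha hg] := homM (ex_intro _ _ erefl : fg_sub (gens s)) (ex_intro _ _ erefl : fg_sub (gens s')) (g := g).
  split; first split.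
  - by move=> _ /gensP[t <-]; rewrite gE; apply/gensP; exists t.
  - move=> x y; rewrite !inE => /gensP[t <-] /gensP[u <-].
    by rewrite !gE => /sameE.
  - by move=> _ /gensP[t <-]; exists (eval (tnth s) t) => //; apply/gensP; exists t.
  - move=> _ /gensP[t <-]; rewrite gE; have /= E := same (FP t).
    by apply/idP/idP => /E.
  - move=> k _ _ /gensP[t <-] /gensP[u <-].
    by rewrite !gE -[sf k _ _]/(eval (tnth s) (TApp k t u)) gE.
exists h => //; suff -> : s' = [tuple of map h s] by [].
apply: eq_from_tnth => i; rewrite tnth_map hg; first by rewrite (gE (TVar n i)).
by apply/gensP; exists (TVar n i).
Qed.

(** A generating tuple of [C] is enough as parameters, since an automorphism that fixes generators
    fixes everything they generate. *)
Lemma same_typeP (C : set M) m (a a' : m.-tuple M) : fg_sub C ->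
  same_type C a a' <-> exists h, [/\ automorphism h, map h a = a' &
    forall x, C x -> h x = x].
Proof.
move=> [c ->]; split=> [same|[h [ha hm hC]] p d phi dC]; last first.
  rewrite -(sat_auto phi _ ha).
  suff -> : h \o tnth [tuple of a ++ d] = tnth [tuple of a' ++ d] by [].
  have E : [tuple of a' ++ d] = [tuple of map h [tuple of a ++ d]].
    apply: val_inj; rewrite /= map_cat hm; congr cat.
    by rewrite -[LHS]map_id; apply/eq_in_map => x /tnthP[j ->]; rewrite hC.
  by apply/funext => i; rewrite E tnth_map.
have [h ha] := same_formulas_auto (fun phi => same _ (in_tuple c) phi
  (fun i => sub_gen (mem_tnth i (in_tuple c)))).
rewrite /= map_cat => /eqP; rewrite eqseq_cat ?size_map ?size_tuple // => /andP[/eqP Ea /eqP Ec].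
exists h; split=> // x; case: ha => _ [_ _ hf]; move: x.
apply: (gen_min (S := [set x | h x = x])) => [k x y /= hx hy|x /= xc].
  by rewrite hf hx hy.
by move: Ec; rewrite -[RHS]map_id => /eq_in_map; apply.
Qed.

End Auto.

(** * Independence *)

Section Amalgam.
Variable G : graph.
Implicit Types X Y Z : set G.

Lemma free_amalgamC X Y Z : free_amalgam X Y Z -> free_amalgam Y X Z.
Proof.
case=> XY e; split=> [|x y]; first by rewrite setIC.
by rewrite setUC => Xx Xy /(e x y Xx Xy)[]; auto.
Qed.

Lemma free_amalgam_embed (G' : graph) (f : G -> G') X Y Z :
    injective f -> (forall x y, adj (f x) (f y) = adj x y) ->
  free_amalgam (f @` X) (f @` Y) (f @` Z) <-> free_amalgam X Y Z.
Proof.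
move=> fI fE; have imI S T : f @` S `&` f @` T = f @` (S `&` T).
  apply/seteqP; split=> [_ [[x Sx <-] [y Ty /fI E]]|_ [x [Sx Tx] <-]].
    by exists x => //; split=> //; rewrite -E.
  by split; exists x.
have imE S x : (f @` S) (f x) <-> S x.
  by split=> [[y Sy /fI <-]|Sx] //; exists x.
split=> -[XY e]; split.
- apply/seteqP; split=> x.
    by case=> Xx Yx; apply/imE; rewrite -XY; split; apply/imE.
  move=> /imE; rewrite -XY => -[/imE Xx /imE Yx]; by split.
- move=> x y Xx Xy xy; have := e (f x) (f y); rewrite fE -!image_setU !imE.
  by apply.
- by rewrite imI XY.
- move=> x' y'; rewrite -image_setU => -[x Xx <-] [y Xy <-].
  by rewrite fE !imE; apply: e.
Qed.

End Amalgam.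

Lemma indep_embed (G1 G2 : graph) n (e : Ln n G1 -> Ln n G2) (A B C : set (Ln n G1)) :
  generalized_ngon n G1 -> generalized_ngon n G2 -> 2 < n -> embedding e ->
  ngon_indep (e @` A) (e @` B) (e @` C) <-> ngon_indep A B C.
Proof.
move=> g1 g2 n3 eE; have [eI _ _] := eE.
have eadj (x y : G1) : adj (e x : G2) (e y : G2) = adj x y by apply: embedding_adj.
rewrite /ngon_indep -!image_setU !gen_image // -image_setU.
split=> -[fa st]; split.
- by apply/(free_amalgam_embed (G := G1) (G' := G2) _ _ _ eI eadj).
- by apply/(strong_embed (G := G1) (G' := G2) eI eadj).
- by apply/(free_amalgam_embed (G := G1) (G' := G2) _ _ _ eI eadj).
- by apply/(strong_embed (G := G1) (G' := G2) eI eadj).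
Qed.

Section Independence.
Variables (n : nat) (G : graph).
Hypotheses (n3 : 2 < n) (gG : generalized_ngon n G).
Implicit Types A B C D : set (Ln n G).

Let adjS : symmetric (@adj G). Proof. by case: gG => -[]. Qed.

Lemma convex_gen A : convex n (gen A : set G).
Proof. by rewrite gen_hull //; apply: hull_convex. Qed.

Lemma indep_sym A B C : ngon_indep A B C -> ngon_indep B A C.
Proof.
rewrite /ngon_indep => -[fa st]; split; first exact: free_amalgamC.
by rewrite setUC [B `|` A]setUC.
Qed.

(** An excursion from the union of [A] and [B] inside that of [A] and [E] has its interior in [E]
    and off [A]. By freeness its ends lie in [E], hence in [B], which is convex. So [hull_strong]
    applies. Monotonicity is this statement, and existence uses it to cut two large copies down to
    the given sets. *)
Lemma free_amalgam_shrink (A B C E : set G) : convex n B -> B `<=` E -> C `<=` B ->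
    free_amalgam A E C -> strong n (A `|` E) (hull n (A `|` E)) ->
  [/\ free_amalgam A B C, strong n (A `|` B) (hull n (A `|` B)),
    free_amalgam (hull n (A `|` B)) E B &
    strong n (hull n (A `|` B) `|` E) (hull n (A `|` E))].
Proof.
move=> cB BE CB [AE eAE] sAE.
have XE x : (A `|` B) x -> E x -> B x.
  by case=> // Ax Ex; apply: CB; rewrite -AE.
have XY : A `|` B `<=` A `|` E by apply: setUS.
have cX : rconvex n (A `|` B) (A `|` E).
  apply: rconvexP => a q b exc lt qY.
  have [Xa Xb uq q0 nq] := exc.
  have [z [z' [zq zq' az zb]]] := excursion_ends exc.
  have Eend x v : (A `|` B) x -> v \in q -> adj x v -> B x.
    move=> Xx vq xv; apply: XE => //.
    have [[_ Av]|[]//] := eAE x v (XY _ Xx) (qY v vq) xv.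
    by case: (nq v vq); left.
  apply: (@excursion_convex G n B a q b cB _ lt); split=> //.
  - exact: Eend az.
  - by apply: (Eend _ z') => //; rewrite adjS.
  - by move=> v vq Bv; apply: (nq v vq); right.
have [hY he hs sX] := hull_strong adjS n3 sAE (@hull_convex _ n _) XY cX.
have Xh := @sub_hull _ n (A `|` B).
split=> //; first split.
- apply/seteqP; split=> x; first by case=> Ax Bx; rewrite -AE; split=> //; apply: BE.
  by move=> Cx; split; [move: Cx; rewrite -AE => -[]|apply: CB].
- move=> x y Xx Xy xy; have [?|[Ex Ey]] := eAE x y (XY _ Xx) (XY _ Xy) xy; first by left.
  by right; split; apply: XE.
- split.
    apply/seteqP; split=> x; last by move=> Bx; split; [apply: Xh; right|apply: BE].
    case=> hx Ex; have : (hull n (A `|` B) `&` (A `|` E)) x by split=> //; right.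
    by rewrite hY => Xx; apply: XE.
  have side x y : hull n (A `|` B) x -> E y -> adj x y ->
     hull n (A `|` B) y \/ E x.
    move=> hx Ey xy; have [Xx|Xy] := he x y hx (or_intror Ey) xy; last by left; apply: Xh.
    have [[_ Ay]|[Ex _]] := eAE x y (XY _ Xx) (or_intror Ey) xy; last by right.
    by left; apply: Xh; left.
  move=> x y [hx|Ex] [hy|Ey] xy; [by left| | |by right].
    by have [hy|Ex] := side x y hx Ey xy; [left|right].
  by rewrite adjS in xy; have [hx|Ey] := side y x hy Ex xy; [left|right].
- have <- // : hull n (A `|` B) `|` (A `|` E) = hull n (A `|` B) `|` E.
  by rewrite setUA; congr setU; apply/setUidl => x Ax; apply: Xh; left.
Qed.

Lemma indepE A B C : ngon_indep A B C <->
  free_amalgam (gen (A `|` C) : set G) (gen (B `|` C)) C /\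
  strong n (gen (A `|` C) `|` gen (B `|` C) : set G)
    (hull n (gen (A `|` C) `|` gen (B `|` C) : set G)).
Proof.
rewrite /ngon_indep -(gen_hull gG n3); have -> // : gen (gen (A `|` C) `|` gen (B `|` C)) =
    gen (A `|` B `|` C) :> set (Ln n G).
by rewrite genUl genUr; congr gen; rewrite setUACA setUid.
Qed.

Lemma indep_monotonicity A B C D : ngon_indep A (gen (B `|` D)) C ->
  ngon_indep A B C /\ ngon_indep A D (gen (B `|` C)).
Proof.
have EE : gen (gen (B `|` D) `|` C) = gen (B `|` C `|` D) :> set (Ln n G).
  by rewrite genUl setUAC.
move/indepE; rewrite EE => -[fa st].
have [|||fa1 s1 fa2 s2] := @free_amalgam_shrink (gen (A `|` C)) (gen (B `|` C)) C
  (gen (B `|` C `|` D)) _ _ _ fa st.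
- exact: convex_gen.
- exact: (@genS n (Ln n G) (B `|` C) (B `|` C `|` D) (@subsetUl _ _ _)).
- by move=> x Cx; apply: sub_gen; right.
split; first by apply/indepE.
have EA : gen (A `|` gen (B `|` C)) = hull n (gen (A `|` C) `|` gen (B `|` C)) :> set G.
  rewrite -gen_hull // !(genUl, genUr); apply: (f_equal (@gen n (Ln n G))).
  by rewrite setUACA setUid setUA.
apply/indepE; rewrite EA [D `|` _]setUC genUl; split=> //.
suff -> : hull n (hull n (gen (A `|` C) `|` gen (B `|` C)) `|` gen (B `|` C `|` D) : set G)
   = hull n (gen (A `|` C) `|` gen (B `|` C `|` D) : set G) by [].
rewrite -EA -!(gen_hull gG n3) !(genUl, genUr); apply: (f_equal (@gen n (Ln n G))).
rewrite -!setUA; congr setU; apply/seteqP; split=> x /=; tauto.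
Qed.

Hypothesis homG : homogeneous (Ln n G).

Lemma gens_map (h : Ln n G -> Ln n G) (s : seq (Ln n G)) : automorphism h ->
  gens (map h s) = h @` gens s.
Proof. by case=> _ eh; rewrite gens_image. Qed.

Lemma indep_automorphism (h : Ln n G -> Ln n G) A B C : automorphism h ->
  ngon_indep A B C <-> ngon_indep (h @` A) (h @` B) (h @` C).
Proof. by case=> _ eh; split=> /(indep_embed _ _ _ gG gG n3 eh). Qed.

Lemma indep_invariance p q r (a a' : p.-tuple (Ln n G)) (b b' : q.-tuple (Ln n G))
    (c c' : r.-tuple (Ln n G)) :
    same_type set0 [tuple of a ++ b ++ c] [tuple of a' ++ b' ++ c'] ->
  ngon_indep (gens a) (gens b) (gens c) <-> ngon_indep (gens a') (gens b') (gens c').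
Proof.
have f0 : fg_sub (set0 : set (Ln n G)).
  exists [::]; symmetry; apply/seteqP; split=> //.
  by apply: gen_min.
move/(same_typeP homG _ _ f0) => [h [ha + _]]; rewrite /= !map_cat => /eqP.
rewrite !eqseq_cat ?size_map ?size_tuple // => /and3P[/eqP <- /eqP <- /eqP <-].
by rewrite !gens_map //; apply: indep_automorphism.
Qed.

(* Two automorphic copies over [C] of a set independent from [B] are conjugate
   over [B]: glue the isomorphism with the identity and extend to the hulls. *)
Lemma indep_stationarity m (a a' : m.-tuple (Ln n G)) B C :
    fg_sub B -> fg_sub C -> same_type C a a' ->
    ngon_indep (gens a) B C -> ngon_indep (gens a') B C ->
  same_type (gen (B `|` C)) a a'.
Proof.
move=> fB fC /(same_typeP homG _ _ fC)[h [ha Ea hC]].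
have [_ eh] := ha; have [hI hP hf] := eh.
have hadj (x y : G) : adj (h x : G) (h y : G) = adj x y by apply: embedding_adj.
rewrite -Ea gens_map // => /indepE[[AB eAB] sAB] /indepE.
set A := gen (gens a `|` C); set B1 := gen (B `|` C).
have -> : gen (h @` gens a `|` C) = h @` A :> set (Ln n G).
  rewrite -(gen_image eh (gens a `|` C)) image_setU; congr (gen (_ `|` _)).
  apply/seteqP; split=> [x Cx|_ [x Cx <-]]; last by rewrite hC.
  by exists x => //; apply: hC.
rewrite -/A -/B1 in AB eAB sAB *.
case=> -[AB' eAB'] sAB'.
have inC x : A x -> B1 x -> C x by move=> Ax Bx; rewrite -AB.
(* [h x] lies in [C], hence is fixed by [h]; injectivity gives [h x = x]. *)
have inC' x : A x -> B1 (h x) -> C x.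
  move=> Ax Bx; have Chx : C (h x) by rewrite -AB'; split=> //; exists x.
  by rewrite -(hI _ _ (hC _ Chx)).
pose R0 : set (G * G) := [set p | (A p.1 /\ p.2 = h p.1) \/ (B1 p.1 /\ p.2 = p.1)].
have iR0 : iso_rel R0.
  (* An edge between the two sides of a free amalgam over [C] has an end in [C], and [h] fixes that
     end. *)
  have adjAB x y : A x -> B1 y -> adj (h x : G) (y : G) = adj (x : G) (y : G).
    move=> Ax By; apply/idP/idP => xy.
      have [[_ [y' Ay' Ey]]|[Bx _]] := eAB' _ _ (or_introl (imageP h Ax)) (or_intror By) xy.
        have Cy' : C y' by apply: inC'; rewrite ?Ey.
        by move: xy; rewrite -Ey hadj (hC _ Cy').
      by move: xy; rewrite (hC _ (inC' x Ax Bx)).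
    have [[_ Ay]|[Bx _]] := eAB _ _ (or_introl Ax) (or_intror By) xy.
      by rewrite -[y]hC ?hadj //; apply: inC.
    by rewrite (hC x) //; apply: inC.
  split=> [x y x' y'|x y x' y'|x x'] /=.
  - case=> -[/= Px ->] [] [/= Py ->].
    + by split=> [->//|/hI].
    + split=> [Exy|Ehx].
        by rewrite -Exy in Py *; apply: hC; apply: inC.
      by rewrite -Ehx in Py *; rewrite hC //; apply: inC'.
    + split=> [Exy|Ehx].
        by rewrite Exy in Px *; rewrite hC //; apply: inC.
      by rewrite Ehx in Px *; rewrite hC //; apply: inC'.
    + by [].
  - case=> -[/= Px ->] [] [/= Py ->] //.
    + by rewrite adjAB.
    + by rewrite adjS -adjAB // adjS.
  - by case=> -[/= _ ->] //; rewrite -[LHS]hP.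
have D0 : dom_rel R0 = A `|` B1.
  apply/seteqP; split=> [x [y [[Ax _]|[Bx _]]]|x [Ax|Bx]]; [by left|by right| |].
    by exists (h x); left.
  by exists x; right.
have E0 : rng_rel R0 = h @` A `|` B1.
  apply/seteqP; split=> [y [x [[/= Ax ->]|[/= Bx ->]]]|y [[x Ax <-]|Bx]].
  - by left; exists x.
  - by right.
  - by exists x; left.
  - by exists y; right.
have pG := generalized_ngon_pregon gG.
have [|R [iR R0R dR rR [cdR crR]]] :=
    iso_extend pG pG n3 (@hull_convex G n (A `|` B1)) (@hull_convex G n (h @` A `|` B1)) (R0 := R0).
  by split=> //; [rewrite D0; exact: sAB|rewrite E0; exact: sAB'].
have {}dR : dom_rel R = hull n (A `|` B1).
  apply/seteqP; split=> //; apply: hull_min => //; rewrite -D0.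
  by move=> x [y /R0R Rxy]; exists y.
have {}rR : rng_rel R = hull n (h @` A `|` B1).
  apply/seteqP; split=> //; apply: hull_min => //; rewrite -E0.
  by move=> y [x /R0R Rxy]; exists x.
have fA : fg_sub A by apply: fg_sub_genU => //; exists a.
have fB1 : fg_sub B1 by apply: fg_sub_genU.
have fdR : fg_sub (dom_rel R : set (Ln n G)).
  by rewrite dR -gen_hull //; apply: fg_sub_genU.
have frR : fg_sub (rng_rel R : set (Ln n G)).
  by rewrite rR -gen_hull //; apply: fg_sub_genU => //; apply: fg_sub_image.
pose g (x : Ln n G) : Ln n G := xget x [set y | R (x, y)].
have [Rinj Radj Rpart] := iR.
have gE x y : R (x, y) -> g x = y.
  by move=> Rxy; apply: xget_unique => // z Rxz; apply: (Rinj _ _ _ _ Rxz Rxy).1.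
have [|k ka kg] := homG fdR frR (g := g).
  split; first split.
  - by move=> x [y Rxy]; rewrite (gE _ _ Rxy); exists x.
  - move=> x y /set_mem[x' Rx] /set_mem[y' Ry]; rewrite (gE _ _ Rx) (gE _ _ Ry).
    by move=> E; apply: (Rinj _ _ _ _ Rx Ry).2.
  - by move=> y [x Rxy]; exists x; [exists y|apply: gE].
  - by move=> x [y Rxy]; rewrite (gE _ _ Rxy) -[LHS](Rpart _ _ Rxy).
  - move=> i x y [x' Rx] [y' Ry]; rewrite (gE _ _ Rx) (gE _ _ Ry).
    by apply: gE; apply: (iso_rel_fk gG gG n3 i iR cdR crR Rx Ry).
have kR x y : R (x, y) -> k x = y.
  by move=> Rxy; rewrite kg; [apply: gE|exists y].
have fBC : fg_sub (gen (B `|` C)) by [].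
apply/(same_typeP homG _ _ fBC); exists k; split=> //.
  rewrite -Ea; apply/eq_in_map => x xa; apply: kR; apply: R0R; left; split=> //.
  by apply: sub_gen; left; apply: sub_gen.
by move=> x Bx; apply: kR; apply: R0R; right.
Qed.

End Independence.

(** * Free completions *)

Section Induced.
Variables (G : graph) (X : set G).

Lemma induced_path (x : induced X) p :
  path (@adj (induced X)) x p = path (@adj G) (val x) (map val p).
Proof. by rewrite path_map. Qed.

Lemma induced_upath (x : induced X) p : upath x p = upath (val x) (map val p).
Proof.
by rewrite /upath induced_path -map_cons map_inj_uniq //; apply: val_inj.
Qed.

Lemma induced_lift (s : seq G) : (forall z, z \in s -> X z) ->
  exists t : seq (induced X), map val t = s.
Proof.
move=> sX; have [|t Et _] := @lift_seq (induced X) G (fun=> True) val s.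
  by move=> z /sX Xz; exists (exist _ z (mem_set Xz)).
by exists t.
Qed.

Lemma induced_val (x : induced X) : X (val x).
Proof. exact: set_valP. Qed.

(* [dist_eq] in [induced X], without dependent types. *)
Definition rdist (x y : G) (m : nat) := [/\ X x, X y,
  exists p, [/\ path (@adj G) x p, last x p = y, forall z, z \in p -> X z & size p = m] &
  forall p, path (@adj G) x p -> last x p = y -> (forall z, z \in p -> X z) ->
    m <= size p].

Lemma rdistP (x y : induced X) m : dist_eq x y m <-> rdist (val x) (val y) m.
Proof.
split=> [[p [[xp Ey] minp] <-]|[_ _ [p [xp Ey pX <-]] minp]].
  split; try exact: induced_val.
  - exists (map val p); split; rewrite ?size_map ?last_map ?Ey -?induced_path //.
    by move=> z /mapP[u _ ->]; apply: induced_val.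
  - move=> q xq Eq /induced_lift[t Et]; rewrite -{}Et in xq Eq *.
    rewrite last_map -induced_path in xq Eq.
    by rewrite size_map; apply: minp; split=> //; apply: val_inj.
have [t Et] := induced_lift pX; rewrite -{}Et in xp Ey minp *.
rewrite last_map -induced_path in xp Ey.
exists t; last by rewrite size_map.
split=> [|q [xq Eq]]; first by split=> //; apply: val_inj.
rewrite -(size_map val) -(size_map val q); apply: minp.
- by rewrite -induced_path.
- by rewrite last_map Eq.
- by move=> z /mapP[u _ ->]; apply: induced_val.
Qed.

End Induced.

Lemma path_nbrs (G : graph) (x w : G) p : symmetric (@adj G) -> upath x p ->
    w \in p -> w != last x p ->
  exists u v, [/\ u \in x :: p, v \in x :: p, u != v, adj w u & adj w v].
Proof.
move=> adjS /andP[xp up] /split_seq[p1 [p2 Ep]]; rewrite Ep last_cat /= => nl.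
case: p2 Ep nl => [|v p2] Ep; first by rewrite eqxx.
move=> _; exists (last x p1), v.
move: xp; rewrite Ep cat_path => /andP[_ /= /and3P[aw wv _]].
rewrite Ep -cat_cons lastI cat_rcons cat_uniq in up.
move: up => /and3P[_ _ /= /and3P[nl _ _]]; rewrite -cat_cons lastI cat_rcons.
split=> //; last by rewrite adjS.
- by rewrite mem_cat mem_head orbT.
- by rewrite mem_cat !inE eqxx !orbT.
- by apply: contraNneq nl => ->; rewrite !inE eqxx orbT.
Qed.

Local Arguments path_vertex : simpl never.

Lemma odd_succ_pred m : 0 < m -> odd m.+1 = odd m.-1.
Proof. by case: m => //= m _; rewrite negbK. Qed.

Section Free.
Variables (n : nat) (G : graph).
Hypotheses (n3 : 2 < n) (bG : bipartite G).

Local Notation Amb := (ambient n G).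
Local Notation S := (@stage n G).
Local Notation pv := (@path_vertex n G).

Definition new_arc j (x y : fvert G) := rdist (S j) (x : Amb) y n.+1 /\ oriented x y.

Lemma stageS j v : S j.+1 v <->
  S j v \/ exists x y k, [/\ new_arc j x y, 0 < k < n.-1 & v = fnew x y k].
Proof.
split=> [[Sv|[x [y [k [/rdistP d o hk ->]]]]]|[Sv|[x [y [k [[d o] hk ->]]]]]].
- by left.
- by right; exists (val x), (val y), k.
- by left.
right; have [Sx Sy _ _] := d.
exists (exist _ x (mem_set Sx)), (exist _ y (mem_set Sy)), k; split=> //.
exact/rdistP.
Qed.

Lemma stage_mono i j : i <= j -> S i `<=` S j.
Proof.
move=> /subnKC <-; elim: (j - i) => [|k IH]; first by rewrite addn0.
by move=> v /IH Sv; rewrite addnS; apply/stageS; left.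
Qed.

Lemma stage_fnew i x y k : S i (fnew x y k) <->
  0 < k < n.-1 /\ exists2 j, j < i & new_arc j x y.
Proof.
split=> [|[hk [j ji na]]]; last first.
  by apply: (stage_mono ji); apply/stageS; right; exists x, y, k.
elim: i => [[]//|i IH] /stageS[/IH[hk [j ji na]]|[x' [y' [k' [na hk [-> -> ->]]]]]].
  by split=> //; exists j => //; apply: leqW.
by split=> //; exists i.
Qed.

Lemma fedgeP (u v : fvert G) : fedge n u v ->
  (exists u0 v0, [/\ adj u0 v0, u = fbase u0 & v = fbase v0]) \/
  exists x y k, k < n.-1 /\ ((u = pv x y k /\ v = pv x y k.+1) \/
    (v = pv x y k /\ u = pv x y k.+1)).
Proof.
elim=> {u v} [u v uv|x y k lk|u v _ [[u0 [v0 [uv -> ->]]]|[x [y [k [lk H]]]]]].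
- by left; exists u, v.
- by right; exists x, y, k; split=> //; left.
- by left; exists v0, u0; rewrite bG.1.
- by right; exists x, y, k; split=> //; case: H => -[-> ->]; [right|left].
Qed.

Lemma adjP (u v : Amb) : reflect (fedge n u v) (adj u v).
Proof. exact: asboolP. Qed.

Lemma amb_sym : symmetric (@adj Amb).
Proof. by move=> u v; apply/adjP/adjP; apply: fedge_sym. Qed.

Lemma pv_inner x y k : 0 < k < n.-1 -> pv x y k = fnew x y k.
Proof. by rewrite /path_vertex; case: k => //= k lk; rewrite ltn_eqF. Qed.

Lemma pv0 x y : pv x y 0 = x. Proof. by []. Qed.

Lemma pv_last x y : pv x y n.-1 = y.
Proof. by rewrite /path_vertex eqxx; case: n n3 => [|[|]]. Qed.

Lemma pv_adj x y k : k < n.-1 -> adj (pv x y k : Amb) (pv x y k.+1).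
Proof. by move=> lk; apply/adjP/fedge_path. Qed.

(** Any other edge at this vertex would be the first or last edge of a further arc ending in it. The
    ends of an arc are older than its inner vertices, so the vertex would already belong to stage
    [j]. *)
Lemma fnew_nbr j x y k u : ~ S j (fnew x y k) -> S j.+1 (fnew x y k) -> S j.+1 u ->
  adj (fnew x y k : Amb) u -> u = pv x y k.+1 \/ u = pv x y k.-1.
Proof.
move=> nSw Sw Su /adjP/fedgeP[[u0 [v0 [_ //]]]|[x' [y' [k' [lk' H]]]]].
have old x1 y1 k1 : S j.+1 (fnew x1 y1 k1) -> S j x1 /\ S j y1.
  move=> /stage_fnew[_ [i ij [[Sx Sy _ _] _]]].
  by split; apply: (stage_mono (i := i)).
case: H => -[Ew Eu].
- case: k' lk' Ew Eu => [|k'] lk' Ew Eu.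
    have E1 : u = fnew x' y' 1 by rewrite Eu pv_inner //; lia.
    by rewrite E1 in Su; have [Sx _] := old _ _ _ Su; rewrite Ew in nSw.
  by move: Ew; rewrite pv_inner // => -[-> -> ->]; left.
- have [lk|gk] := ltnP k'.+1 n.-1.
    by move: Eu; rewrite pv_inner // => -[-> -> ->]; right.
  have Ek : k'.+1 = n.-1 by apply/eqP; rewrite eqn_leq lk' gk.
  have Ey : fnew x y k = y' by rewrite Eu Ek pv_last.
  have E1 : u = fnew x' y' k' by rewrite Ew pv_inner // lk' andbT; lia.
  by rewrite E1 in Su; have [_ Sy] := old _ _ _ Su; rewrite Ey in nSw.
Qed.

Definition farc (x y : fvert G) : seq Amb := [seq pv x y l | l <- iota 1 n.-1].

Lemma size_arc x y : size (farc x y) = n.-1.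
Proof. by rewrite size_map size_iota. Qed.

Lemma nth_arc z x y l : l < n.-1 -> nth z (farc x y) l = pv x y l.+1.
Proof. by move=> ll; rewrite (nth_map 0) ?size_iota // nth_iota. Qed.

Lemma nth_arc0 z x y l : l <= n.-1 -> nth z ((x : Amb) :: farc x y) l = pv x y l.
Proof. by case: l => // l ll; rewrite /= nth_arc. Qed.

Lemma arcP z x y : z \in farc x y -> exists2 l, 0 < l <= n.-1 & z = pv x y l.
Proof.
by move=> /mapP[l]; rewrite mem_iota add1n ltnS => hl ->; exists l.
Qed.

Lemma arc_path x y : path (@adj Amb) x (farc x y).
Proof.
apply/(pathP (x : Amb)) => l; rewrite size_arc => ll.
by rewrite nth_arc0 1?ltnW // nth_arc // pv_adj.
Qed.

Lemma arc_last x y : last (x : Amb) (farc x y) = y.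
Proof. by rewrite (last_nth (x : Amb)) size_arc nth_arc0 // pv_last. Qed.

Lemma pv_stage j x y k : new_arc j x y -> k <= n.-1 -> S j.+1 (pv x y k).
Proof.
move=> na lk; have [[Sx Sy _ _] _] := na.
case: k lk => [|k] lk; first exact: (stage_mono (leqnSn j)).
have [->|nk] := eqVneq k.+1 n.-1; first by rewrite pv_last; apply: (stage_mono (leqnSn j)).
have hk : 0 < k.+1 < n.-1 by rewrite /= ltn_neqAle nk.
by rewrite pv_inner //; apply/stage_fnew; split=> //; exists j.
Qed.

(** Had the arc been added earlier, it would be a path of length [n - 1] in [S j] between vertices
    at distance [n + 1]. *)
Lemma new_arc_old j x y k : new_arc j x y -> ~ S j (fnew x y k).
Proof.
move=> [[Sx Sy _ dmin] _] /stage_fnew[_ [i ij na]].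
suff : n.+1 <= n.-1 by lia.
rewrite -(size_arc x y); apply: dmin.
- exact: arc_path.
- exact: arc_last.
- by move=> z /arcP[l /andP[_ ll] ->]; apply: (stage_mono ij); apply: pv_stage.
Qed.

Lemma new_arc_neq j x y : new_arc j x y -> x <> y.
Proof. by move=> [[_ _ _ dmin] _] E; have : n.+1 <= 0 by apply: (dmin [::]). Qed.

Lemma pv_inj j x y k l : new_arc j x y -> k <= n.-1 -> l <= n.-1 ->
  pv x y k = pv x y l -> k = l.
Proof.
move=> na; have [[Sx Sy _ _] _] := na.
have nxy := new_arc_neq na; have nS i := @new_arc_old j x y i na.
have cases i : i <= n.-1 -> [\/ i = 0, i = n.-1 | 0 < i < n.-1].
  move=> li; case: (posnP i) => [->|i0]; first by constructor 1.
  have [->|ni] := eqVneq i n.-1; first by constructor 2.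
  by constructor 3; lia.
move=> /cases ck /cases cl.
case: ck => [->|->|hk]; case: cl => [->|->|hl]; rewrite ?pv0 ?pv_last ?(pv_inner _ _ hk) ?(pv_inner _ _ hl) // => E.
- by rewrite E in Sx; case: (nS _ Sx).
- by rewrite E in nxy.
- by rewrite E in Sy; case: (nS _ Sy).
- by rewrite -E in Sx; case: (nS _ Sx).
- by rewrite -E in Sy; case: (nS _ Sy).
- by case: E.
Qed.

Lemma arc_upath j x y : new_arc j x y -> upath (x : Amb) (farc x y).
Proof.
move=> na; rewrite /upath arc_path andTb; apply/(uniqP (x : Amb)) => k l.
rewrite !inE /= size_arc !ltnS => lk ll; rewrite !nth_arc0 //; exact: pv_inj na lk ll.
Qed.

Lemma fpart_pv x y k : k < n.-1 -> fpart (pv x y k) = fpart x (+) odd k.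
Proof.
case: k => [|k] lk; first by rewrite pv0 addbF.
by rewrite pv_inner.
Qed.

(** The ends of an added path are at distance [n + 1], which has the parity of its length
    [n - 1]. *)
Lemma stage_bipartite j : bipartite (induced (S j)).
Proof.
split; first by move=> u v; apply: amb_sym.
suff H (u v : Amb) : S j u -> S j v -> adj u v -> part u != part v.
  by move=> u v uv; apply: H; rewrite //; apply: induced_val.
elim: j u v => [|j IH] u v.
  move=> [u0 _ <-] [v0 _ <-] /adjP/fedgeP[[u1 [v1 [uv [->] [->]]]]|]; first exact: bG.2.
  move=> [x [y [k [lk H]]]].
  have [k0|k1] : 0 < k < n.-1 \/ 0 < k.+1 < n.-1 by lia.
    by case: H => -[]; rewrite pv_inner.
  by case: H => -[] E; rewrite pv_inner.
have pS : bipartite (induced (S j)).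
  split; first by move=> ? ?; apply: amb_sym.
  by move=> ? ? ?; apply: IH; rewrite //; apply: induced_val.
have parity x y : new_arc j x y -> fpart y = fpart x (+) odd n.-1.
  move=> [[Sx Sy [p [xp Ey pX sp]] _] _]; have [t Et] := induced_lift pX.
  pose x' : induced (S j) := exist _ (x : Amb) (mem_set Sx).
  have := @path_part _ x' t pS; rewrite induced_path Et => /(_ xp).
  have -> : part (last x' t) = fpart (last (x : Amb) p).
    by rewrite -Et -[x in last x (map _ _)]/(val x') last_map.
  rewrite Ey => ->; rewrite -(size_map val) Et sp.
  by rewrite odd_succ_pred //; apply: ltn_trans n3.
have new w z : ~ S j w -> S j.+1 w -> S j.+1 z -> adj w z -> part w != part z.
  move=> nSw Sw; have [//|[x [y [k [na hk Ew]]]]] := (stageS j w).1 Sw.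
  rewrite {}Ew in nSw Sw * => Sz wz.
  have Epv i : i <= n.-1 -> fpart (pv x y i) = fpart x (+) odd i.
    rewrite leq_eqVlt => /predU1P[->|li]; last exact: fpart_pv.
    by rewrite pv_last (parity x y na).
  have [k0 lk] := andP hk.
  have [Ez|Ez] := fnew_nbr nSw Sw Sz wz; rewrite Ez /= Epv //=; lia.
move=> Su Sv uv; have [Su'|nSu] := pselect (S j u); last exact: new.
have [Sv'|nSv] := pselect (S j v); first exact: IH.
by rewrite eq_sym; apply: new => //; rewrite amb_sym.
Qed.

(** A new vertex has only its two arc neighbours in its stage, so a set in which it keeps two
    neighbours follows the arc both ways to its ends. This is applied to cycles and to paths with
    old ends. *)
Lemma closed_arc (Q : Amb -> Prop) j x y k : (forall z, Q z -> S j.+1 z) ->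
    (forall w, Q w -> ~ S j w ->
      exists u v, [/\ Q u, Q v, u != v, adj w u & adj w v]) ->
    new_arc j x y -> 0 < k < n.-1 -> Q (fnew x y k) ->
  forall i, i <= n.-1 -> Q (pv x y i).
Proof.
move=> QS Q2 na hk Qk.
have step i : 0 < i < n.-1 -> Q (pv x y i) -> Q (pv x y i.+1) /\ Q (pv x y i.-1).
  move=> hi; rewrite pv_inner // => Qi.
  have nS := @new_arc_old j x y i na.
  have [u [v [Qu Qv nuv wu wv]]] := Q2 _ Qi nS.
  have Eu := fnew_nbr nS (QS _ Qi) (QS _ Qu) wu.
  have Ev := fnew_nbr nS (QS _ Qi) (QS _ Qv) wv.
  by move: Qu Qv nuv; case: Eu => ->; case: Ev => ->; rewrite ?eqxx.
rewrite -(pv_inner _ _ hk) in Qk.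
have up d : k + d <= n.-1 -> Q (pv x y (k + d)).
  elim: d => [|d IH]; first by rewrite addn0.
  rewrite addnS => ld; have [] := step (k + d) _ (IH (ltnW ld)); last by [].
  by rewrite ld andbT; move: hk; lia.
have down d : d <= k -> Q (pv x y (k - d)).
  elim: d => [|d IH] ld; first by rewrite subn0.
  have [] := step (k - d) _ (IH (ltnW ld)); first by move: hk; lia.
  by rewrite subnS.
move=> i li; have [ki|ik] := leqP k i.
  by rewrite -(subnKC ki); apply: up; rewrite subnKC.
by rewrite -(subKn (ltnW ik)); apply: down; apply: leq_subr.
Qed.

(** The path contains a whole arc by [closed_arc]. The arc has [n] vertices and the path at most as
    many, so there are no others, and the old ends of the path are the ends of the arc. *)
Lemma short_path_arc j (u : Amb) r : upath u r -> S j u -> S j (last u r) ->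
    (forall z, z \in r -> S j.+1 z) -> size r <= n.-1 ->
    ~ (forall z, z \in r -> S j z) ->
  exists x y, [/\ new_arc j x y,
    (u = x /\ last u r = y) \/ (u = y /\ last u r = x) &
    forall i, i <= n.-1 -> (pv x y i : Amb) \in u :: r].
Proof.
move=> ur Su Sl rS sr /existsNP[w /not_implyP[wr nSw]].
have [//|[x [y [k [na hk Ew]]]]] := (stageS j w).1 (rS _ wr).
have QS z : z \in u :: r -> S j.+1 z.
  by rewrite inE => /predU1P[->|/rS//]; apply: (stage_mono (leqnSn j)).
have all_pv i : i <= n.-1 -> (pv x y i : Amb) \in u :: r.
  move: i; apply: (@closed_arc (fun z => z \in u :: r) j x y k) => //.
    move=> v; rewrite inE => /predU1P[-> /(_ Su)//|vr nSv].
    have nl : v != last u r by apply: contra_not_neq nSv => ->.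
    have [a [b [ha hb nab va vb]]] := path_nbrs (@amb_sym) ur vr nl.
    by exists a, b.
  by rewrite -Ew inE wr orbT.
exists x, y; split=> //.
have uarc : uniq ((x : Amb) :: farc x y) by case/andP: (arc_upath na).
have sub : {subset ((x : Amb) :: farc x y) <= u :: r}.
  move=> z; rewrite inE => /predU1P[->|/arcP[l /andP[_ ll] ->]]; last exact: all_pv.
  exact: (all_pv 0).
have szr : size (u :: r) <= size ((x : Amb) :: farc x y) by rewrite /= size_arc.
have [_ Emem] := uniq_min_size uarc sub szr.
have ends z : z \in u :: r -> S j z -> z = x \/ z = y.
  rewrite -Emem inE => /predU1P[->|/arcP[l hl ->]]; first by left.
  have [->|nl] := eqVneq l n.-1; first by rewrite pv_last; right.
  by rewrite pv_inner => [/(new_arc_old na)//|]; lia.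
have nul : u <> last u r.
  have lr : last u r \in r by case: (r) wr => // z s _; apply: (mem_last z s).
  by move=> E; case/andP: ur => _ /andP[]; rewrite {1}E lr.
have Eu := ends u (mem_head _ _) Su; have El := ends _ (mem_last u r) Sl.
case: Eu El nul => -> [->|->] //; by [left|right].
Qed.

Lemma oriented_sym (x y : fvert G) : oriented y x =
  (choose [pred z | (z == x) || (z == y)] x == y).
Proof.
rewrite /oriented; congr (_ == y).
have E : choose [pred z | (z == y) || (z == x)] =1
    choose [pred z | (z == x) || (z == y)].
  by apply: eq_choose => z /=; apply: orbC.
by rewrite E; apply: choose_id; rewrite /= eqxx ?orbT.
Qed.

Lemma oriented_anti (x y : fvert G) : oriented x y -> oriented y x -> x = y.
Proof. by rewrite oriented_sym /oriented => /eqP -> /eqP. Qed.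

Lemma oriented_total (x y : fvert G) : oriented x y \/ oriented y x.
Proof.
rewrite (oriented_sym x y) /oriented; apply/orP.
by apply: (@chooseP _ [pred z | (z == x) || (z == y)]); rewrite /= eqxx.
Qed.

(** Opened at position [1] of the arc and oriented so as to end in [x], the cycle is forced through
    the arc up to [y], since an inner vertex has just one neighbour besides the previous one. *)
Lemma cycle_rest j x y (c : seq Amb) : new_arc j x y -> is_cycle c ->
    (forall z, z \in c -> S j.+1 z) ->
    (forall i, i <= n.-1 -> (pv x y i : Amb) \in c) ->
  exists r, [/\ upath (y : Amb) r, last (y : Amb) r = x, size r + n.-1 = size c,
    {subset r <= c} & (pv x y 1 : Amb) \notin r].
Proof.
move=> na cc cS pvc.
have nS i := @new_arc_old j x y i na.
have pvN i l : i <= n.-1 -> l <= n.-1 -> i != l -> pv x y i <> pv x y l.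
  by move=> li ll /eqP nil E; apply: nil; apply: pv_inj na li ll E.
(* [r] is the part of the cycle still to be walked after position [i.+1]; the last clause says that
   it avoids the positions passed. *)
suff H i : i.+1 <= n.-1 -> exists r, [/\ upath (pv x y i.+1 : Amb) r,
    last (pv x y i.+1 : Amb) r = x, size r + i.+1 = size c, {subset r <= c} &
    forall l, 0 < l < i.+1 -> (pv x y l : Amb) \notin (pv x y i.+1 : Amb) :: r].
  have [|r [ur lr sr rc avoid]] := H n.-2; first by lia.
  have E : n.-2.+1 = n.-1 by lia.
  rewrite E pv_last in ur lr sr avoid.
  exists r; split=> //; have : 0 < 1 < n.-1 by lia.
  by move/avoid; rewrite inE negb_or => /andP[].
elim: i => [|i IH] li.
  have [sc uc ccyc] := cc; have [k s Es] := rot_to (pvc 1 li).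
  have mc z : z \in c = (z \in (pv x y 1 : Amb) :: s) by rewrite -Es mem_rot.
  move: uc ccyc; rewrite -(rot_uniq k c) -(rot_cycle k) Es => uc ccyc.
  have szc : size s + 1 = size c by rewrite -(size_rot k c) Es addn1.
  have sub : {subset s <= c} by move=> z zs; rewrite mc inE zs orbT.
  have Sc1 := cS _ (pvc 1 li); have h1 : 0 < 1 < n.-1 by lia.
  rewrite (pv_inner _ _ h1) in Sc1.
  case: s Es mc uc ccyc szc sub => [|z s] Es mc uc ccyc szc sub.
    by move: sc; rewrite -szc.
  have ccyc' : path (@adj Amb) (pv x y 1) (rcons (z :: s) (pv x y 1)) by [].
  move: (ccyc'); rewrite rcons_path => /andP[pz lz].
  have Sz := cS z (sub z (mem_head _ _)).
  have lc : last z s \in c by apply: sub; apply: mem_last.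
  have az : adj (fnew x y 1 : Amb) z by rewrite -(pv_inner _ _ h1); case/andP: pz.
  have al : adj (fnew x y 1 : Amb) (last z s) by rewrite -(pv_inner _ _ h1) amb_sym.
  have Hz := fnew_nbr (nS 1) Sc1 Sz az; have Hl := fnew_nbr (nS 1) Sc1 (cS _ lc) al.
  have nzl : z <> last z s.
    move=> E; move: uc => /= /and3P[_ + _]; case: (s) E szc => [|z' s'] E szc.
      by move: sc; rewrite -szc.
    by rewrite {1}E /= mem_last.
  have avoid r' l : 0 < l < 1 -> (pv x y l : Amb) \notin r' by lia.
  (* The two cycle neighbours of position [1] are positions [0] and [2]. If the cycle reaches [x]
     first, it is reversed. *)
  have [lx|nlx] := eqVneq (last z s) (x : Amb).
    exists (z :: s); split=> //; last by move=> l; apply: avoid.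
    by apply/andP; split.
  have Ez : z = x.
    case: Hl => El; last by rewrite El eqxx in nlx.
    by case: Hz => // Ez; case: nzl; rewrite El.
  exists (rev (z :: s)); split; last first.
  - by move=> l; apply: avoid.
  - by move=> v; rewrite mem_rev; apply: sub.
  - by rewrite size_rev.
  - by rewrite rev_cons last_rcons.
  apply/andP; split; last first.
    by move: uc; rewrite /= !mem_rev rev_uniq.
  have /andP[_ pz'] : path (@adj Amb) (pv x y 1) (z :: rcons s (pv x y 1)) := ccyc'.
  have := rev_path (@adj Amb) z (rcons s (pv x y 1)).
  rewrite last_rcons belast_rcons => ->.
  by rewrite (eq_path (e' := @adj Amb)) // => a b; rewrite amb_sym.
have [r [ur lr sr rc avoid]] := IH (ltnW li).
have hi : 0 < i.+1 < n.-1 by lia.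
case: r ur lr sr rc avoid => [|z r] ur lr sr rc avoid.
  by case: (@pvN i.+1 0); rewrite ?pv0 //; apply: ltnW.
have Si := cS _ (pvc _ (ltnW li)).
have zc := rc z (mem_head _ _).
have az : adj (pv x y i.+1 : Amb) z by case/andP: ur => /= /andP[].
rewrite (pv_inner _ _ hi) in Si az.
(* Going back is excluded by [avoid]; for the step back to [x] the reason is that [x] is the last
   vertex of [r] and cannot occur earlier. *)
have Ez : z = pv x y i.+2.
  have [//|/= Ez] := fnew_nbr (nS _) Si (cS _ zc) az.
  case: i {IH hi Si az} li ur lr sr avoid Ez => [|i] li ur lr sr avoid Ez.
    case: r ur lr sr avoid rc => [|z' r] ur lr sr avoid rc.
      by have [+ _ _] := cc; rewrite -sr.
    case/andP: ur => _ /= /and3P[_ + _]; rewrite {1}Ez pv0 -lr /=.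
    by rewrite mem_last.
  by have := avoid i.+1 (ltnSn i); rewrite Ez !inE eqxx orbT.
rewrite Ez in ur lr sr rc avoid.
exists r; split.
- by move: ur; rewrite -cat1s => /upath_catr.
- by [].
- by rewrite -sr /= addnS addSn.
- by move=> v vr; apply: rc; rewrite inE vr orbT.
- move=> l /andP[l0]; rewrite ltnS leq_eqVlt => /predU1P[->|ll].
    by case/andP: ur => _ /andP[].
  have := avoid l; rewrite l0 ll => /(_ isT); rewrite inE negb_or => /andP[_].
  by [].
Qed.

Lemma adj_fbase (u v : G) : adj (fbase u : Amb) (fbase v) = adj u v.
Proof.
apply/adjP/idP; last exact: fedge_base.
case/fedgeP => [[u1 [v1 [uv [->] [->]]]] //|[x [y [k [lk H]]]]].
have [k0|k1] : 0 < k < n.-1 \/ 0 < k.+1 < n.-1 by lia.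
  by case: H => -[]; rewrite pv_inner.
by case: H => -[] E; rewrite pv_inner.
Qed.

(* A short cycle would contain an added path, the rest of it being too short to
   be anything but the same added path. *)
Lemma stage_girth j (c : seq Amb) : girth_ge G (2 * n) -> is_cycle c ->
  (forall z, z \in c -> S j z) -> 2 * n <= size c.
Proof.
move=> gG; elim: j c => [|j IH] c cc cS.
  have [t Et _] := @lift_seq G Amb (fun=> True) (@fbase G) c (fun z zc =>
    let: ex_intro2 v _ Ev := cS z zc in ex_intro2 _ _ v I Ev).
  have fI : injective (@fbase G : G -> Amb) by move=> u v [].
  have fE := adj_fbase.
  rewrite -Et size_map; apply: gG.
  move: cc; rewrite -Et => -[sc uc ccyc]; split.
  - by rewrite size_map in sc.
  - by rewrite map_inj_uniq in uc.
  - case: (t) ccyc => // u s /=; rewrite -map_rcons path_map.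
    by rewrite (eq_path (e' := @adj G)).
have [cS'|/existsNP[w /not_implyP[wc nSw]]] := pselect (forall z, z \in c -> S j z).
  exact: IH.
have [//|[x [y [k [na hk Ew]]]]] := (stageS j w).1 (cS _ wc).
have pvc i : i <= n.-1 -> (pv x y i : Amb) \in c.
  move: i; apply: (@closed_arc (fun z => z \in c) j x y k) => //; last by rewrite -Ew.
  move=> v vc _; have [a [b [ha hb nab va vb]]] := cycle_nbrs (@amb_sym) cc vc.
  by exists a, b.
have [r [ur lr sr rc nr]] := cycle_rest na cc cS pvc.
rewrite leqNgt; apply/negP => lt.
have [[Sx Sy _ dmin] o] := na.
have rS z : z \in r -> S j.+1 z by move=> /rc/cS.
have wr : path (@adj Amb) y r by case/andP: ur.
have ler : size r <= n by lia.
(* [r] has the same ends as the arc of length [n - 1], so parity excludes length [n]. *)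
have Enr : size r != n.
  apply/eqP => Er; have pS := stage_bipartite j.+1.
  have arcS z : z \in farc x y -> S j.+1 z.
    by move=> /arcP[l /andP[_ ll] ->]; apply: pv_stage.
  have [t Et] := induced_lift rS; have [t' Et'] := induced_lift arcS.
  pose y' : induced (S j.+1) := exist _ (y : Amb) (mem_set (stage_mono (leqnSn j) Sy)).
  pose x' : induced (S j.+1) := exist _ (x : Amb) (mem_set (stage_mono (leqnSn j) Sx)).
  have E1 := @path_part _ y' t pS; have E2 := @path_part _ x' t' pS.
  rewrite induced_path Et in E1; rewrite induced_path Et' in E2.
  have {}E1 := E1 wr; have {}E2 := E2 (arc_path x y).
  have L1 : last y' t = x' by apply: val_inj; rewrite -last_map Et lr.
  have L2 : last x' t' = y' by apply: val_inj; rewrite -last_map Et' arc_last.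
  have szt : size t = n by rewrite -[RHS]Er -Et size_map.
  have szt' : size t' = n.-1 by rewrite -[RHS](size_arc x y) -Et' size_map.
  move: E1 E2; rewrite L1 L2 szt szt' => -> {L1 L2}.
  by case: (part y') => /=; lia.
have ltr : size r <= n.-1 by lia.
have [rSj|nrS] := pselect (forall z, z \in r -> S j z).
  suff : n.+1 <= size r by lia.
  rewrite -(size_rev r) -[size (rev r)]addn0.
  have wrev : path (@adj Amb) x (rev (belast (y : Amb) r)).
    by case/andP: (upath_rev (@amb_sym) ur); rewrite lr.
  have -> : size (rev r) + 0 = size (rev (belast (y : Amb) r)).
    by rewrite addn0 !size_rev size_belast.
  apply: dmin => //; first by rewrite -{1}lr last_rev_belast.
  move=> z; rewrite mem_rev => /mem_belast; rewrite inE => /predU1P[->//|]; exact: rSj.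
(* Here [r] is itself an arc between [x] and [y]. The opposite orientation is excluded by
   [oriented], the same one because [pv x y 1] is missing from [r]. *)
have [|x' [y' [na' Hends pvr]]] := short_path_arc ur Sy _ rS ltr nrS.
  by rewrite lr.
have [_ o'] := na'.
rewrite lr in Hends; case: Hends => -[Ey Ex].
  by rewrite Ex Ey in na; have [_ o2] := na; case: (new_arc_neq na); apply: oriented_anti.
have h1 : 1 <= n.-1 by lia.
rewrite Ex Ey in nr; have := pvr 1 h1; rewrite inE (negbTE nr) orbF => /eqP Ey'.
have := @pv_inj j x' y' 1 n.-1 na' h1 (leqnn _).
by rewrite pv_last Ey' Ey => /(_ erefl); lia.
Qed.

End Free.

Lemma discrete_switch (P : pred nat) i j : i <= j -> P i -> ~~ P j ->
  exists k, [/\ i <= k, k < j, P k & ~~ P k.+1].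
Proof.
move=> /subnKC <-; elim: (j - i) => [|d IH]; first by rewrite addn0 => ->.
rewrite addnS => Pi nP; have [Pd|nPd] := boolP (P (i + d)).
  by exists (i + d); rewrite leq_addr ltnSn.
by have [k [ik kd Pk nPk]] := IH Pi nPd; exists k; split=> //; apply: ltnW.
Qed.

(** [E] lists every edge that disappears together with [D]; the last hypothesis says that the
    vertices of [D] pay for them. *)
Lemma chi_remove (G : graph) n (H D : {fset G}) (E : seq {fset G}) :
    1 < n -> (D `<=` H)%fset ->
    (forall u v, u \in D -> v \in H -> adj u v -> [fset u; v]%fset \in E) ->
    symmetric (@adj G) ->
    (n - 2) * size E <= (n - 1) * #|` D| ->
  (chi n (H `\` D)%fset <= chi n H)%R.
Proof.
move=> n1 DH DE adjS le; rewrite -subr_ge0.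
pose X : set G := [set x | x \notin D].
have EX : (H `\` D)%fset = [fset x in H | x \in X]%fset.
  apply/fsetP => x; rewrite fset_in_eq in_fsetD andbC; congr andb.
  by apply/idP/idP => [nD|/set_mem//]; apply: mem_set.
rewrite EX; apply/chi_diff => //; apply: leq_trans (leq_trans _ le) _; last first.
  rewrite leq_mul2l; apply/orP; right; apply/fsubset_leq_card/fsubsetP => x xD.
  by apply/nvP; split; [move/fsubsetP: DH; apply|rewrite /X /= xD].
rewrite leq_mul2l; apply/orP; right.
rewrite (leq_trans _ (size_undup E)) // -card_fseq.
apply/fsubset_leq_card/fsubsetP => e /neP[u [v [uH vH uv -> nX]]].
rewrite in_fset_seq; have [uD|nuD] := boolP (u \in D); first exact: DE.
have [vD|nvD] := boolP (v \in D); last by case: nX.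
by rewrite fsetUC; apply: DE; rewrite // adjS.
Qed.

(** * Strength of the stages *)

Section StageStrong.
Variables (n : nat) (G : graph).
Hypotheses (n3 : 2 < n) (bG : bipartite G).
Local Notation Amb := (ambient n G).
Local Notation S := (@stage n G).
Local Notation pv := (@path_vertex n G).

(** Induction on the number of new vertices in [H]. Removing the interior of a complete arc leaves
    [chi] unchanged, and removing a vertex of degree at most one lowers it, so all new vertices can
    be removed without raising [chi]. *)
Lemma stage_strong j : strong n (S j : set Amb) (S j.+1).
Proof.
split; first exact: stage_mono.
move=> H HS; rewrite subr_ge0.
have [m] := ubnP #|` nv H (S j)|; elim: m H HS => // m IH H HS lem.
have [E|/fset0Pn[w /nvP[wH nSw]]] := eqVneq (nv H (S j)) fset0.
  suff -> : [fset x in H | x \in S j]%fset = H by [].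
  apply/fsetP => x; rewrite fset_in_eq; case xH: (x \in H) => //=.
  apply: mem_set; apply: contrapT => nSx.
  by have /nvP : x \in H /\ ~ S j x by []; rewrite E.
have [//|[x [y [k [na hk Ew]]]]] := (stageS j w).1 (HS _ wH).
have nS i := @new_arc_old _ _ n3 j x y i na.
have nbr i u : 0 < i < n.-1 -> (pv x y i : Amb) \in H -> u \in H ->
    adj (pv x y i : Amb) u -> u = pv x y i.+1 \/ u = pv x y i.-1.
  move=> hi; rewrite pv_inner // => iH uH iu.
  by apply: (fnew_nbr n3 bG (nS i)) => //; apply: HS.
(* [D] is an entire added path, or a new vertex of degree at most one in [H]. *)
suff [D [E [D0 DH DS DE le]]] : exists (D : {fset Amb}) E, [/\ D != fset0, (D `<=` H)%fset,
    (forall u, u \in D -> ~ S j u),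
    (forall u v, u \in D -> v \in H -> adj u v -> [fset u; v]%fset \in E) &
    (n - 2) * size E <= (n - 1) * #|` D|].
  have := chi_remove (ltnW n3) DH DE (@amb_sym n G) le; apply: le_trans.
  have -> : [fset x in H | x \in S j]%fset = [fset x in (H `\` D)%fset | x \in S j]%fset.
    apply/fsetP => u; rewrite !fset_in_eq in_fsetD.
    case: (boolP (u \in D)) => //= uD; rewrite andbC; apply/andP => -[/set_mem Su _].
    exact: DS uD Su.
  apply: IH; first by move=> u /=; rewrite in_fsetD => /andP[_ /HS].
  rewrite ltnS in lem; apply: leq_trans lem; apply: fproper_ltn_card; rewrite fproperE; apply/andP; split.
    by apply/fsubsetP => u /nvP[]; rewrite in_fsetD => /andP[_ uH] nSu; apply/nvP.
  have /fset0Pn[u uD] := D0; apply/fsubsetPn; exists u; last by apply/negP => /nvP[]; rewrite in_fsetD uD.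
  by apply/nvP; split; [move/fsubsetP: DH; apply|apply: DS].
have [full|/existsNP[i /not_implyP[hi niH]]] :=
    pselect (forall i, 0 < i < n.-1 -> (pv x y i : Amb) \in H).
  pose s : seq Amb := [seq pv x y i | i <- iota 1 n.-2].
  have sP z : z \in s -> exists2 i, 0 < i < n.-1 & z = pv x y i.
    by move=> /mapP[i]; rewrite mem_iota => hi ->; exists i => //; lia.
  exists [fset z in s]%fset, [seq [fset (pv x y i : Amb); pv x y i.+1]%fset | i <- iota 0 n.-1].
  split.
  - apply/fset0Pn; exists (fnew x y k); rewrite in_fset_seq -(pv_inner _ _ hk).
    by apply/mapP; exists k => //; rewrite mem_iota; lia.
  - by apply/fsubsetP => z; rewrite in_fset_seq => /sP[i hi ->]; apply: full.
  - by move=> z; rewrite in_fset_seq => /sP[i hi ->]; rewrite pv_inner.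
  - move=> u v; rewrite in_fset_seq => /sP[i hi ->] vH iv.
    have [->|->] := nbr i v hi (full i hi) vH iv.
      by apply/mapP; exists i; rewrite ?mem_iota //; lia.
    apply/mapP; exists i.-1; first by rewrite mem_iota; lia.
    by rewrite fsetUC prednK //; lia.
  - rewrite size_map size_iota card_fseq undup_id ?size_map ?size_iota.
      by have := n3; nia.
    rewrite map_inj_in_uniq ?iota_uniq // => a b; rewrite !mem_iota => ha hb.
    by apply: (pv_inj n3 na); lia.
(* Along an incomplete arc some position in [H] is next to one outside [H], which leaves it at most
   one neighbour [e]. *)
have [l [hl lH nH]] : exists l, [/\ 0 < l < n.-1, (pv x y l : Amb) \in H &
    exists e, forall v, v \in H -> adj (pv x y l : Amb) v -> v = e].
  have kH : (pv x y k : Amb) \in H by rewrite pv_inner // -Ew.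
  have [ki|ik] := leqP k i.
    have [l [kl li Pl nPl]] := @discrete_switch (fun l => (pv x y l : Amb) \in H) k i ki kH (introN idP niH).
    have hl : 0 < l < n.-1 by lia.
    exists l; split=> //; exists (pv x y l.-1) => v vH lv.
    by have [Ev|//] := nbr l v hl Pl vH lv; rewrite Ev (negbTE nPl) in vH.
  have [l [kl li nPl]] := @discrete_switch (fun l => (pv x y l : Amb) \notin H) i k (ltnW ik) (introN idP niH) (introT negPn kH).
  rewrite negbK => Pl; have hl : 0 < l.+1 < n.-1 by lia.
  exists l.+1; split=> //; exists (pv x y l.+2) => v vH lv.
  by have [//|/= Ev] := nbr l.+1 v hl Pl vH lv; rewrite Ev (negbTE nPl) in vH.
have [e He] := nH.
exists [fset (pv x y l : Amb)]%fset, [:: [fset (pv x y l : Amb); e]%fset]; split.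
- by apply/fset0Pn; exists (pv x y l); rewrite in_fset1.
- by rewrite fsub1set.
- by move=> u; rewrite in_fset1 => /eqP ->; rewrite pv_inner.
- by move=> u v; rewrite in_fset1 => /eqP -> vH /(He v vH) ->; rewrite mem_head.
- by rewrite cardfs1 /=; lia.
Qed.

End StageStrong.

Section Linked.
Variables (G : graph) (X : set G).
Hypothesis adjS : symmetric (@adj G).

Definition linked (x y : G) :=
  exists p, [/\ path (@adj G) x p, last x p = y & forall z, z \in p -> X z].

Lemma linked_trans x y z : linked x y -> linked y z -> linked x z.
Proof.
move=> [p [xp <- pX]] [q [yq <- qX]]; exists (p ++ q); split.
- by rewrite cat_path xp.
- by rewrite last_cat.
- by move=> u; rewrite mem_cat => /orP[/pX|/qX].
Qed.

Lemma linked_sym x y : X x -> linked x y -> linked y x.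
Proof.
move=> Xx [p [xp <- pX]]; exists (rev (belast x p)); split.
- by rewrite rev_path (eq_path (e' := @adj G)) // => u v; rewrite adjS.
- exact: last_rev_belast.
- by move=> z; rewrite mem_rev => /mem_belast; rewrite inE => /predU1P[->//|/pX].
Qed.

End Linked.

Lemma rdist_sym (G : graph) (X : set G) x y m : symmetric (@adj G) ->
  rdist X x y m -> rdist X y x m.
Proof.
move=> adjS [Xx Xy [p [xp Ey pX sp]] dmin].
have rv u v q : X u -> path (@adj G) u q -> last u q = v -> (forall z, z \in q -> X z) ->
    [/\ path (@adj G) v (rev (belast u q)), last v (rev (belast u q)) = u,
      forall z, z \in rev (belast u q) -> X z & size (rev (belast u q)) = size q].
  move=> Xu uq <- qX; split.
  - by rewrite rev_path (eq_path (e' := @adj G)) // => a b; rewrite adjS.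
  - exact: last_rev_belast.
  - by move=> z; rewrite mem_rev => /mem_belast; rewrite inE => /predU1P[->//|/qX].
  - by rewrite size_rev size_belast.
split=> //; first by exists (rev (belast x p)); rewrite -sp; apply: rv.
by move=> q yq Ex qX; have [? ? ? <-] := rv _ _ q Xy yq Ex qX; apply: dmin.
Qed.

(** * The union of the stages *)

Section FreeGraph.
Variables (n : nat) (G : graph).
Hypotheses (n3 : 2 < n) (bG : bipartite G) (cG : connected_graph G).
Hypotheses (gG : girth_ge G (2 * n)).
Local Notation Amb := (ambient n G).
Local Notation S := (@stage n G).
Local Notation pv := (@path_vertex n G).
Local Notation Fm := (free_completion n G).

Definition St j : set Fm := [set v | S j (val v)].

Lemma St_mono i j : i <= j -> St i `<=` St j.
Proof. by move=> ij v; apply: stage_mono. Qed.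

Lemma St_ex (v : Fm) : exists j, St j v.
Proof. by have [j _ Sv] := induced_val v; exists j. Qed.

Lemma St_seq (s : seq Fm) : exists j, forall z, z \in s -> St j z.
Proof.
elim: s => [|v s [j IH]]; first by exists 0.
have [i Sv] := St_ex v; exists (maxn i j) => z; rewrite inE => /predU1P[->|/IH].
  by apply: (St_mono (leq_maxl i j)).
by apply: (St_mono (leq_maxr i j)).
Qed.

Lemma St_image j : val @` St j = S j.
Proof.
apply/seteqP; split=> [_ [v Sv <-] //|v Sv].
have Uv : (\bigcup_i S i) v by exists j.
by exists (exist _ (v : Amb) (mem_set Uv)).
Qed.

Lemma free_lift j (s : seq Amb) : (forall z, z \in s -> S j z) ->
  exists2 t : seq Fm, map val t = s & forall z, z \in t -> St j z.
Proof.
move=> sS; apply: lift_seq => y /sS; rewrite -St_image => -[x Sx <-]; by exists x.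
Qed.

Lemma free_bipartite : bipartite Fm.
Proof.
split=> [u v|u v uv]; first exact: amb_sym.
have [j Sj] := St_seq [:: u; v].
have Su : S j (val u) by apply: Sj; rewrite inE eqxx.
have Sv : S j (val v) by apply: Sj; rewrite !inE eqxx orbT.
have [_ /(_ (exist _ (val u) (mem_set Su)) (exist _ (val v) (mem_set Sv)))] :=
  stage_bipartite n3 bG j.
exact.
Qed.

Lemma free_girth : girth_ge Fm (2 * n).
Proof.
move=> c [sc uc cc]; have [j Sj] := St_seq c.
rewrite -(size_map val); apply: (@stage_girth n G n3 bG j _ gG).
  split; first by rewrite size_map.
    by rewrite map_inj_uniq //; apply: val_inj.
  by case: (c) cc => // u s /=; rewrite -map_rcons path_map.
by move=> _ /mapP[z /Sj Sz ->].
Qed.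

Lemma stage_linked j (u v : Amb) : S j u -> S j v -> linked (S j) u v.
Proof.
have sub i x y : linked (S i) x y -> linked (S i.+1) x y.
  by move=> [p [xp Ey pS]]; exists p; split=> // z /pS; apply: (stage_mono (leqnSn i)).
elim: j u v => [|j IH] u v.
  move=> [u0 _ <-] [v0 _ <-]; have [p [up Ev]] := cG u0 v0.
  exists (map (@fbase G) p); split.
  - by rewrite path_map (eq_path (e' := @adj G)) // => a b; apply: adj_fbase.
  - by rewrite last_map Ev.
  - by move=> z /mapP[a _ ->]; exists a.
suff old w : S j.+1 w -> exists2 w', S j w' & linked (S j.+1) w' w.
  move=> Su Sv; have [u' Su' uu'] := old u Su; have [v' Sv' vv'] := old v Sv.
  apply: linked_trans vv'; apply: (linked_trans (y := u')); last exact/sub/IH.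
  by apply: (linked_sym (@amb_sym n G) _ uu'); apply: (stage_mono (leqnSn j)).
move=> Sw; have [Sw'|[x [y [k [na hk Ew]]]]] := (stageS j w).1 Sw.
  by exists w => //; exists [::].
have [[Sx _ _ _] _] := na; exists x => //.
exists (take k (farc n x y)); split.
- by apply: take_path; apply: arc_path.
- rewrite (last_nth (x : Amb)) size_takel ?size_arc; last by lia.
  case: k hk Ew => [//|k] hk Ew; rewrite [nth _ _ _]/= nth_take //.
  by rewrite nth_arc ?pv_inner //; lia.
- by move=> z /mem_take/arcP[l hl ->]; apply: (pv_stage n3 na); lia.
Qed.

(** A geodesic longer than [n] starts with one of length [n + 1]. A stage containing the latter sees
    its ends at distance exactly [n + 1], so the next stage joins them by a path of length
    [n - 1]. *)
Lemma free_diam : diam_le Fm n.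
Proof.
move=> x y.
have [j0 S0] := St_seq [:: x; y].
have wlift j (u v : Fm) p : St j u -> path (@adj Amb) (val u) p -> last (val u) p = val v ->
    (forall z, z \in p -> S j z) -> exists q, [/\ walk u v q, map val q = p & size q = size p].
  move=> Su up Ev pS; have [q Eq _] := free_lift pS; exists q.
  rewrite -Eq in up Ev *; rewrite size_map; split=> //.
  split; first by rewrite path_map in up.
  by apply: val_inj; rewrite -Ev last_map.
pose P m := `[< exists p, walk x y p /\ size p = m >].
have exP : exists m, P m.
  have Sx : S j0 (val x) by apply: S0; rewrite inE eqxx.
  have Sy : S j0 (val y) by apply: S0; rewrite !inE eqxx orbT.
  have [p [xp Ey pS]] := stage_linked Sx Sy.
  have [q [wq _ sq]] := wlift j0 x y p Sx xp Ey pS.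
  by exists (size q); apply/asboolP; exists q.
have [m /asboolP[p [wp sp]] minm] := ex_minnP exP.
have minp q : walk x y q -> m <= size q.
  by move=> wq; apply: minm; apply/asboolP; exists q.
exists m; first by exists p => //; split=> // q /minp; rewrite sp.
rewrite leqNgt; apply/negP => ltm.
pose p1 := take n.+1 p; pose p2 := drop n.+1 p; pose z := last x p1.
have Ep : p = p1 ++ p2 by rewrite cat_take_drop.
have sp1 : size p1 = n.+1 by rewrite size_takel // sp.
have [xp1 zp2] : path (@adj Fm) x p1 /\ path (@adj Fm) z p2.
  by case: wp => + _; rewrite Ep cat_path => /andP[].
have l2 : last z p2 = y by case: wp => _ <-; rewrite Ep last_cat.
have sp2 : size p2 + n.+1 = m by rewrite -sp Ep size_cat sp1 addnC.
have shorter q : walk x z q -> n < size q.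
  move=> [xq Ez]; have : m <= size (q ++ p2).
    by apply: minp; split; rewrite ?cat_path ?last_cat ?xq ?Ez.
  by rewrite size_cat -sp2 addnC leq_add2r.
have [j Sj] := St_seq (x :: p1).
have Sx : St j x by apply: Sj; rewrite mem_head.
have Sz : St j z by apply: Sj; apply: mem_last.
have rd : rdist (S j) (val x : Amb) (val z) n.+1.
  split=> //.
    exists (map val p1); split; rewrite ?size_map ?last_map //; first by rewrite path_map.
    by move=> _ /mapP[u up1 ->]; apply: Sj; rewrite inE up1 orbT.
  move=> q xq Ez qS; have [q' [wq' _ <-]] := wlift j x z q Sx xq Ez qS.
  exact: shorter.
have arcS u v w : new_arc n j u v -> w \in farc n u v -> S j.+1 w.
  by move=> na /arcP[l hl ->]; apply: (pv_stage n3 na); lia.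
have short q : path (@adj Amb) (val x) q -> last (val x : Amb) q = val z ->
    (forall w, w \in q -> S j.+1 w) -> size q = n.-1 -> False.
  move=> xq Ez qS sq; have [q' [wq' _ sq']] := wlift j.+1 x z q (St_mono (leqnSn j) Sx) xq Ez qS.
  by have := shorter q' wq'; rewrite sq' sq; lia.
(* The arc is added in one orientation only; in the other case it is traversed backwards. *)
have [oxz|ozx] := oriented_total (val x : fvert G) (val z).
  have na : new_arc n j (val x) (val z) by [].
  apply: (short (farc n (val x) (val z))); rewrite ?size_arc ?arc_path ?arc_last //.
  by move=> w; apply: arcS na.
have na : new_arc n j (val z) (val x) by split=> //; apply: rdist_sym (@amb_sym n G) rd.
have ua := arc_upath n3 na; have := upath_rev (@amb_sym n G) ua.
rewrite arc_last // => /andP[pr _].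
apply: (short _ pr); last by rewrite size_rev size_belast size_arc.
  by rewrite -{1}(arc_last n3 (val z) (val x)) last_rev_belast.
move=> w; rewrite mem_rev => /mem_belast; rewrite inE => /predU1P[->|]; last exact: arcS na.
exact: (stage_mono (leqnSn j)).
Qed.

Lemma free_pregon : pregon n Fm.
Proof. split; [exact: free_bipartite|exact: free_diam|exact: free_girth]. Qed.

Lemma St_strong j : strong n (St j) setT.
Proof.
have UE : (\bigcup_i S i : set Amb) = val @` [set: Fm].
  apply/seteqP; split=> [v Uv|_ [v _ <-]]; last exact: induced_val.
  by exists (exist _ v (mem_set Uv)).
have fE (u v : Fm) : adj (val u : Amb) (val v) = adj u v by [].
apply/(@strong_embed Fm Amb val (@val_inj _ _ _) fE n); rewrite St_image -UE.
have le d : strong n (S j : set Amb) (S (j + d)).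
  elim: d => [|d IH]; first by rewrite addn0; apply: strong_refl.
  by rewrite addnS; apply: strong_trans IH _; apply: stage_strong.
split=> [v Sv|H HU]; first by exists j.
have [i Hi] : exists i, forall v, v \in (H : seq Amb) -> S i v.
  elim: (H : seq Amb) (fun v (vH : v \in (H : seq Amb)) => HU v vH) => [|v s IH] sU.
    by exists 0.
  have [i Hi] := IH (fun z zs => sU z (mem_behead (s := v :: s) zs)).
  have [k _ Sk] := sU v (mem_head _ _); exists (maxn i k) => z.
  rewrite inE => /predU1P[->|/Hi]; first exact: (stage_mono (leq_maxr i k) Sk).
  exact: (stage_mono (leq_maxl i k)).
apply: (le i).2 => v /Hi; exact: (stage_mono (leq_addl j i)).
Qed.

(** Each added path has length [n - 1], short enough for convexity to force it once its ends are
    present. With a finite base the completion is thus finitely generated, as membership in the age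
    demands. *)
Lemma free_hull : hull n (St 0) = setT.
Proof.
apply/seteqP; split=> // v _; have [j] := St_ex v; elim: j v => [|j IH] v.
  exact: sub_hull.
move=> /stageS[/IH//|[x [y [k [na hk Ev]]]]].
have [[Sx Sy _ _] _] := na; have ua := arc_upath n3 na.
have arcS z : z \in farc n x y -> S j.+1 z.
  by move=> /arcP[l hl ->]; apply: (pv_stage n3 na); lia.
have [t Et _] := free_lift arcS.
have [x' Sx' Ex'] : (val @` St j) (x : Amb) by rewrite St_image.
have [y' Sy' Ey'] : (val @` St j) (y : Amb) by rewrite St_image.
have {}ua : upath x' t by rewrite induced_upath Ex' Et.
have El : last x' t = y'.
  by apply: val_inj; rewrite -last_map Et Ex' arc_last.
have vt : v \in t.
  rewrite -(mem_map val_inj) Et Ev; apply/mapP; exists k; last by rewrite pv_inner.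
  by rewrite mem_iota; lia.
have st : size t < n by rewrite -(size_map val) Et size_arc; lia.
apply: (@hull_convex Fm n (St 0) x' t ua st _ _ _ v vt) => //; first exact: IH.
by rewrite El; apply: IH.
Qed.

Lemma St_linked j (u v : Fm) : St j u -> St j v -> linked (St j) u v.
Proof.
move=> Su Sv; have [p [up Ev pS]] := stage_linked Su Sv.
have [t Et tS] := free_lift pS; rewrite -Et in up Ev.
exists t; split=> //; first by rewrite path_map in up.
by apply: val_inj; rewrite -Ev last_map.
Qed.

Lemma base_rel : exists e : G -> Fm, [/\ injective e, forall x y, adj (e x) (e y) = adj x y,
  forall x, part (e x) = part x & range e = St 0].
Proof.
have b0 x : (\bigcup_i S i : set Amb) (fbase x) by exists 0 => //; exists x.
exists (fun x => exist _ (fbase x : Amb) (mem_set (b0 x))); split=> //.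
- by move=> x y [].
- by move=> x y; apply: (adj_fbase n3 bG).
- apply/seteqP; split=> [_ [x _ <-]|v [x _ Ev]]; first by exists x.
  by exists x => //; apply: val_inj.
Qed.

Lemma St_finite j : finite_set [set: G] -> finite_set (St j).
Proof.
move=> fG; suff fS : finite_set (S j : set Amb).
  have [t Et] : exists t : seq Amb, forall z, S j z <-> z \in t.
    have /finite_seqP[t Et] := fS; exists t => z; by rewrite Et.
  have [t' Et' _] := @free_lift j t (fun z zt => (Et z).2 zt).
  apply/finite_seqP; exists t'; apply/seteqP; split=> v /=.
    by move=> /Et; rewrite -Et' mem_map //; apply: val_inj.
  by move=> vt; apply/Et; rewrite -Et' map_f.
elim: j => [|j IH]; first exact: finite_image.
have /finite_seqP[s Es] := IH.
apply: (@sub_finite_set _ _ [set` s ++ [seq fnew xy.1 xy.2 k |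
  xy <- [seq (x, y) | x <- s, y <- s], k <- iota 0 n]]); last exact: finite_seq.
have memS z : S j z -> z \in s by rewrite Es.
move=> v /stageS[/memS vs|[x [y [k [[[Sx Sy _ _] _] hk ->]]]]].
  by rewrite /= mem_cat vs.
rewrite /= mem_cat; apply/orP; right; apply/allpairsP; exists ((x, y), k); split=> //=.
  by apply/allpairsP; exists (x, y); split=> //; apply: memS.
by rewrite mem_iota; lia.
Qed.

End FreeGraph.

(** * Free amalgams *)

Section AmalgamPaths.
Variables (G : graph) (L R K : set G).
Hypothesis adjS : symmetric (@adj G).
Hypothesis amal : free_amalgam L R K.

Lemma side_path x p : path (@adj G) x p -> (forall z, z \in p -> (L `|` R) z) ->
  (forall z, z \in x :: p -> ~ K z) -> L x -> forall z, z \in p -> L z.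
Proof.
have [LR e] := amal.
elim: p x => // y p IH x /= /andP[xy yp] pY nK Lx.
have Ly : L y.
  have [[]//|[Rx _]] := e x y (or_introl Lx) (pY y (mem_head _ _)) xy.
  by case: (nK x (mem_head _ _)); rewrite -LR.
move=> z; rewrite inE => /predU1P[->//|zp].
apply: (IH y) => // [u up|u up]; first by apply: pY; rewrite inE up orbT.
by apply: nK; rewrite inE up orbT.
Qed.

Lemma cross_path x p : path (@adj G) x p -> (forall z, z \in p -> (L `|` R) z) ->
  (L `|` R) x -> ~ R x -> ~ L (last x p) -> exists2 z, z \in p & K z.
Proof.
move=> xp pY Xx nRx nLl; apply: contrapT => H; apply: nLl.
have [LR _] := amal.
have [p0|] := eqVneq p [::]; first by case: Xx; rewrite p0.
case: p xp pY H => // y p xp pY H _.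
apply: (side_path xp pY) => [z||]; last exact: (mem_last y p).
  rewrite inE => /predU1P[->|zp Kz]; first by rewrite -LR => -[].
  by apply: H; exists z.
by case: Xx.
Qed.

End AmalgamPaths.

Lemma cycle_upath (G : graph) (z k : G) s1 s2 : uniq (z :: s1 ++ k :: s2) ->
  cycle (@adj G) (z :: s1 ++ k :: s2) -> upath z (rcons s1 k).
Proof.
rewrite -cat_rcons -cat_cons cat_uniq => /and3P[u _ _] /=.
by rewrite rcons_cat cat_path => /andP[zp _]; apply/andP.
Qed.

(** A cycle contained in neither side crosses [K] twice. If it is shorter than [2 * n], one of the
    two pieces between the crossings has length below [n] and lies in [K] by convexity, although
    each piece contains a vertex outside [K]. *)
Lemma amalgam_girth (G : graph) (L R K : set G) n :
    symmetric (@adj G) -> free_amalgam L R K -> L `|` R = setT -> convex n K ->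
    (forall c, is_cycle c -> (forall z, z \in c -> L z) -> 2 * n <= size c) ->
    (forall c, is_cycle c -> (forall z, z \in c -> R z) -> 2 * n <= size c) ->
  girth_ge G (2 * n).
Proof.
move=> adjS amal LRT cK gL gR c cc.
have T z : (L `|` R) z by rewrite LRT.
have [cL|/existsNP[v /not_implyP[vc nLv]]] := pselect (forall z, z \in c -> L z).
  exact: gL.
have [cR|/existsNP[u /not_implyP[uc nRu]]] := pselect (forall z, z \in c -> R z).
  exact: gR.
rewrite leqNgt; apply/negP => lt.
have [sc uqc ccyc] := cc; have [i s Es] := rot_to uc.
move: uqc ccyc; rewrite -(rot_uniq i c) -(rot_cycle i) Es => uqc ccyc.
have szc : size c = (size s).+1 by rewrite -(size_rot i c) Es.
have vs : v \in s.
  have : v \in u :: s by rewrite -Es mem_rot.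
  rewrite inE => /predU1P[Ev|//].
  by case: (T u) => //; rewrite -Ev.
have [p1 [p2 Ep]] := split_seq vs.
have cyc' : path (@adj G) u (rcons s u) by [].
have [pu pv] : path (@adj G) u (rcons p1 v) /\ path (@adj G) v (rcons p2 u).
  move: cyc'; rewrite Ep rcons_cat cat_path /= => /and3P[h1 h2 h3].
  by rewrite rcons_path h1 h2.
have amal' := free_amalgamC amal.
have [k1 k1p Kk1] : exists2 z, z \in rcons p1 v & K z.
  by apply: (cross_path amal pu) => //; rewrite last_rcons.
have [k2 k2p Kk2] : exists2 z, z \in rcons p2 u & K z.
  have T' z : (R `|` L) z by rewrite setUC.
  by apply: (cross_path amal' pv) => //; rewrite last_rcons.
have [LR _] := amal.
have nKv : ~ K v by rewrite -LR => -[].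
have nKu : ~ K u by rewrite -LR => -[].
move: k1p; rewrite mem_rcons inE => /predU1P[Ek|k1p]; first by rewrite Ek in Kk1.
move: k2p; rewrite mem_rcons inE => /predU1P[Ek|k2p]; first by rewrite Ek in Kk2.
have [p1a [p1b E1]] := split_seq k1p; have [p2a [p2b E2]] := split_seq k2p.
(* The interiors of the two pieces between [k1] and [k2]; [B] contains [v] and [D] contains [u]. *)
pose B := p1b ++ v :: p2a; pose D := p2b ++ u :: p1a.
have Ec : u :: s = (u :: p1a) ++ k1 :: B ++ k2 :: p2b.
  by rewrite Ep E1 E2 /B -!catA.
have szBD : (size B).+1 + (size D).+1 = size c.
  rewrite szc -[(size s).+1]/(size (u :: s)) Ec !size_cat /= !size_cat /=.
  by move: (size p1a) (size B) (size p2b) => *; lia.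
rewrite Ec in uqc ccyc.
have F1 : k1 :: B ++ k2 :: p2b ++ u :: p1a = (k1 :: B ++ k2 :: p2b) ++ u :: p1a.
  by rewrite cat_cons -catA.
have F2 : k2 :: D ++ k1 :: B = (k2 :: p2b) ++ (u :: p1a) ++ k1 :: B.
  by rewrite /D cat_cons -catA.
have F3 : (u :: p1a) ++ k1 :: B ++ k2 :: p2b = ((u :: p1a) ++ k1 :: B) ++ k2 :: p2b.
  by rewrite -catA.
have cycC (l1 l2 : seq G) : cycle (@adj G) (l1 ++ l2) = cycle (@adj G) (l2 ++ l1).
  by rewrite -(rot_cycle (size l1)) rot_size_cat.
have u1 : upath k1 (rcons B k2).
  apply: (@cycle_upath _ _ _ _ (p2b ++ u :: p1a)); rewrite F1.
    by rewrite uniq_catC.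
  by rewrite (cycC (k1 :: B ++ k2 :: p2b) (u :: p1a)).
have u2 : upath k2 (rcons D k1).
  apply: (@cycle_upath _ _ _ _ B); rewrite F2.
    by rewrite uniq_catC -F3.
  by rewrite (cycC (k2 :: p2b) ((u :: p1a) ++ k1 :: B)) -F3.
have [ltB|ltD] : size (rcons B k2) < n \/ size (rcons D k1) < n.
  by move: szBD lt; rewrite !size_rcons; move: (size B) (size D) => *; lia.
  apply: nKv; apply: (cK k1 (rcons B k2)) => //; first by rewrite last_rcons.
  by rewrite mem_rcons /B !inE mem_cat mem_head !orbT.
apply: nKu; apply: (cK k2 (rcons D k1)) => //; first by rewrite last_rcons.
by rewrite mem_rcons /D !inE mem_cat mem_head !orbT.
Qed.

(** An excursion from [X1] inside the amalgam runs through [X2] and, by freeness, starts and ends in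
    [X0]. *)
Lemma amalgam_rconvex (G : graph) n (X1 X2 X0 : set G) : symmetric (@adj G) ->
  free_amalgam X1 X2 X0 -> rconvex n X0 (X1 `|` X2) -> rconvex n X1 (X1 `|` X2).
Proof.
move=> adjS amal c0; have X01 : X0 `<=` X1 by case: amal => <- _ x [].
have [XX e] := amal.
apply: rconvexP => a q b exc lt qY; have [Xa Xb uq q0 nq] := exc.
have [z [z' [zq zq' az zb]]] := excursion_ends exc.
have to0 x v : X1 x -> v \in q -> adj x v -> X0 x.
  move=> Xx vq xv; have [[_ /(nq v vq)//]|[X2x _]] := e x v (or_introl Xx) (qY v vq) xv.
  by rewrite -XX.
apply: (@excursion_rconvex _ n X0 (X1 `|` X2) a q b c0) => //; last by left.
split=> //; first exact: to0 az.
  by apply: (to0 b z') => //; rewrite adjS.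
by move=> v vq /X01; apply: nq.
Qed.

Section AmalgamHull.
Variables (G : graph) (n : nat) (X1 X2 X0 Z : set G).
Hypotheses (adjS : symmetric (@adj G)) (n3 : 2 < n).
Hypotheses (amal : free_amalgam X1 X2 X0) (sZ : strong n (X1 `|` X2) Z).
Hypotheses (cZ : convex n Z) (c0 : rconvex n X0 (X1 `|` X2)).

(* Take the hull of [X1] first, then that of [hull X0 `|` X2] over it. *)
Lemma amalgam_hull :
  [/\ free_amalgam (hull n X1) (hull n X2) (hull n X0),
    strong n (hull n X1 `|` hull n X2) Z,
    strong n X1 (hull n X1) & strong n X2 (hull n X2)].
Proof.
have [XX e] := amal.
have X01 : X0 `<=` X1 by rewrite -XX => x [].
have X02 : X0 `<=` X2 by rewrite -XX => x [].
have r1 := amalgam_rconvex adjS amal c0.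
have r2 : rconvex n X2 (X2 `|` X1).
  by apply: (amalgam_rconvex adjS (free_amalgamC amal)); rewrite setUC.
have [hY he hs s1] := hull_strong adjS n3 sZ cZ (@subsetUl _ X1 X2) r1.
have s2 : strong n X2 (hull n X2).
  have sZ' : strong n (X2 `|` X1) Z by rewrite setUC.
  by have [] := hull_strong adjS n3 sZ' cZ (@subsetUl _ X2 X1) r2.
set L := hull n X1; set C := hull n X0.
have XL : X1 `<=` L by apply: sub_hull.
have CL : C `<=` L by apply: hullS.
have LX2 x : L x -> X2 x -> C x.
  move=> Lx Xx; apply: sub_hull; rewrite -XX; split=> //.
  by rewrite -hY; split=> //; right.
have eLX x y : L x -> X2 y -> adj x y -> X2 x \/ L y.
  move=> Lx Xy xy; have [X1x|X1y] := he x y Lx (or_intror Xy) xy; last by right; apply: XL.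
  have [[_ X1y]|[X2x _]] := e x y (or_introl X1x) (or_intror Xy) xy; last by left.
  by right; apply: XL.
(* Such an excursion has its interior in [L] and, by [eLX], its ends in [C], which is convex. *)
have rX : rconvex n (C `|` X2) (L `|` (X1 `|` X2)).
  apply: rconvexP => a q b exc lt qY; have [Xa Xb uq q0 nq] := exc.
  have [z [z' [zq zq' az zb]]] := excursion_ends exc.
  have qL v : v \in q -> L v.
    by move=> vq; have [//|[/XL//|Xv]] := qY v vq; case: (nq v vq); right.
  have toC x v : (C `|` X2) x -> v \in q -> adj x v -> C x.
    case=> // Xx vq xv; rewrite adjS in xv.
    have [Xv|Lx] := eLX v x (qL v vq) Xx xv; last exact: LX2.
    by case: (nq v vq); right.
  apply: (@excursion_convex _ n C a q b (@hull_convex _ n X0) _ lt).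
  split=> //; first exact: toC az.
    by apply: (toC b z') => //; rewrite adjS.
  by move=> v vq Cv; apply: (nq v vq); left.
have sub' : C `|` X2 `<=` L `|` (X1 `|` X2).
  by move=> x [/CL|]; [left|right; right].
have [hY' he' hs' _] := hull_strong adjS n3 hs cZ sub' rX.
have ER : hull n (C `|` X2) = hull n X2.
  apply/seteqP; split; last by apply: hullS; apply: subsetUr.
  apply: hull_min; first exact: hull_convex.
  by move=> x [Cx|]; [apply: (hullS X02)|apply: sub_hull].
rewrite {}ER in hY' he' hs'.
have CR : C `<=` hull n X2 by apply: hullS.
split=> //; last first.
  have <- // : hull n X2 `|` (L `|` (X1 `|` X2)) = L `|` hull n X2.
  apply/seteqP; split=> x; last by case; [right; left|left].
  by case=> [|[|[/XL|/sub_hull]]]; [right|left|left|right].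
split.
  apply/seteqP; split=> x; last by move=> Cx; split; [apply: CL|apply: CR].
  case=> Lx Rx; have : (hull n X2 `&` (L `|` (X1 `|` X2))) x by split=> //; left.
  by rewrite hY' => -[//|]; apply: LX2.
have side x y : hull n X2 x -> L y -> adj x y -> L x \/ hull n X2 y.
  move=> Rx Ly xy; have [[/CL|Xx]|[/CR|/sub_hull]] := he' x y Rx (or_introl Ly) xy;
    [by left| |by right|by right].
  rewrite adjS in xy; have [Xy|Lx] := eLX y x Ly Xx xy; last by left.
  by right; apply: sub_hull.
move=> x y [Lx|Rx] [Ly|Ry] xy; [by left| | |by right].
  by rewrite adjS in xy; have [Ly|Rx] := side y x Ry Lx xy; [left|right].
by have [Lx|Ry] := side x y Rx Ly xy; [left|right].
Qed.

End AmalgamHull.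

Lemma iso_rel_cycle (G1 G2 : graph) (R : set (G1 * G2)) (t : seq (G1 * G2)) :
  iso_rel R -> (forall u, u \in t -> R u) ->
  is_cycle (unzip1 t) -> is_cycle (unzip2 t).
Proof.
move=> iR; case: t => [|[x x'] t] Rt [//]; rewrite !size_map => sc uc cc.
have Rx := Rt _ (mem_head _ _).
have Rt' u : u \in t -> R u by move=> ut; apply: Rt; rewrite inE ut orbT.
split; first by rewrite size_map.
  have : upath x (unzip1 t).
    by apply/andP; split=> //; move: cc => /=; rewrite rcons_path => /andP[].
  by rewrite (iso_rel_upath iR Rx Rt') => /andP[].
have : path (@adj G1) x (unzip1 (rcons t (x, x'))) by rewrite /unzip1 map_rcons.
rewrite (iso_rel_path iR Rx) ?/unzip2 ?map_rcons //.
by move=> u; rewrite mem_rcons inE => /predU1P[->|/Rt'].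
Qed.

(** * Two copies of a graph glued along a convex set *)

Section Double.
Variables (n : nat) (M : graph) (G1 C : set M).
Hypotheses (bM : bipartite M) (gM : girth_ge M (2 * n)) (cC : convex n C).

(* Two copies of [G1], labelled by booleans and glued along [C]: a vertex of [C]
   occurs with label [false] only and has neighbours with both labels. *)
Definition dbl_raw : graph := @Graph (M * bool)%type (fun p => part p.1)
  (fun p q => adj p.1 q.1 && [|| p.2 == q.2, `[< C p.1 >] | `[< C q.1 >]]).

Definition dbl_set : set dbl_raw := [set p : (M * bool)%type | G1 p.1 /\ (p.2 -> ~ C p.1)].

Definition dbl : graph := induced dbl_set.

Definition dbl_proj (v : dbl) : M := (val v).1.

Definition dbl_l : set dbl := [set v : dbl | (val v).2 = false].
Definition dbl_r : set dbl := [set v : dbl | (val v).2 \/ C (dbl_proj v)].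
Definition dbl_c : set dbl := [set v : dbl | C (dbl_proj v)].

Lemma dbl_valP (v : dbl) : G1 (dbl_proj v) /\ ((val v).2 -> ~ C (dbl_proj v)).
Proof. exact: (induced_val v). Qed.

Lemma dbl_c_side v : C (dbl_proj v) -> (val v).2 = false.
Proof. by move=> Cv; apply/negP => /(dbl_valP v).2. Qed.

Lemma dbl_inj (u v : dbl) : dbl_proj u = dbl_proj v -> (val u).2 = (val v).2 -> u = v.
Proof.
move=> E1 E2; apply: val_inj; rewrite [val u]surjective_pairing [val v]surjective_pairing.
by congr pair.
Qed.

Lemma dbl_adj (u v : dbl) : adj u v -> adj (dbl_proj u) (dbl_proj v).
Proof. by case/andP. Qed.

Lemma dbl_sym : symmetric (@adj dbl).
Proof.
move=> u v; rewrite /adj /= [in LHS]bM.1 eq_sym; congr andb; congr orb.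
by rewrite orbC.
Qed.

Lemma dbl_cover : dbl_l `|` dbl_r = setT.
Proof.
by apply/seteqP; split=> // v _; case E: ((val v).2); [right; left|left].
Qed.

Lemma dbl_amalgam : free_amalgam dbl_l dbl_r dbl_c.
Proof.
split.
  apply/seteqP; split=> v; first by case=> /= E [|//]; rewrite E.
  by move=> Cv; split; [apply: dbl_c_side|right].
move=> u v _ _ /andP[_ /or3P[/eqP E|/asboolP Cu|/asboolP Cv]].
- case Eu: ((val u).2); [right|left]; split; rewrite ?/dbl_l ?/dbl_r /= -?E ?Eu //;
    by left.
- have Eu := dbl_c_side Cu; have [Lv|Rv] : (dbl_l `|` dbl_r) v by rewrite dbl_cover.
    by left.
  by right; split=> //; right.
- have Ev := dbl_c_side Cv; have [Lu|Ru] : (dbl_l `|` dbl_r) u by rewrite dbl_cover.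
    by left.
  by right; split=> //; right.
Qed.

Definition dbl_rel (S : set dbl) : set (dbl * M) := [set p | S p.1 /\ p.2 = dbl_proj p.1].

Lemma dbl_rel_l : iso_rel (dbl_rel dbl_l).
Proof.
split=> [x y x' y' [/= Lx ->] [/= Ly ->]|x y x' y' [/= Lx ->] [/= Ly ->]|x x' [/= _ ->]] //.
- by split=> [->//|E]; apply: dbl_inj; rewrite // Lx Ly.
- by rewrite /adj /= Lx Ly eqxx andbT.
Qed.

Lemma dbl_rel_r : iso_rel (dbl_rel dbl_r).
Proof.
split=> [x y x' y' [/= Rx ->] [/= Ry ->]|x y x' y' [/= Rx ->] [/= Ry ->]|x x' [/= _ ->]] //.
- split=> [->//|E]; apply: dbl_inj => //.
  case: Rx => [sx|Cx]; last by rewrite !dbl_c_side // -?E.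
  case: Ry => [sy|Cy]; first by rewrite sx sy.
  by rewrite !dbl_c_side // E.
- rewrite /adj /=; case: Rx => [sx|/asboolT ->]; last by rewrite orbT andbT.
  by case: Ry => [sy|/asboolT ->]; rewrite ?sx ?sy ?eqxx ?orbT andbT.
Qed.

Lemma dbl_proj_l : dbl_proj @` dbl_l = G1.
Proof.
apply/seteqP; split=> [_ [v _ <-]|x Gx]; first by case: (dbl_valP v).
have H : dbl_set (x, false) by split.
by exists (exist _ ((x, false) : dbl_raw) (mem_set H)).
Qed.

Lemma dbl_proj_r : dbl_proj @` dbl_r = G1.
Proof.
apply/seteqP; split=> [_ [v _ <-]|x Gx]; first by case: (dbl_valP v).
have [Cx|nCx] := pselect (C x).
  have H : dbl_set (x, false) by split.
  by exists (exist _ ((x, false) : dbl_raw) (mem_set H)) => //; right.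
have H : dbl_set (x, true) by split.
by exists (exist _ ((x, true) : dbl_raw) (mem_set H)) => //; left.
Qed.

Lemma dbl_proj_c : dbl_proj @` dbl_c = G1 `&` C.
Proof.
apply/seteqP; split=> [_ [v Cv <-]|x [Gx Cx]]; first by case: (dbl_valP v).
have H : dbl_set (x, false) by split.
by exists (exist _ ((x, false) : dbl_raw) (mem_set H)).
Qed.

Lemma dbl_bipartite : bipartite dbl.
Proof. by split=> [|u v /dbl_adj]; [exact: dbl_sym|exact: bM.2]. Qed.

Lemma dbl_rel_seq S (s : seq dbl) : (forall z, z \in s -> S z) ->
  [/\ unzip1 [seq (z, dbl_proj z) | z <- s] = s,
    unzip2 [seq (z, dbl_proj z) | z <- s] = map dbl_proj s &
    forall u, u \in [seq (z, dbl_proj z) | z <- s] -> dbl_rel S u].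
Proof.
move=> sS; split; first by rewrite /unzip1 -map_comp map_id.
  by rewrite /unzip2 -map_comp.
by move=> _ /mapP[z /sS Sz ->].
Qed.

(** The interior of an excursion avoids the glued part and so stays on one side, where the
    projection is an isomorphism onto its image; the projected path lies in [C] by convexity. *)
Lemma dbl_c_convex : convex n dbl_c.
Proof.
have [LR _] := dbl_amalgam.
apply: convexP => a q b exc lt.
have [Ca Cb uq q0 nq] := exc.
have main S : iso_rel (dbl_rel S) -> dbl_c `<=` S -> (forall z, z \in q -> S z) -> False.
  move=> iS cS qS.
  have [|E1 E2 RS] := @dbl_rel_seq S (rcons q b).
    by move=> z; rewrite mem_rcons inE => /predU1P[->|/qS//]; apply: cS.
  have Ra : dbl_rel S (a, dbl_proj a) by split=> //; apply: cS.
  have := iso_rel_upath iS Ra RS; rewrite E1 E2 uq => /esym up.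
  case: q q0 nq {exc} lt qS E1 E2 RS uq up => // z q _ nq lt qS _ _ _ _ up.
  apply: (nq z (mem_head _ _)).
  apply: (cC up) => //; first by rewrite size_map size_rcons.
    by rewrite map_rcons last_rcons.
  by rewrite rcons_cons /= mem_head.
case: q q0 uq nq lt main {exc} => // z q _ /andP[/= /andP[_ pq] _] nq lt main.
have T (v : dbl) : (dbl_l `|` dbl_r) v by rewrite dbl_cover.
have T' (v : dbl) : (dbl_r `|` dbl_l) v by rewrite setUC dbl_cover.
move: pq; rewrite rcons_path => /andP[pq _].
have [Lz|Rz] := T z.
  apply: (main dbl_l dbl_rel_l) => [v|v]; first by rewrite -LR => -[].
  by rewrite inE => /predU1P[->//|]; apply: (side_path dbl_amalgam pq).
apply: (main dbl_r dbl_rel_r) => [v|v]; first by rewrite -LR => -[].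
by rewrite inE => /predU1P[->//|]; apply: (side_path (free_amalgamC dbl_amalgam) pq).
Qed.

Lemma dbl_girth : girth_ge dbl (2 * n).
Proof.
have main S : iso_rel (dbl_rel S) -> forall c : seq dbl, is_cycle c ->
    (forall z, z \in c -> S z) -> 2 * n <= size c.
  move=> iS c cc cS; have [E1 E2 RS] := dbl_rel_seq cS.
  rewrite -(size_map dbl_proj) -E2; apply: gM.
  by apply: (iso_rel_cycle iS RS); rewrite E1.
apply: (amalgam_girth dbl_sym dbl_amalgam dbl_cover dbl_c_convex).
  exact: main dbl_rel_l.
exact: main dbl_rel_r.
Qed.

Lemma dbl_finite : finite_set G1 -> finite_set [set: dbl].
Proof.
move=> /finite_seqP[s Es].
pose t : seq dbl_raw := [seq p <- [seq (x, b) | x <- s, b <- [:: true; false]] | `[< dbl_set p >]].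
have [t' Et] : exists t' : seq dbl, map val t' = t.
  by apply: induced_lift => p; rewrite mem_filter => /andP[/asboolP].
apply/finite_seqP; exists t'; apply/seteqP; split=> // v _ /=.
rewrite -(mem_map val_inj) Et mem_filter; apply/andP; split.
  by apply/asboolP; apply: (induced_val v).
apply/allpairsP; exists ((val v).1, (val v).2); split=> /=.
- by have [Gv _] := dbl_valP v; move: Gv; rewrite Es.
- by case: ((val v).2).
- exact: surjective_pairing.
Qed.

(** Each copy is connected and contains the common point [c']. Without such a point the copies would
    fall apart, hence the separate treatment of an empty [C]. *)
Lemma dbl_connected : (forall x y, G1 x -> G1 y -> linked G1 x y) ->
  (exists c, G1 c /\ C c) -> connected_graph dbl.
Proof.
move=> lG [c [Gc Cc]].
have [c' Cc' Ec'] : (dbl_proj @` dbl_c) c by rewrite dbl_proj_c.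
have [LR _] := dbl_amalgam.
have main S v : iso_rel (dbl_rel S) -> dbl_proj @` S = G1 -> dbl_c `<=` S -> S v ->
    linked setT v c'.
  move=> iS pS cS Sv; have [Gv _] := dbl_valP v.
  have [p [vp lp pG]] := lG _ _ Gv Gc.
  have [t Et tS] : exists2 t, map dbl_proj t = p & forall z, z \in t -> S z.
    by apply: lift_seq => y /pG; rewrite -pS => -[x Sx <-]; exists x.
  have [E1 E2 RS] := dbl_rel_seq tS.
  have Rv : dbl_rel S (v, dbl_proj v) by split.
  have := iso_rel_path iS Rv RS; rewrite E1 E2 Et vp => pt.
  exists t; split=> //.
  have := iso_rel_last Rv RS; rewrite E1 E2 Et lp => Rl.
  have Rc : dbl_rel S (c', c) by split; [apply: cS|].
  by have [inj _ _] := iS; apply: (inj _ _ _ _ Rl Rc).2.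
have lc v : linked setT v c'.
  have : (dbl_l `|` dbl_r) v by rewrite dbl_cover.
  case=> [Lv|Rv].
    apply: (main dbl_l v dbl_rel_l dbl_proj_l) => //.
    by move=> u; rewrite -LR => -[].
  apply: (main dbl_r v dbl_rel_r dbl_proj_r) => //.
  by move=> u; rewrite -LR => -[].
move=> x y; have [p [xp Ey _]] : linked setT x y.
  by apply: linked_trans (lc x) _; apply: (linked_sym dbl_sym) (lc y).
by exists p.
Qed.

End Double.

(** * Graph embeddings with convex image *)

Section GraphEmbedding.
Variables (n : nat) (G1 G2 : graph) (f : G1 -> G2).
Hypotheses (fI : injective f) (fE : forall x y, adj (f x) (f y) = adj x y).
Hypotheses (fP : forall x, part (f x) = part x).

Lemma graph_iso_rel : iso_rel [set p | p.2 = f p.1].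
Proof.
split=> [x y x' y' /= -> ->|x y x' y' /= -> ->|x x' /= ->] //.
by split=> [->|/fI].
Qed.

Lemma embed_upath x p : upath (f x) (map f p) = upath x p.
Proof.
rewrite /upath path_map -map_cons map_inj_uniq //; congr andb.
by apply: eq_path => u v; apply: fE.
Qed.

Lemma rconvex_embed X : convex n X -> rconvex n (f @` X) (range f).
Proof.
move=> cX x' p up sp [x Xx Ex] [y Xy Ey] pR.
rewrite -{x'}Ex in up Ey.
have [t Et _] : exists2 t, map f t = p & forall z, z \in t -> True.
  by apply: lift_seq => z /pR[u _ <-]; exists u.
rewrite -Et embed_upath in up; rewrite -Et last_map in Ey.
rewrite -Et size_map in sp; rewrite -{}Et.
move=> _ /mapP[z zt ->]; exists z => //; apply: (cX x t) => //.
by rewrite -(fI Ey).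
Qed.

Hypotheses (n3 : 2 < n) (cR : convex n (range f)).

Lemma graph_embedding_Ln : generalized_ngon n G1 -> generalized_ngon n G2 ->
  @embedding n (Ln n G1) (Ln n G2) f.
Proof.
move=> g1 g2; split=> // k x y.
have iR := graph_iso_rel.
have E : rng_rel [set p | p.2 = f p.1] = range f.
  by apply/seteqP; split=> [y' [x' /= ->]|y' [x' _ <-]]; exists x'.
have D : dom_rel [set p | p.2 = f p.1] = setT.
  by apply/seteqP; split=> // x' _; exists (f x').
symmetry; apply: (@iso_rel_fk _ _ n g1 g2 n3 [set p | p.2 = f p.1] k x y (f x) (f y)) => //.
  by rewrite D.
by rewrite E.
Qed.

(** The image of a cycle of length [2 * n] settles the girth. Were the diameter of [G2] below [n],
    convexity would keep short paths between image points in the image, and [G1] would inherit the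
    bound. *)
Lemma pregon_embed_ngon : generalized_ngon n G1 -> pregon n G2 ->
  generalized_ngon n G2.
Proof.
move=> [bG1 [d1 min1] [_ [c cc sc]]] [bG2 d2 g2].
split=> //; split=> //; last first.
  exists (map f c); last by rewrite size_map.
  case: cc => s3 uc ccyc; split; rewrite ?size_map ?map_inj_uniq //.
  case: (c) ccyc => // u s /=; rewrite -map_rcons path_map.
  by rewrite (eq_path (e' := @adj G1)).
move=> l dl; apply: min1 => x y.
have [m dm _] := d1 x y; exists m => //.
have [ltl|len] := leqP n l.
  have [m' [p gp <-] lm] := d1 x y; case: dm => q gq <-.
  apply: leq_trans ltl; apply: leq_trans lm; apply: gq.2; by case: gp.
have [m' [p [[wp lp] minp] <-] ll] := dl (f x) (f y).
have [q [uq lq sq _]] := walk_upath wp; rewrite lp in lq.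
have qR : forall z, z \in q -> range f z.
  apply: (cR uq) => //; first exact: leq_ltn_trans sq (leq_ltn_trans ll len).
  by rewrite lq; exists y.
have [t Et _] : exists2 t, map f t = q & forall z, z \in t -> True.
  by apply: lift_seq => z /qR[u _ <-]; exists u.
rewrite -Et in uq lq sq; rewrite embed_upath in uq; rewrite last_map in lq.
case: dm => r gr <-; apply: leq_trans ll; apply: leq_trans sq.
rewrite size_map; apply: gr.2; split; [by case/andP: uq|exact: fI].
Qed.

End GraphEmbedding.

(** Matching [pi v] with [e v] relates two sets that are strong in their hulls. The first hull is
    all of [M1], so the extension is a map. *)
Lemma iso_extend_embedding (n : nat) (H M1 M2 : graph) (pi : H -> M1) (e : H -> M2)
    (S : set H) : 2 < n -> pregon n M1 -> pregon n M2 ->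
    iso_rel [set p : (H * M1)%type | S p.1 /\ p.2 = pi p.1] ->
    injective e -> (forall x y, adj (e x) (e y) = adj x y) ->
    (forall x, part (e x) = part x) ->
    strong n (pi @` S) setT -> hull n (pi @` S) = setT ->
    strong n (e @` S) (hull n (e @` S)) ->
  exists f : M1 -> M2, [/\ injective f, forall x y, adj (f x) (f y) = adj x y,
    forall x, part (f x) = part x, range f = hull n (e @` S) &
    forall v, S v -> f (pi v) = e v].
Proof.
move=> n3 p1 p2 [i1 i2 i3] eI eE eP sT hT sS.
have i1' u v : S u -> S v -> u = v <-> pi u = pi v by move=> Su Sv; apply: i1.
have i2' u v : S u -> S v -> adj u v = adj (pi u) (pi v) by move=> Su Sv; apply: i2.
have i3' u : S u -> part u = part (pi u) by move=> Su; apply: i3.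
pose R0 : set (M1 * M2) := [set p | exists v, [/\ S v, p.1 = pi v & p.2 = e v]].
have D0 : dom_rel R0 = pi @` S.
  apply/seteqP; split=> [x [y [v [/= Sv -> _]]]|_ [v Sv <-]]; first by exists v.
  by exists (e v), v.
have E0 : rng_rel R0 = e @` S.
  apply/seteqP; split=> [y [x [v [/= Sv _ ->]]]|_ [v Sv <-]]; first by exists v.
  by exists (pi v), v.
have iR0 : iso_rel R0.
  split=> [x y x' y'|x y x' y'|x x'].
  - move=> [u [/= Su -> ->]] [v [/= Sv -> ->]].
    by split=> [/(i1' u v Su Sv) ->|/eI ->].
  - by move=> [u [/= Su -> ->]] [v [/= Sv -> ->]]; rewrite eE i2'.
  - by move=> [u [/= Su -> ->]]; rewrite eP i3'.
have cT : convex n [set: M1] by [].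
have [|R [iR R0R dR rR [cdR crR]]] := iso_extend p1 p2 n3 cT (@hull_convex _ n (e @` S)) (R0 := R0).
  by split; rewrite ?D0 ?E0.
have {}dR : dom_rel R = setT.
  apply/seteqP; split=> //; rewrite -hT; apply: hull_min => //; rewrite -D0.
  by move=> x [y /R0R Rxy]; exists y.
have {}rR : rng_rel R = hull n (e @` S).
  apply/seteqP; split=> //; apply: hull_min => //; rewrite -E0.
  by move=> y [x /R0R Rxy]; exists x.
have [f Rf] : {f : M1 -> M2 & forall x, R (x, f x)}.
  by apply: (@choice _ _ (fun x y => R (x, y))) => x; have : dom_rel R x by rewrite dR.
have [r1 r2 r3] := iR.
exists f; split.
- by move=> x y E; apply/(r1 _ _ _ _ (Rf x) (Rf y)).
- by move=> x y; rewrite (r2 _ _ _ _ (Rf x) (Rf y)).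
- by move=> x; rewrite (r3 _ _ (Rf x)).
- rewrite -rR; apply/seteqP; split=> [_ [x _ <-]|y [x Rxy]]; first by exists x.
  by exists x => //; apply: (r1 _ _ _ _ (Rf x) Rxy).1.
- move=> v Sv; have Rv : R (pi v, e v) by apply: R0R; exists v.
  exact: (r1 _ _ _ _ (Rf _) Rv).1.
Qed.

(* Here [L] and [R] are two copies of [T] in [H], amalgamated over [K]. *)
Lemma amalgam_embeddings (n : nat) (H M1 M2 : graph) (pi : H -> M1) (e : H -> M2)
    (L R K : set H) (T C : set M1) : 2 < n ->
    generalized_ngon n M1 -> pregon n M2 ->
    iso_rel [set p : (H * M1)%type | L p.1 /\ p.2 = pi p.1] ->
    iso_rel [set p : (H * M1)%type | R p.1 /\ p.2 = pi p.1] ->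
    injective e -> (forall x y, adj (e x) (e y) = adj x y) ->
    (forall x, part (e x) = part x) ->
    pi @` L = T -> pi @` R = T -> pi @` K = T `&` C ->
    strong n T setT -> hull n T = setT ->
    convex n C -> C `<=` hull n (T `&` C) -> convex n K ->
    free_amalgam L R K -> L `|` R = setT -> strong n (range e) setT ->
  generalized_ngon n M2 /\
  exists f g : Ln n M1 -> Ln n M2, [/\ embedding f, embedding g,
    forall x, C x -> f x = g x,
    @free_amalgam M2 (range f) (range g) (f @` C) &
    @strong M2 n (range f `|` range g) setT].
Proof.
move=> n3 g1 p2 iL iR eI eE eP pL pR pK sT hT cC hC cK am cover sE.
have p1 := generalized_ngon_pregon g1.
have [[adjS _] _ _] := p2; have [LR _] := am.
have eam : free_amalgam (e @` L) (e @` R) (e @` K) by apply/free_amalgam_embed.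
have eU : e @` L `|` e @` R = range e by rewrite -image_setU cover.
have cT2 : convex n [set: M2] by [].
have [||hA hS sl sr] := amalgam_hull adjS n3 eam _ cT2.
- by rewrite eU.
- by rewrite eU; apply: rconvex_embed.
have [||f [fI fE fP fR fpi]] := iso_extend_embedding n3 p1 p2 iL eI eE eP _ _ sl.
- by rewrite pL.
- by rewrite pL.
have [||g [gI gE gP gR gpi]] := iso_extend_embedding n3 p1 p2 iR eI eE eP _ _ sr.
- by rewrite pR.
- by rewrite pR.
have cf : convex n (range f) by rewrite fR; apply: hull_convex.
have cg : convex n (range g) by rewrite gR; apply: hull_convex.
have g2 : generalized_ngon n M2 := pregon_embed_ngon fI fE cf g1 p2.
have ef : @embedding n (Ln n M1) (Ln n M2) f by apply: graph_embedding_Ln.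
have eg : @embedding n (Ln n M1) (Ln n M2) g by apply: graph_embedding_Ln.
split=> //; exists f, g; split=> //; last by rewrite fR gR.
(* [f] and [g] agree on the trace of [C] on [T], which generates [C]. *)
- have agree : C `<=` [set x | f x = g x].
    apply: subset_trans hC _; rewrite -(gen_hull g1 n3).
    have [_ _ hf] := ef; have [_ _ hg] := eg.
    apply: (@gen_min n (Ln n M1) (T `&` C) [set x : M1 | f x = g x]) => [k x y /= hx hy|x].
      by have := hf k x y; have := hg k x y; rewrite /= => -> ->; rewrite hx hy.
    rewrite -pK => -[v Kv <-] /=; have [Lv Rv] : (L `&` R) v by rewrite LR.
    by rewrite fpi // gpi.
  by move=> x /agree.
- rewrite fR gR; suff -> : f @` C = hull n (e @` K) by [].
  have EC : C = hull n (T `&` C).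
    apply/seteqP; split=> //; apply: hull_min => //; exact: subIsetr.
  rewrite {1}EC -(gen_hull g1 n3) -(gen_hull g2 n3).
  rewrite -(@gen_image n (Ln n M1) (Ln n M2) f ef (T `&` C)).
  apply: (f_equal (@gen n (Ln n M2))); rewrite -pK; apply/seteqP.
  have fK v : K v -> f (pi v) = e v.
    by move=> Kv; apply: fpi; have [] : (L `&` R) v by rewrite LR.
  split=> [_ [_ [v Kv <-] <-]|_ [v Kv <-]]; first by exists v; rewrite // fK.
  by exists (pi v); [exists v|rewrite fK].
Qed.

Section FreeDouble.
Variables (n : nat) (G : graph).
Hypotheses (n3 : 2 < n) (fG : finite_set [set: G]) (bG : bipartite G).
Hypotheses (cG : connected_graph G) (gG : girth_ge G (2 * n)).
Local Notation M1 := (free_completion n G).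
Hypothesis ngon1 : generalized_ngon n M1.
Variables (C : set M1) (j : nat).
Hypotheses (C0 : C `&` @St n G j !=set0) (cC : convex n C).
Hypothesis hC : C `<=` hull n (C `&` @St n G j).

Let bM1 : bipartite M1. Proof. by case: ngon1. Qed.
Let gM1 : girth_ge M1 (2 * n). Proof. by case: ngon1 => _ _ []. Qed.

Local Notation G' := (dbl (@St n G j) C).
Local Notation M2 := (free_completion n G').

Let fG' : finite_set [set: G']. Proof. exact/dbl_finite/St_finite. Qed.
Let bG' : bipartite G'. Proof. exact: dbl_bipartite. Qed.
Let cG' : connected_graph G'.
Proof.
apply: dbl_connected => //; last by case: C0 => c [Cc Gc]; exists c.
by move=> x y; apply: St_linked.
Qed.
Let gG' : girth_ge G' (2 * n). Proof. exact: dbl_girth. Qed.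
Let pM2 : pregon n M2. Proof. exact: free_pregon. Qed.

Lemma free_double : exists G2 : graph,
  [/\ finite_set [set: G2], bipartite G2, connected_graph G2 & girth_ge G2 (2 * n)] /\
  generalized_ngon n (free_completion n G2) /\
  exists f g : Ln n M1 -> Ln n (free_completion n G2), [/\ embedding f, embedding g,
    forall x, C x -> f x = g x,
    @free_amalgam (free_completion n G2) (range f) (range g) (f @` C) &
    @strong (free_completion n G2) n (range f `|` range g) setT].
Proof.
exists G'; split; first by split.
have [e [eI eE eP eR]] := base_rel n3 bG'.
have Tn : St j `&` C = C `&` @St n G j by rewrite setIC.
apply: (amalgam_embeddings (pi := @dbl_proj M1 (@St n G j) C) (e := e) (T := @St n G j) n3 ngon1 pM2
  (dbl_rel_l _ _) (dbl_rel_r _ _) eI eE eP (dbl_proj_l _ _) (dbl_proj_r _ _) (dbl_proj_c _ _)) => //.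
- exact: St_strong.
- apply/seteqP; split=> // x _; have : hull n (@St n G 0) x by rewrite free_hull.
  by apply: hullS; apply: St_mono.
- by rewrite Tn.
- exact: dbl_c_convex.
- exact: dbl_amalgam.
- exact: dbl_cover.
- by rewrite eR; apply: St_strong.
Qed.

End FreeDouble.

(** * Existence *)

(** A total map whose values off [T] are irrelevant, so that images and compositions need no
    subtype. *)
Definition pembedding n (M N : Lstruct n) (T : set M) (e : M -> N) :=
  [/\ forall x y, T x -> T y -> e x = e y -> x = y, forall x, T x -> sP (e x) = sP x
    & forall k x y, T x -> T y -> e (sf k x y) = sf k (e x) (e y)].

Section PEmbedding.
Variables (n : nat) (M N : Lstruct n) (T : set M) (e : M -> N).
Hypotheses (sT : substructure T) (eE : pembedding T e).

Lemma pembedding_comp (K : Lstruct n) (f : N -> K) : embedding f -> pembedding T (f \o e).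
Proof.
have [eI eP ef] := eE; move=> [fI fP ff]; split=> [x y Tx Ty /= /fI/eI|x Tx|k x y Tx Ty] /=.
- exact.
- by rewrite fP eP.
- by rewrite ef // ff.
Qed.

Lemma gen_pembedding (A : set M) : A `<=` T -> gen (e @` A) = e @` gen A.
Proof.
have [eI eP ef] := eE; move=> AT; have gT : gen A `<=` T by apply: gen_min.
apply/seteqP; split.
  apply: gen_min => [k _ _ [x Ax <-] [y Ay <-]|_ [x Ax <-]].
    by exists (sf k x y); [apply: gen_sub|rewrite ef //; apply: gT].
  by exists x => //; apply: sub_gen.
have : gen A `<=` T `&` e @^-1` gen (e @` A).
  apply: gen_min => [k x y [Tx hx] [Ty hy]|x Ax]; split; try exact: sT.
  - by rewrite /= ef //; apply: gen_sub.
  - exact: AT.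
  - by apply: sub_gen; exists x.
by move=> sub _ [x /sub[_ h] <-].
Qed.

Lemma fg_sub_pembedding (A : set M) : A `<=` T -> fg_sub A -> fg_sub (e @` A).
Proof.
move=> AT [s Es]; exists (map e s); have sA : [set` s] `<=` T.
  by apply: subset_trans AT; rewrite Es; apply: sub_gen.
rewrite Es /gens -gen_pembedding //; congr gen; apply/seteqP; split.
  by move=> _ [x xs <-]; apply: map_f.
by move=> _ /mapP[x xs ->]; exists x.
Qed.

End PEmbedding.

Lemma pembedding_partial_iso n (M : Lstruct n) (T A : set M) (e : M -> M) :
  pembedding T e -> A `<=` T -> partial_iso A (e @` A) e.
Proof.
move=> [eI eP ef] AT; split; first split.
- by move=> x Ax; exists x.
- by move=> x y /set_mem/AT Tx /set_mem/AT Ty; apply: eI.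
- by [].
- by move=> x /AT; apply: eP.
- by move=> k x y /AT Tx /AT Ty; apply: ef.
Qed.

Section SubStruct.
Variables (n : nat) (M : Lstruct n) (T : set M).
Hypothesis sT : substructure T.

Definition sub_struct : Lstruct n := @LStruct n (set_type T) (fun x => sP (val x))
  (fun k x y => exist _ (sf k (val x) (val y)) (mem_set (sT k (set_valP x) (set_valP y)))).

Lemma sub_struct_fg : fg_sub T -> fg_struct sub_struct.
Proof.
move=> [s Es].
have [s' Es'] : exists s' : seq sub_struct, map val s' = s.
  have [|t Et _] := @lift_seq sub_struct M (fun=> True) val s; last by exists t.
  move=> y ys; have Ty : T y by rewrite Es; apply: sub_gen.
  by exists (exist _ y (mem_set Ty)).
exists s'; apply/seteqP; split=> // x _.
suff sub : T `<=` [set y | exists2 z : sub_struct, val z = y & gens s' z].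
  by have [z /val_inj <-] := sub _ (set_valP x).
rewrite {1}Es; apply: gen_min => [k _ _ [u <- gu] [v <- gv]|y ys].
  by exists (sf k u v) => //; apply: gen_sub.
move: ys; rewrite /= -Es' => /mapP[z zs ->]; exists z => //.
exact: sub_gen.
Qed.

End SubStruct.

Section Existence.
Variables (n : nat) (Gam : graph).
Hypotheses (n3 : 2 < n) (gG : generalized_ngon n Gam).
Hypothesis lim : fraisse_limit (@free_class n) (Ln n Gam).
Local Notation L := (Ln n Gam).

Let homG : homogeneous L. Proof. by case: lim. Qed.

Lemma age_rep (T : set L) : fg_sub T -> T !=set0 -> exists G : graph,
  [/\ finite_set [set: G], bipartite G, connected_graph G & girth_ge G (2 * n)] /\
  generalized_ngon n (free_completion n G) /\
  exists e : L -> Ln n (free_completion n G), pembedding T e.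
Proof.
move=> fT [t Tt]; have sT := fg_sub_substructure fT.
have [_ _ age] := lim; have emb : embeds (sub_struct sT) L.
  by exists val; split=> //; apply: val_inj.
have [G [hG [nG [e [eI eP ef]]]]] := (age _ (sub_struct_fg sT fT)).1 emb.
exists G; split=> //; split=> //.
(* [t'] only serves as the value of [c] off [T]. *)
pose t' : sub_struct sT := exist _ t (mem_set Tt).
pose c x : sub_struct sT := insubd t' x.
have cE x : T x -> val (c x) = x.
  by move=> Tx; rewrite insubdK //; apply: mem_set.
exists (e \o c); split=> [x y Tx Ty /= /eI E|x Tx|k x y Tx Ty] /=.
- by rewrite -(cE x Tx) E cE.
- by rewrite -[in RHS](cE x Tx); apply: (eP (c x)).
- have /= <- := ef k (c x) (c y); congr e; apply: val_inj.
  have Ts : T (sf k x y) := sT k x y Tx Ty.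
  by rewrite (cE _ Ts) /= !cE.
Qed.

Lemma age_embed (G : graph) :
  [/\ finite_set [set: G], bipartite G, connected_graph G & girth_ge G (2 * n)] ->
  generalized_ngon n (free_completion n G) ->
  exists e : Ln n (free_completion n G) -> L, embedding e.
Proof.
move=> hG nG; have [fG bG cG gG'] := hG; have [_ _ age] := lim.
apply/age; last first.
  by exists G; split=> //; split=> //; exists id; split=> [x y|x|k x y].
have /finite_seqP[s Es] := St_finite n3 0 fG.
exists s; rewrite /gens -Es; symmetry.
by rewrite gen_hull // free_hull.
Qed.

(** [A1] is mapped by the first copy and [B1] by the second. Homogeneity extends these maps [u] and
    [v] to automorphisms [hu] and [hv], and [hw \o hu], with [hw] the inverse of [hv], moves [a]
    while fixing [C], where [u] and [v] agree. *)
Lemma indep_existence_nonempty m (a : m.-tuple L) (B C : set L) :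
    fg_sub B -> fg_sub C -> C !=set0 ->
  exists2 a' : m.-tuple L, same_type C a a' & ngon_indep (gens a') B C.
Proof.
move=> fB fC [c0 Cc0].
pose A1 := gen (gens a `|` C); pose B1 := gen (B `|` C); pose T := gen (A1 `|` B1).
have fa : fg_sub (gens a) by exists a.
have fA1 : fg_sub A1 by apply: fg_sub_genU.
have fB1 : fg_sub B1 by apply: fg_sub_genU.
have fT : fg_sub T by apply: fg_sub_genU.
have sT := fg_sub_substructure fT.
have CA : C `<=` A1 by move=> x Cx; apply: sub_gen; right.
have CB : C `<=` B1 by move=> x Cx; apply: sub_gen; right.
have AT : A1 `<=` T by move=> x Ax; apply: sub_gen; left.
have BT : B1 `<=` T by move=> x Bx; apply: sub_gen; right.
have CT : C `<=` T by apply: subset_trans AT.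
have [|G [[fG bG cG gG'] [nG [e eE]]]] := age_rep fT; first by exists c0; apply: CT.
have fC1 := fg_sub_pembedding sT eE CT fC.
have fA2 := fg_sub_pembedding sT eE AT fA1.
have fB2 := fg_sub_pembedding sT eE BT fB1.
have cvx (X : set (Ln n (free_completion n G))) : fg_sub X ->
    convex n (X : set (free_completion n G)).
  by move=> /fg_sub_gen <-; apply: convex_gen.
(* Stage [j] contains generators of the image of [C], so the trace of that image on it is nonempty
   and generates the whole. *)
have [s Es] := fC1; have [j Sj] := St_seq s.
have sub_s : [set` s] `<=` e @` C `&` @St n G j.
  by move=> x xs; split; [rewrite Es; apply: sub_gen|apply: Sj].
have C1h : e @` C `<=` hull n (e @` C `&` @St n G j).
  by rewrite {1}Es /gens gen_hull //; apply: hullS.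
have C10 : e @` C `&` @St n G j !=set0.
  apply/set0P/negP => /eqP E0; have : hull n (e @` C `&` @St n G j) (e c0).
    by apply: C1h; exists c0.
  by rewrite E0; apply: (@hull_min _ n set0 set0).
have [G2 [hG2 [nG2 [f [g [fE gE fg am st]]]]]] :=
  free_double n3 fG bG cG nG C10 (cvx _ fC1) C1h.
have [h hE] := age_embed hG2 nG2.
pose u := (h \o f) \o e; pose v := (h \o g) \o e.
have uE : pembedding T u by apply: (pembedding_comp eE (embedding_comp fE hE)).
have vE : pembedding T v by apply: (pembedding_comp eE (embedding_comp gE hE)).
have fuA := fg_sub_pembedding sT uE AT fA1.
have fvB := fg_sub_pembedding sT vE BT fB1.
have [hu hua huE] := homG fA1 fuA (pembedding_partial_iso uE AT).
have [hv hva hvE] := homG fB1 fvB (pembedding_partial_iso vE BT).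
have [hw hwa [hvK hwK]] := automorphism_inv hva.
have uv x : C x -> u x = v x by move=> Cx; rewrite /u /v /= fg //; exists x.
exists (map_tuple (hw \o hu) a).
  apply/(same_typeP homG _ _ fC); exists (hw \o hu); split=> //.
    exact: automorphism_comp.
  by move=> x Cx /=; rewrite huE ?uv -?hvE ?hvK //; [apply: CB|apply: CA].
(* Applying [hv] turns the claim into one about images under [hu] and [hv], where the two copies can
   be seen. *)
apply/(indep_automorphism n3 gG _ _ _ hva).
have imA : hv @` gens (map_tuple (hw \o hu) a) = hu @` gens a.
  rewrite /= gens_map; last exact: automorphism_comp.
  apply/seteqP; split=> [_ [_ [x ax <-] <-]|_ [x ax <-]].
    by exists x; rewrite //= hwK.
  by exists (hw (hu x)); rewrite ?hwK //; exists x.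
have eqim (k k' : L -> L) X : (forall x, X x -> k x = k' x) -> k @` X = k' @` X.
  move=> kk; apply/seteqP; split=> [_ [x Xx <-]|_ [x Xx <-]]; exists x => //.
    by rewrite kk.
  by rewrite kk.
have im3 (f' : _ -> Ln n (free_completion n G2)) X :
    ((h \o f') \o e) @` X = h @` (f' @` (e @` X)).
  apply/seteqP; split=> [_ [x Xx <-]|_ [_ [_ [x Xx <-] <-] <-]]; last by exists x.
  by exists (f' (e x)) => //; exists (e x) => //; exists x.
have imu X : u @` X = h @` (f @` (e @` X)) := im3 f X.
have imv X : v @` X = h @` (g @` (e @` X)) := im3 g X.
have imC : hv @` C = hu @` C.
  by apply: eqim => x Cx; rewrite huE ?uv -?hvE //; [apply: CB|apply: CA].
have E1 : gen (hu @` gens a `|` hv @` C) = h @` (f @` (e @` A1)).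
  rewrite imC -image_setU gen_image; last by case: hua.
  by rewrite (eqim hu u A1 huE) imu.
have E2 : gen (hv @` B `|` hv @` C) = h @` (g @` (e @` B1)).
  rewrite -image_setU gen_image; last by case: hva.
  by rewrite (eqim hv v B1 hvE) imv.
have E3 : hv @` C = h @` (f @` (e @` C)).
  by rewrite imC (eqim hu u C (fun x Cx => huE x (CA x Cx))) imu.
apply/(indepE n3 gG); rewrite imA E1 E2 E3.
set X := f @` _; set Y := g @` _; set W := f @` _.
have cvx2 (V : set (Ln n (free_completion n G2))) : fg_sub V ->
    convex n (V : set (free_completion n G2)).
  by move=> /fg_sub_gen <-; apply: convex_gen.
have EW : W = g @` (e @` C).
  by apply/seteqP; split=> [_ [x Cx <-]|_ [x Cx <-]]; exists x; rewrite ?fg.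
have WX : W `<=` X by apply/image_subset/image_subset.
have WY : W `<=` Y by rewrite EW; apply/image_subset/image_subset.
have XR : X `<=` range f by move=> _ [x _ <-]; exists x.
have YR : Y `<=` range g by move=> _ [x _ <-]; exists x.
have cX := cvx2 _ (fg_sub_image fE fA2).
have cY := cvx2 _ (fg_sub_image gE fB2).
have stR := strong_sub st (@sub_hull _ n _) (@subsetT _ _).
(* Starting from the amalgam of two full copies, the second is shrunk to [Y] and then, with the
   sides exchanged, the first to [X]. *)
have [am1 st1 _ _] := free_amalgam_shrink n3 nG2 cY YR WY am stR.
rewrite setUC in st1.
have [am2 st2 _ _] := free_amalgam_shrink n3 nG2 cX XR WX (free_amalgamC am1) st1.
have [hI _ _] := hE.
have hadj (x y : free_completion n G2) : adj (h x : Gam) (h y : Gam) = adj x y.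
  exact: embedding_adj.
have amh := (@free_amalgam_embed (free_completion n G2) Gam h X Y W hI hadj).2 (free_amalgamC am2).
split; first exact: amh.
rewrite -image_setU -(gen_hull gG n3) (gen_image hE) (gen_hull nG2 n3).
apply/(@strong_embed (free_completion n G2) Gam h hI hadj).
by rewrite setUC.
Qed.

End Existence.

(** * Existence over the empty set *)

Section ExistenceEmpty.
Variables (n : nat) (Gam : graph).
Hypotheses (n3 : 2 < n) (gG : generalized_ngon n Gam).
Hypothesis lim : fraisse_limit (@free_class n) (Ln n Gam).
Local Notation L := (Ln n Gam).

Let homG : homogeneous L. Proof. by case: lim. Qed.
Let adjS : symmetric (@adj Gam). Proof. by case: gG => -[]. Qed.

Definition far (x y : Gam) m := forall p, upath x p -> last x p = y -> m <= size p.

Lemma opposite_pair : exists x z : Gam, far x z n.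
Proof.
apply: contrapT => H; have [_ [_ minn] _] := gG.
suff /minn : diam_le Gam n.-1 by lia.
move=> x y; have [_ [d _] _] := gG; have [l dl _] := d x y.
exists l => //; rewrite -ltnS prednK; last by apply: ltn_trans n3.
have [p [up El lt]] : exists p, [/\ upath x p, last x p = y & size p < n].
  apply: contrapT => H'; apply: H; exists x, y => p up El.
  by rewrite leqNgt; apply/negP => lt; apply: H'; exists p.
case: dl => q gq <-; apply: leq_ltn_trans lt; apply: gq.2.
by split=> //; case/andP: up.
Qed.

Lemma far_sym x y m : far x y m -> far y x m.
Proof.
move=> fxy p up El; have ur := upath_rev adjS up.
by have := fxy _; rewrite -El => /(_ _ ur (last_rev_belast _ _)); rewrite size_rev size_belast.
Qed.

Lemma far_automorphism (h : L -> L) x y m : automorphism h ->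
  far x y m -> far (h x) (h y) m.
Proof.
move=> ha fxy p up El; have [h' ha' [hK h'K]] := automorphism_inv ha.
have [_ eh'] := ha'; have [h'I _ _] := eh'.
have h'adj (u v : Gam) : adj (h' u : Gam) (h' v : Gam) = adj u v by apply: embedding_adj.
rewrite -(size_map h'); apply: fxy.
  by rewrite -[x]hK (embed_upath (f := h' : Gam -> Gam)).
by rewrite -[x]hK last_map El hK.
Qed.

Lemma upath_closed (x : Gam) p : upath x p -> last x p = x -> p = [::].
Proof.
case: p => // y p /andP[_ /andP[nx _]] E; case/negP: nx.
by rewrite -{1}E; apply: (mem_last y p).
Qed.

Lemma far_pair_convex (u v : Gam) : far u v n -> convex n [set x | x = u \/ x = v].
Proof.
move=> fuv x p up lt Xx Xl _; have fvu := far_sym fuv.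
suff -> : p = [::] by [].
case: Xx Xl => [Ex|Ex] [El|El]; first by apply: (upath_closed up); rewrite El Ex.
- by move: lt; rewrite Ex in up El; rewrite ltnNge fuv.
- by move: lt; rewrite Ex in up El; rewrite ltnNge fvu.
- by apply: (upath_closed up); rewrite El Ex.
Qed.

Lemma gens1 (x : L) : gens [:: x] = [set x].
Proof.
rewrite /gens gen_hull // hull_id; first by apply/seteqP; split=> y /=; rewrite inE => /eqP.
move=> u p up _ /=; rewrite !inE => /eqP Eu /eqP El _.
by rewrite (upath_closed up) // El Eu.
Qed.

(* A point opposite to some [x0], chosen independent from [T] over [x0]. *)
Lemma far_point (T : set L) : fg_sub T ->
  exists x : Gam, forall y, T y -> far x y n.-1.
Proof.
move=> fT; have [x0 [z fxz]] := opposite_pair.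
pose X0 : set L := gens [:: (x0 : L)].
have fx : fg_sub X0 by exists [:: (x0 : L)].
have x0x : X0 x0 by rewrite /X0 gens1.
have [|z' /(same_typeP homG _ _ fx)[h [ha Ez hx]]] :=
    @indep_existence_nonempty n Gam n3 gG lim 1 [tuple (z : L)] T X0 fT fx.
  by exists x0.
have fw : far x0 (h z) n by have := far_automorphism ha fxz; rewrite hx.
rewrite -Ez [map h _]/= => /(indepE n3 gG).
set w := h z in fw *; set A := gen (_ `|` X0); set E := gen (T `|` _).
move=> [[AE eAE] sAE].
have neq : w <> x0.
  move=> Ew; have : n <= 0 by apply: (fw [::]); rewrite //= Ew.
  by lia.
have Apair u : A u -> u = x0 \/ u = w.
  have: A `<=` [set x | x = x0 \/ x = w]; last exact.
  rewrite /A gen_hull //; apply: hull_min; first exact: far_pair_convex.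
  by rewrite /X0 !gens1 => v [->|->]; [right|left].
have Aw : A w by apply: sub_gen; left; rewrite gens1.
have nEw : ~ E w.
  by move=> Ew; have : (A `&` E) w by []; rewrite AE /X0 gens1.
exists w => y Ty p up El; rewrite leqNgt; apply/negP => lt.
have Ey : E y by apply: sub_gen; left.
(* Inside the amalgam [w] has no neighbour: freeness leaves only [x0], which is opposite. A path
   from [w] to [T] therefore contains an excursion, of length at least [n - 1] by strength. *)
have [v vp nv] : exists2 v, v \in p & ~ (A `|` E) v.
  apply: contrapT => H; case: p up El lt H => [|v p] up El lt H.
    by apply: nEw; rewrite -[w]/(last w [::]) El.
  have Xv : (A `|` E) v.
    by apply: contrapT => nv; apply: H; exists v; rewrite ?mem_head.
  have wv : adj w v by case/andP: up => /= /andP[].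
  have [[_ Av]|[Ew _]] := eAE w v (or_introl Aw) Xv wv; last by [].
  have nwv : w != v by case/andP: up => _ /= /andP[]; rewrite inE negb_or => /andP[].
  have [Ev|Ev] := Apair v Av; last by rewrite Ev eqxx in nwv.
  have := far_sym fw (p := [:: v]); rewrite /upath /= inE wv nwv Ev => /(_ isT erefl) /=.
  by lia.
have [||a [q [b [exc _ _ le _]]]] := path_excursion up _ _ vp nv.
- by left.
- by rewrite El; right.
have lt' : (size q).+1 < n by lia.
have qZ := excursion_sub (@hull_convex _ n (A `|` E)) (@sub_hull _ n _) exc lt'.
have := arc_size n3 sAE exc qZ lt'; lia.
Qed.

(* Over the empty set the free amalgam is disconnected and has no free completion.
   Instead take [a'] independent from [B] over a point [x] at distance at least
   [n - 1] from [B]; paths from [gens a'] to [B] then pass through [x] and are long. *)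
Lemma indep_existence_empty m (a : m.-tuple L) (B : set L) : fg_sub B ->
  exists2 a' : m.-tuple L, same_type set0 a a' & ngon_indep (gens a') B set0.
Proof.
move=> fB; have fa : fg_sub (gens a) by exists a.
(* [x] is also taken far from [gens a], so that [x], being fixed by [h] below, does not lie in
   [gens a']. *)
have [x farx] := far_point (fg_sub_genU fa fB).
pose X0 : set L := gens [:: (x : L)].
have EX : X0 = [set x] by apply: gens1.
have fx : fg_sub X0 by exists [:: (x : L)].
have f0 : fg_sub (set0 : set L).
  by exists [::]; symmetry; apply/seteqP; split=> //; apply: gen_min.
have [|a' /(same_typeP homG _ _ fx)[h [ha Ea hx]]] :=
    @indep_existence_nonempty n Gam n3 gG lim m a B X0 fB fx.
  by exists x; rewrite EX.
move=> /(indepE n3 gG); set A1 := gen (gens a' `|` X0); set B1 := gen (B `|` X0).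
move=> [[AB eAB] sAB].
exists a'.
  by apply/(same_typeP homG _ _ f0); exists h; split.
have notfar y : ~ far y y n.-1.
  move=> fyy; have : n.-1 <= 0 by apply: (fyy [::]).
  by lia.
have nBx y : B y -> y <> x.
  by move=> By E; apply: (@notfar y); rewrite {1}E; apply: farx; apply: sub_gen; right.
have hxx : h x = x by apply: hx; rewrite EX.
have nAx y : gens a' y -> y <> x.
  rewrite -Ea gens_map // => -[y0 ay0 <-] Ey; apply: (@notfar x).
  have Eyx : y0 = x by case: ha => _ [hI _ _]; apply: hI; rewrite hxx.
  by rewrite -{2}Eyx; apply: farx; apply: sub_gen; left.
have farB b : B b -> far x b n.-1 by move=> Bb; apply: farx; apply: sub_gen; right.
have AA : gens a' `<=` A1 by move=> y Ay; apply: sub_gen; left.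
have BB : B `<=` B1 by move=> y By; apply: sub_gen; left.
have only y : A1 y -> B1 y -> y = x by move=> Ay By; have : (A1 `&` B1) y by []; rewrite AB EX.
have cA : convex n (gens a' : set Gam) by apply: convex_gen.
have cB : convex n (B : set Gam) by rewrite -(fg_sub_gen fB); apply: convex_gen.
have amal : free_amalgam (A1 : set Gam) B1 X0 by split.
(* Such a path passes through [x], which is not its start, and needs at least [n - 1] further steps
   to reach [B]. *)
have mixed u p : upath u p -> gens a' u -> B (last u p) ->
    (forall z, z \in p -> (A1 `|` B1 : set Gam) z) -> n <= size p.
  move=> up Au Bl pY.
  have [y yp Xy] : exists2 y, y \in p & X0 y.
    have /andP[wp _] := up; apply: (cross_path amal wp pY).
    - by left; apply: AA.
    - by move=> B1u; apply: (nAx u Au); apply: only => //; apply: AA.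
    - by move=> A1l; apply: (nBx _ Bl); apply: only => //; apply: BB.
  rewrite EX in Xy; rewrite {}Xy in yp.
  have [p1 [p2 Ep]] := split_seq yp.
  rewrite Ep -cat_rcons in up; have := upath_catr up; rewrite last_rcons => ux.
  have := farB _ Bl p2 ux; rewrite Ep -cat_rcons last_cat last_rcons => /(_ erefl).
  by rewrite size_cat size_rcons; lia.
have XY : gens a' `|` B `<=` A1 `|` B1 by move=> y [/AA|/BB]; [left|right].
(* Excursions with both ends on one side are excluded by the convexity of that side, the others by
   [mixed]. *)
have rX : rconvex n (gens a' `|` B : set Gam) (A1 `|` B1).
  apply: rconvexP => u q v exc lt qY; have [Xu Xv up q0 nq] := exc.
  have pY z : z \in rcons q v -> (A1 `|` B1 : set Gam) z.
    by rewrite mem_rcons inE => /predU1P[->|/qY//]; apply: XY.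
  have one (S : set Gam) : convex n S -> S `<=` gens a' `|` B -> S u -> S v -> False.
    move=> cS sS Su Sv; apply: (@excursion_convex _ n S u q v cS) => //.
    by split=> // z zq /sS; apply: nq.
  case: Xu Xv => [Au|Bu] [Av|Bv].
  - exact: (one (gens a')).
  - by have := mixed u (rcons q v) up Au; rewrite last_rcons size_rcons leqNgt lt => /(_ Bv pY).
  - have := upath_rev adjS up; rewrite last_rcons belast_rcons rev_cons => ur.
    have := mixed v _ ur Av; rewrite last_rcons size_rcons size_rev leqNgt lt.
    move=> /(_ Bu) H; suff: false by []; apply: H => z.
    by rewrite mem_rcons inE mem_rev => /predU1P[->|/qY//]; apply: XY; right.
  - exact: (one B).
have cZ := @hull_convex Gam n (A1 `|` B1).
(* This passes from strength of the amalgam over [x] to strength of the union without [x]. *)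
have [_ _ _ sX] := hull_strong adjS n3 sAB cZ XY rX.
apply/(indepE n3 gG); rewrite !setU0 (gen_id (@gen_sub _ L _)) (fg_sub_gen fB).
split=> //; split.
  apply/seteqP; split=> // y [Ay By]; apply: (nAx y Ay); apply: only; [exact: AA|exact: BB].
move=> u v Xu Xv uv; have [[A1u A1v]|[B1u B1v]] := eAB u v (XY _ Xu) (XY _ Xv) uv.
  left; split; [case: Xu|case: Xv] => // By; case: (nBx _ By); apply: only => //; exact: BB.
right; split; [case: Xu|case: Xv] => // Ay; case: (nAx _ Ay); apply: only => //; exact: AA.
Qed.

End ExistenceEmpty.

Theorem lemma5p6 (n : nat) (n_ge3 : 3 <= n) (Gamma : graph)
    (Gamma_ngon : generalized_ngon n Gamma)
    (Gamma_limit : fraisse_limit (@free_class n) (Ln n Gamma)) :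
  stationary_independence (@ngon_indep n Gamma).
Proof.
have hom : homogeneous (Ln n Gamma) by case: Gamma_limit.
split.
- exact: indep_invariance.
- by move=> h A B C ha _ _ _; apply: indep_automorphism.
- by move=> A B C _ _ _; apply: indep_sym.
- by move=> A B C D _ _ _ _; apply: indep_monotonicity.
- move=> m a B C fB fC; have [C0|/set0P nC0] := eqVneq C set0.
    by rewrite C0; apply: indep_existence_empty.
  exact: indep_existence_nonempty.
- by move=> m a a' B C fB fC; apply: indep_stationarity.
Qed.
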